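(* Assume that H1 and H2 hold and that $\mathcal{K}\subset\Omega\times W^{1,\infty}$ is a positively $\Pi$-invariant compact set projecting over the whole base and such that each one of its elements admits at least one backward extension in $\mathcal{K}$. Let $\lambda_{\mathcal{K}}$ be the upper Lyapunov exponent of $\mathcal{K}$ and let $\rho_0=\sup\{\|\bar x\|_{W^{1,\infty}}\,|\;(\omega,\bar x)\in\mathcal{K}\}$. The following statements are equivalent: (1) $\lambda_{\mathcal{K}}<0$. (2) There exists $\beta>0$ satisfying the following property: if we fix $\rho>\rho_0$, there exist constants $k_1=k_1(\rho)>0$ and $\delta_1=\delta_1(\rho)>0$ such that, if $(\omega,\bar x)\in\mathcal{K}$ and $(\omega,x)\in\Omega\times W^{1,\infty}$ satisfy $\|x\|_{W^{1,\infty}}\le\rho$ and $\|x-\bar x\|_C\le\delta_1$, then $y(t,\omega,x)$ is defined for $t\in[-r,\infty)$ and $$|y(t,\omega,x)-y(t,\omega,\bar x)|\le k_1e^{-\beta t}\|x-\bar x\|_C\quad\text{for all }t\ge-r,$$ so that $$\|u(t,\omega,x)-u(t,\omega,\bar x)\|_C\le k_1e^{\beta r}e^{-\beta t}\|x-\bar x\|_C\quad\text{for all }t\ge0.$$ (3) The set $\mathcal{K}$ is exponentially stable; i.e., there exist $\beta>0$, $k_2\ge1$ and $\delta_2>0$ such that, if $(\omega,\bar x)\in\mathcal{K}$ and $(\omega,x)\in\Omega\times W^{1,\infty}$ satisfy $\|x-\bar x\|_{W^{1,\infty}}<\delta_2$, then $u(t,\omega,x)$ is defined for $t\in[0,\infty)$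 and $$\|u(t,\omega,x)-u(t,\omega,\bar x)\|_{W^{1,\infty}}\le k_2e^{-\beta t}\|x-\bar x\|_{W^{1,\infty}}\quad\text{for all }t\ge0.$$ In addition, if (1) holds, then any $\beta\in(0,-\lambda_{\mathcal{K}})$ can be taken in (2) and (3) (changing the constants $\delta_1,k_1,\delta_2,k_2$ if required).
   Context: Fix $r>0$ and $n\ge1$. $C=C([-r,0],\mathbb{R}^n)$ with the supremum norm $\|\cdot\|_C$; $W^{1,\infty}$ is the Banach space of Lipschitz functions $\psi:[-r,0]\to\mathbb{R}^n$ with norm $\|\psi\|_{W^{1,\infty}}=\max\{\|\psi\|_C,\|\dot\psi\|_{L^\infty}\}$. For a continuous function $y$ on $[t-r,t]$, $y_t(s)=y(t+s)$, $s\in[-r,0]$. $(\Omega,\sigma,\mathbb{R})$ is a continuous flow on a compact metric space, and $\omega\cdot t=\sigma(t,\omega)$. $\mathrm{Lin}(X,Y)$ is the space of bounded linear maps with the operator norm. Consider the family of equations, for $\omega\in\Omega$, $$\dot y(t)=F(\omega\cdot t,\,y(t),\,y(t-\tau(\omega\cdot t,y_t))),\quad t\ge0,$$ with $F:\Omega\times\mathbb{R}^n\times\mathbb{R}^n\to\mathbb{R}^n$ and $\tau:\Omega\times C\to[0,r]$. Conditions: H1: $F$ is continuous and its partial derivatives with respect to the second and third arguments exist and are continuous on $\Omega\times\mathbb{R}^n\times\mathbb{R}^n$. H2: (1) $\tau$ is continuous and differentiable with respect to its second argument, with $D_2\tau:\Omega\times C\to\mathrm{Lin}(C,\mathbb{R})$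 continuous. (2) For every compact subset $\mathcal{C}\subset\Omega\times C$ there is $L_2=L_2(\mathcal{C})>0$ with $\|D_2\tau(\omega,x_1)-D_2\tau(\omega,x_2)\|_{\mathrm{Lin}(C,\mathbb{R})}\le L_2\|x_1-x_2\|_C$ for all $(\omega,x_1),(\omega,x_2)\in\mathcal{C}$. Under these conditions, for each $\omega\in\Omega$ and $x\in W^{1,\infty}$ there is a unique maximal solution $y(t,\omega,x)$ with $y(s,\omega,x)=x(s)$ for $s\in[-r,0]$, defined on $[-r,\beta_{\omega,x})$, $0<\beta_{\omega,x}\le\infty$. Put $u(t,\omega,x)(s)=y(t+s,\omega,x)$, which belongs to $W^{1,\infty}$, and $\Pi(t,\omega,x)=(\omega\cdot t,u(t,\omega,x))$ for $t\in[0,\beta_{\omega,x})$. A set $\mathcal{M}$ is positively $\Pi$-invariant if $\beta_{\omega,x}=\infty$ and $\Pi(t,\omega,x)\in\mathcal{M}$ for all $(\omega,x)\in\mathcal{M}$, $t\ge0$. It projects over the whole base if for every $\omega\in\Omega$ there is $x$ with $(\omega,x)\in\mathcal{M}$. A point $(\omega,x)\in\mathcal{M}$ admits a backward extension in $\mathcal{M}$ if there is a continuous $\theta:(-\infty,0]\to\mathcal{M}$ with $\theta(0)=(\omega,x)$ and $\Pi(t,\theta(s))=\theta(t+s)$ whenever $s\le-t\le0$. The existence of backward extensions implies that $\bar x$ is $C^1$ for all $(\omega,\bar x)\in\mathcal{K}$. For $(\omega,\bar x)\in\mathcal{K}$ and $\phi\in C$ define $$\begin{aligned}L(\omega,\bar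 x)\phi={}&D_2F(\omega,\bar x(0),\bar x(-\tau(\omega,\bar x)))\phi(0)+D_3F(\omega,\bar x(0),\bar x(-\tau(\omega,\bar x)))\phi(-\tau(\omega,\bar x))\\&-D_3F(\omega,\bar x(0),\bar x(-\tau(\omega,\bar x)))\,\dot{\bar x}(-\tau(\omega,\bar x))\cdot D_2\tau(\omega,\bar x)\phi .\end{aligned}$$ For $v\in C$ let $z(t,\omega,\bar x,v)$, $t\ge-r$, be the solution of $\dot z(t)=L(\Pi(t,\omega,\bar x))z_t$, $t\ge0$, with $z(s)=v(s)$ on $[-r,0]$, and let $w(t,\omega,\bar x,v)(s)=z(t+s,\omega,\bar x,v)$, $s\in[-r,0]$ (which lies in $W^{1,\infty}$ if $v$ does). The upper Lyapunov exponent of $\mathcal{K}$ is (with $\ln0=-\infty$) $$\lambda_{\mathcal{K}}=\sup_{(\omega,\bar x)\in\mathcal{K}}\ \sup_{0\ne v\in W^{1,\infty}}\limsup_{t\to\infty}\tfrac1t\ln\|w(t,\omega,\bar x,v)\|_{W^{1,\infty}},$$ which coincides with the analogous quantity $\sup_{(\omega,\bar x)\in\mathcal{K}}\sup_{0\ne v\in C}\limsup_{t\to\infty}\frac1t\ln\|w(t,\omega,\bar x,v)\|_C$. *)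

(* Defs.v *)
From HB Require Import structures.
From mathcomp Require Import all_boot all_order all_algebra.
From mathcomp Require Import all_classical all_reals all_analysis.
From mathcomp Require Import ess_sup_inf.
From mathcomp Require Import lra.

Set Implicit Arguments.
Unset Strict Implicit.
Unset Printing Implicit Defensive.

Import Order.TTheory GRing.Theory Num.Theory.
Import numFieldNormedType.Exports.

Local Open Scope classical_set_scope.
Local Open Scope ring_scope.

Section lipschitz_ae.
Context {R : realType}.
Local Notation mu := (@lebesgue_measure R).

Lemma stieltjes_null (g : cumulative R R) (K : R) : 0 < K ->
  (forall x y, x <= y -> g y - g x <= K * (y - x)) ->
  forall A, mu A = 0%E -> lebesgue_stieltjes_measure g A = 0%E.
Proof.
move=> K0 gK A A0; apply/eqP; rewrite eq_le measure_ge0 andbT.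
apply/lee_addgt0Pr => e e0; rewrite add0e.
have : (mu A < (e / K)%:E)%E by rewrite A0 lte_fin divr_gt0.
rewrite /lebesgue_measure /lebesgue_stieltjes_measure /measure_extension /=.
rewrite /mu_ext => /ereal_inf_lt[_ [C CA <-]] Ce.
apply: (@le_trans _ _ (\sum_(k <oo) wlength g (C k))%E).
  by apply: ereal_inf_lbound; exists C.
have wK k : (wlength g (C k) <= K%:E * wlength idfun (C k))%E.
  have [/(_ k)] := CA; case/ocitvP => [-> _|[[a b] /= ab ->] _].
    by rewrite !wlength0 mule0.
  by rewrite !wlength_itv_bnd ?(ltW ab)//= -EFinM lee_fin gK// ltW.
apply: (@le_trans _ _ (\sum_(k <oo) (K%:E * wlength idfun (C k))%E)%E).
  by apply: lee_nneseries => // k _ _; exact: wlength_ge0.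
rewrite nneseriesZl; last by move=> k _; exact: (wlength_ge0 idfun).
rewrite muleC -lee_pdivlMr// -EFinM; exact: ltW.
Qed.

Lemma nd_lipschitz_ae (g : R -> R) (K : R) (a b : R) : 0 < K ->
  {homo g : x y / x <= y} ->
  (forall x y, x <= y -> g y - g x <= K * (y - x)) ->
  {ae mu, forall x, x \in `]a, b[ -> derivable g x 1}.
Proof.
move=> K0 ndg gK.
have cg : continuous g.
  move=> x; apply/cvgrPdist_le => e e0; near=> y.
  have le1 : `|g x - g y| <= K * `|x - y|.
    have [xy|/ltW yx] := leP x y.
      by rewrite distrC ger0_norm ?subr_ge0 ?ndg// distrC ger0_norm ?subr_ge0// gK.
    by rewrite ger0_norm ?subr_ge0 ?ndg// ger0_norm ?subr_ge0// gK.
  rewrite (le_trans le1)// mulrC -ler_pdivlMr//.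
  near: y; apply: cvgr_dist_le; [exact: cvg_id|exact: divr_gt0].
have rcg := right_continuousW cg.
pose gc : cumulative R R :=
  HB.pack g (isCumulative.Build R _ R g ndg rcg).
pose D : set (measurableTypeR R) := `]a, b]%classic.
have mD : measurable D by exact: measurable_itv.
have [ba|ab] := leP b a.
  by apply: nearW => x; rewrite in_itv/= => /andP[/lt_trans h /h]; rewrite ltNge ba.
have itvE (x y : R) : x <= y ->
    lebesgue_stieltjes_measure gc `]x, y]%classic = (g y - g x)%:E.
  move=> xy; transitivity (wlength gc `]x, y]%classic).
    by apply: (@measurable_mu_extE _ _ _ (wlength gc)); exact: is_ocitv.
  by rewrite wlength_itv_bnd.
have nuDy : (lebesgue_stieltjes_measure gc D < +oo)%E.
  by rewrite itvE ?ltW// ltry.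
pose nu := mfrestr mD nuDy.
have numu : nu `<< mu.
  apply/null_content_dominatesP => A mA A0; rewrite /nu /= /mfrestr /mrestr.
  apply: (stieltjes_null K0) => //.
  by apply/eqP; rewrite eq_le measure_ge0 andbT -A0 le_measure ?inE//; exact: measurableI.
have [h [h0 hfin hint nuE]] := radon_nikodym_sigma_finite numu.
pose f := fine \o h.
have fE : EFin \o f = h by apply/funext => x /=; rewrite fineK.
have intf y : mu.-integrable [set` Interval (BRight a) (BRight y)] (EFin \o f).
  by rewrite fE; apply: (integrableS measurableT).
have locf : locally_integrable [set: R] f.
  by apply: open_integrable_locally; [exact: openT|rewrite fE].
have := FTC1 intf locf.
apply: filterS; first exact: (ae_filter_ringOfSetsType mu).
move=> x /= + xab; move: xab; rewrite in_itv /= => /andP[ax xb].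
rewrite lte_fin => /(_ ax)[dF _].
have := derivableD dF (derivable_cst (g a) x 1).
apply: near_eq_derivable; near=> y.
have ay : a < y by near: y; exact: lt_nbhsr.
have yb : y < b by near: y; exact: lt_nbhsl.
change (fine (\int[mu]_(t in `]a, y]) (EFin \o f) t)%E + g a = g y); rewrite fE.
rewrite -nuE; last exact: measurable_itv.
rewrite /nu /= /mfrestr /mrestr.
rewrite (_ : _ `&` _ = `]a, y]%classic); last first.
  apply/setIidPl => z; rewrite /D /= !in_itv/= => /andP[-> zy].
  by rewrite (le_trans zy)// ltW.
by rewrite itvE ?ltW//= subrK.
Unshelve. all: by end_near. Qed.

Lemma lipschitz_ae (g : R -> R) (K : R) (a b : R) :
  (forall x y, `|g x - g y| <= K * `|x - y|) ->
  {ae mu, forall x, x \in `]a, b[ -> derivable g x 1}.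
Proof.
move=> gK.
pose K1 := `|K| + 1.
have K1K : K <= K1 by rewrite /K1 (le_trans (ler_norm _))// lerDl.
have K10 : 0 < K1 by rewrite /K1 ltr_wpDl.
have gK1 x y : x <= y -> `|g y - g x| <= K1 * (y - x).
  move=> xy; rewrite (le_trans (gK _ _))// ger0_norm ?subr_ge0//.
  by rewrite ler_wpM2r// subr_ge0.
pose f x := g x + K1 * x.
have ndf : {homo f : x y / x <= y}.
  move=> x y xy; rewrite /f.
  by have := gK1 _ _ xy; rewrite ler_norml => /andP[]; lra.
have fK x y : x <= y -> f y - f x <= (2 * K1) * (y - x).
  move=> xy; rewrite /f.
  by have := gK1 _ _ xy; rewrite ler_norml => /andP[]; lra.
have K20 : 0 < 2 * K1 by rewrite mulr_gt0.
have H := nd_lipschitz_ae a b K20 ndf fK.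
apply: filterS H.
  exact: (ae_filter_ringOfSetsType mu).
move=> x H xab; have df := H xab.
have dK : derivable (fun y : R => K1 * y) x 1.
  by apply: derivableM; [exact: derivable_cst|exact: derivable_id].
have -> : g = f - (fun y => K1 * y).
  by apply/funext => y; rewrite !fctE /f addrK.
exact: derivableB.
Qed.
End lipschitz_ae.


(* Derivative of f at s relative to A: one-sided at the endpoints when A is an
   interval. *)
Section derive_on.
Context {R : realType} {V : normedModType R}.

Definition growth_rate_on (f : R -> V) (s h : R) : V :=
  h^-1 *: (f (h + s) - f s).

Definition has_derive_on (A : set R) (f : R -> V) (s : R) (l : V) : Prop :=
  growth_rate_on f s h @[h --> within [set h | A (h + s)] 0^'] --> l.

Definition derive_on (A : set R) (f : R -> V) (s : R) : V :=
  lim (growth_rate_on f s h @[h --> within [set h | A (h + s)] 0^']).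

End derive_on.

Section history_interval.
Context {R : realType}.
Variable r : {posnum R}.

Definition hitv : set R := `[- r%:num, 0].

Definition clamp (s : R) : R := Num.max (- r%:num) (Num.min 0 s).

Lemma hitv0 : hitv 0.
Proof. by rewrite /hitv/= in_itv/= lexx andbT oppr_le0. Qed.

Lemma clamp_in s : hitv (clamp s).
Proof.
rewrite /hitv/= in_itv/= /clamp le_max lexx/= ge_max oppr_le0 ge_min lexx.
by rewrite andbT.
Qed.

Lemma clamp_id s : hitv s -> clamp s = s.
Proof.
rewrite /hitv/= in_itv/= => /andP[rs s0].
by rewrite /clamp (min_idPr s0) (max_idPr rs).
Qed.

Lemma clamp_lip s t : `|clamp s - clamp t| <= `|s - t|.
Proof.
wlog st : s t / s <= t => [H|].
  by have [/H//|/ltW/H] := leP s t; rewrite distrC (distrC t).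
rewrite distrC (distrC s) (ger0_norm (_ : 0 <= t - s)) ?subr_ge0//.
rewrite /clamp; have := gt0 r; set d := r%:num; move: d => d d0.
rewrite /Num.min /Num.max.
have [s0|s0] := ltP 0 s; have [t0|t0] := ltP 0 t.
- by rewrite subrr normr0 subr_ge0.
- lra.
- case: ltP => h1; case: ltP => h2; rewrite ler_norml; apply/andP; split; lra.
- case: ltP => h1; case: ltP => h2; rewrite ler_norml; apply/andP; split; lra.
Qed.

End history_interval.

(* C([-r, 0], R^n): a function on [-r, 0] is represented by its extension to R
   that is constant on each side of [-r, 0]. *)
Section continuous_histories.
Context {R : realType}.
Variables (r : {posnum R}) (n : nat).

Definition hist : {pred R -> 'rV[R]_n} :=
  mem [set f : R -> 'rV[R]_n | continuous f /\ f \o clamp r = f].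

Record CSpace := MkCSpace {
  Cfun :> R -> 'rV[R]_n;
  Cfun_hist : Cfun \in hist }.

HB.instance Definition _ := [isSub for Cfun].
HB.instance Definition _ := gen_eqMixin CSpace.
HB.instance Definition _ := gen_choiceMixin CSpace.

Lemma hist_submod_closed : submod_closed hist.
Proof.
split.
  by rewrite inE/=; split => [s|]; [exact: cvg_cst|exact/funext].
move=> a f g; rewrite !inE/= => -[cf fE] [cg gE]; split => [s|].
  by apply: cvgD; [apply: cvgZr; exact: cf|exact: cg].
by rewrite -[in RHS]fE -[in RHS]gE.
Qed.

HB.instance Definition _ :=
  GRing.isSubmodClosed.Build _ _ hist hist_submod_closed.
HB.instance Definition _ := [SubChoice_isSubLmodule of CSpace by <:].

Lemma CfunP (x y : CSpace) : {in hitv r, x =1 y} -> x = y.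
Proof.
move=> xy; apply/val_inj/funext => s /=.
have := Cfun_hist x; rewrite inE => -[_ <-].
have := Cfun_hist y; rewrite inE => -[_ <-] /=.
by apply: xy; rewrite inE; exact: clamp_in.
Qed.

Definition sup_norm (x : CSpace) : R := sup [set `|x s| | s in hitv r].

Lemma sup_norm_has_sup (x : CSpace) : has_sup [set `|x s| | s in hitv r].
Proof.
split; first by exists `|x 0|; exists 0 => //; exact: hitv0.
have := Cfun_hist x; rewrite inE => -[cx _].
have : compact [set `|x s| | s in hitv r].
  apply: continuous_compact; last exact: segment_compact.
  apply: continuous_subspaceT => s.
  by apply: continuous_comp; [exact: cx|exact: norm_continuous].
move=> /compact_bounded[M [_ /(_ (M + 1))]].
rewrite ltrDl ltr01 => /(_ isT) MB; exists (M + 1) => y Ay.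
by apply: le_trans (MB _ Ay); exact: ler_norm.
Qed.

Lemma sup_norm_ge (x : CSpace) s : hitv r s -> `|x s| <= sup_norm x.
Proof.
move=> rs; apply: sup_upper_bound; first exact: sup_norm_has_sup.
by exists s.
Qed.

Lemma sup_norm_le (x : CSpace) M :
  (forall s, hitv r s -> `|x s| <= M) -> sup_norm x <= M.
Proof.
move=> xM; apply: ge_sup; first by have [] := sup_norm_has_sup x.
by move=> _ [s rs <-]; exact: xM.
Qed.

Lemma sup_normD x y : sup_norm (x + y) <= sup_norm x + sup_norm y.
Proof.
apply: sup_norm_le => s rs; apply: (le_trans (ler_normD _ _)).
by apply: lerD; exact: sup_norm_ge.
Qed.

Lemma sup_normZ_le (l : R) x : sup_norm (l *: x) <= `|l| * sup_norm x.
Proof.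
apply: sup_norm_le => s rs; rewrite [leLHS]normrZ ler_wpM2l//.
exact: sup_norm_ge.
Qed.

Lemma sup_normZ (l : R) x : sup_norm (l *: x) = `|l| * sup_norm x.
Proof.
apply/eqP; rewrite eq_le sup_normZ_le/=.
have [->|l0] := eqVneq l 0.
  rewrite normr0 mul0r; apply: le_trans (sup_norm_ge _ (hitv0 r)).
  exact: normr_ge0.
rewrite -ler_pdivlMl ?normr_gt0//.
have := sup_normZ_le l^-1 (l *: x).
by rewrite scalerA mulVf// scale1r normfV.
Qed.

Lemma sup_norm_eq0 x : sup_norm x = 0 -> x = 0.
Proof.
move=> x0; apply: CfunP => s; rewrite inE => rs.
by apply/eqP; rewrite -normr_le0 -x0 sup_norm_ge.
Qed.

HB.instance Definition _ :=
  Lmodule_isNormed.Build R CSpace sup_normD sup_normZ sup_norm_eq0.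

End continuous_histories.

Section lipschitz_histories.
Context {R : realType}.
Variables (r : {posnum R}) (n : nat).
Local Notation mu := (@lebesgue_measure R).
Local Notation C := (CSpace r n).

Definition lip_hist : {pred C} :=
  mem [set x : C | [lipschitz x s | s in hitv r]].

Record WSpace := MkWSpace {
  toC :> C;
  toC_lip : toC \in lip_hist }.

HB.instance Definition _ := [isSub for toC].
HB.instance Definition _ := gen_eqMixin WSpace.
HB.instance Definition _ := gen_choiceMixin WSpace.

Lemma lip_histP (x : C) : x \in lip_hist <->
  exists K, forall s t, `|x s - x t| <= K * `|s - t|.
Proof.
rewrite inE /=; split => [[M [_ /(_ (M + 1))]]|[K xK]].
  rewrite ltrDl ltr01 => /(_ isT) xM; exists (`|M| + 1) => s t.
  have := Cfun_hist x; rewrite inE => -[_ <-] /=.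
  apply: (le_trans (xM (clamp r s, clamp r t) _)).
    by split; exact: clamp_in.
  rewrite /= (@le_trans _ _ ((`|M| + 1) * `|clamp r s - clamp r t|))//.
    by rewrite ler_wpM2r// lerD2r ler_norm.
  by rewrite ler_wpM2l ?clamp_lip// addr_ge0.
exists K; split; first exact: num_real.
move=> M KM [s t] _ /=; apply: (le_trans (xK _ _)).
by rewrite ler_wpM2r// ltW.
Qed.

Lemma lip_hist_submod_closed : submod_closed lip_hist.
Proof.
split; first by apply/lip_histP; exists 0 => s t; rewrite subrr normr0 mul0r.
move=> a x y /lip_histP[K xK] /lip_histP[L yL].
apply/lip_histP; exists (`|a| * K + L) => s t.
rewrite (_ : _ - _ = a *: (x s - x t) + (y s - y t)); last first.
  by rewrite scalerBr addrACA -opprD.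
rewrite (le_trans (ler_normD _ _))// mulrDl lerD//.
by rewrite normrZ -mulrA ler_wpM2l.
Qed.

HB.instance Definition _ :=
  GRing.isSubmodClosed.Build _ _ lip_hist lip_hist_submod_closed.
HB.instance Definition _ := [SubChoice_isSubLmodule of WSpace by <:].

(* The L^oo norm of the derivative, which exists almost everywhere by
   W_derivable_ae below. *)
Definition ess_norm_derive (x : WSpace) : \bar R :=
  'N[mu]_+oo[(fun s => `|derive_on (hitv r) x s|%:E) \_ (hitv r)]%E.

Definition W_norm (x : WSpace) : R :=
  Num.max `|toC x| (fine (ess_norm_derive x)).

Lemma W_derivable_ae (x : WSpace) :
  {ae mu, forall s, s \in `]- r%:num, 0[ -> derivable x s 1}.
Proof.
have /lip_histP[K xK] := toC_lip x.
have H (j : 'I_n) : {ae mu, forall s, s \in `]- r%:num, 0[ ->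
    derivable (fun t => x t ord0 j) s 1}.
  apply: (@lipschitz_ae _ _ K) => s t.
  apply: le_trans (xK s t).
  rewrite [leRHS]/Num.Def.normr/= mx_normrE.
  apply: le_trans; last exact: (le_bigmax _ _ (ord0, j)).
  by rewrite !mxE.
have {}H : {ae mu, forall s, forall j : 'I_n, s \in `]- r%:num, 0[ ->
    derivable (fun t => x t ord0 j) s 1}.
  apply: filter_forall => //; exact: (ae_filter_ringOfSetsType mu).
apply: filterS H; first exact: (ae_filter_ringOfSetsType mu).
move=> s H sr; apply/derivable_mxP => i j; rewrite ord1; exact: H.
Qed.

Lemma within_hitv s : s \in `]- r%:num, 0[ ->
  within [set h | hitv r (h + s)] 0^' = 0^'.
Proof.
move=> sr.
apply/seteqP; split=> A; rewrite /within /=; last by apply: filterS => h Ah _.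
have : \forall h \near 0^', hitv r (h + s).
  apply: nbhs_dnbhs.
  have hs : (h + s) @[h --> (0 : R)] --> s.
    rewrite -[X in _ --> X]add0r.
    by apply: cvgD; [exact: cvg_id|exact: cvg_cst].
  apply: (filterS _ (hs _ (near_in_itvoo sr))) => h /=.
  by rewrite /hitv /= !in_itv/= => /andP[/ltW -> /ltW ->].
by apply: filterS2 => h hs; exact.
Qed.

Lemma growth_rate_onE (x : R -> 'rV[R]_n) s : growth_rate_on x s =
  (fun h => h^-1 *: ((x \o shift s) (h *: 1) - x s)).
Proof. by apply/funext => h; rewrite /growth_rate_on /= [h *: 1]mulr1. Qed.

Lemma derive_on_hitv (x : R -> 'rV[R]_n) s : s \in `]- r%:num, 0[ ->
  derive_on (hitv r) x s = 'D_1 x s.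
Proof. by move=> sr; rewrite /derive_on within_hitv// growth_rate_onE. Qed.

Lemma hitv_interior_ae :
  {ae mu, forall s, hitv r s -> s \in `]- r%:num, 0[}.
Proof.
have D (a : R) : {ae mu, forall s, s != a}.
  exists [set a]; split => //; first exact: lebesgue_measure_set1.
  by move=> s /= /negP; rewrite negbK => /eqP.
have := D (- r%:num); apply: filterS2 (D 0).
  exact: (ae_filter_ringOfSetsType mu).
move=> s s0 sr; rewrite /hitv /= !in_itv/= !le_eqVlt.
by rewrite (negbTE s0) eq_sym (negbTE sr).
Qed.

Lemma mu_setT_gt0 : (0 < mu [set: R])%E.
Proof.
rewrite (@lt_le_trans _ _ (mu `[0, 1]%classic))//.
  by rewrite lebesgue_measure_itv/= lte_fin ltr01 -EFinB subr0 lte_fin ltr01.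
by rewrite le_measure ?inE//; exact: measurable_itv.
Qed.

Lemma ess_norm_deriveE (x : WSpace) : ess_norm_derive x =
  ess_sup mu
    (fun s => (if s \in hitv r then `|derive_on (hitv r) x s| else 0)%:E).
Proof.
rewrite /ess_norm_derive unlock mu_setT_gt0; congr ess_sup.
apply/funext => s /=; rewrite /patch; case: ifPn => _ /=.
  by rewrite normr_id.
by rewrite normr0.
Qed.

Lemma W_derive_ae (x : WSpace) : {ae mu, forall s,
  hitv r s -> (s \in `]- r%:num, 0[) /\ derivable x s 1}.
Proof.
apply: filterS2 hitv_interior_ae (W_derivable_ae x).
  exact: (ae_filter_ringOfSetsType mu).
by move=> s h1 h2 /h1 sr; split => //; exact: h2.
Qed.

Lemma ess_norm_derive_ge0 x : (0 <= ess_norm_derive x)%E.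
Proof. exact: Lnorm_ge0. Qed.

Lemma ess_norm_derive_fin x : ess_norm_derive x \is a fin_num.
Proof.
rewrite ge0_fin_numE ?ess_norm_derive_ge0// ess_norm_deriveE.
have /lip_histP[K xK] := toC_lip x.
rewrite (@le_lt_trans _ _ `|K|%:E) ?ltry//.
apply/ess_supP.
apply: filterS (W_derive_ae x); first exact: (ae_filter_ringOfSetsType mu).
move=> s /= hs; case: ifPn => rs; last by rewrite lee_fin.
move: rs; rewrite inE => /hs[sr xs]; rewrite derive_on_hitv// lee_fin.
rewrite /derive -lim_norm//; apply: limr_le.
  by apply/cvg_ex; eexists; apply: cvg_norm; exact: xs.
near=> h; have h0 : h != 0 by near: h; exact: nbhs_dnbhs_neq.
rewrite normrZ normfV ler_pdivrMl ?normr_gt0// mulrC.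
apply: (le_trans (xK _ _)); rewrite /= addrK [h *: 1]mulr1.
by rewrite ler_wpM2r// ler_norm.
Unshelve. all: by end_near. Qed.

Lemma ess_norm_deriveD (x y : WSpace) :
  (ess_norm_derive (x + y)%R <= ess_norm_derive x + ess_norm_derive y)%E.
Proof.
rewrite !ess_norm_deriveE; apply: le_trans (ess_supD _ _ _); apply: le_ess_sup.
apply: filterS2 (W_derive_ae x) (W_derive_ae y).
  exact: (ae_filter_ringOfSetsType mu).
move=> s hx hy /=; case: ifPn => rs; last by rewrite -EFinD addr0.
move: rs; rewrite inE => rs; have [sr dx] := hx rs; have [_ dy] := hy rs.
rewrite !derive_on_hitv// -EFinD lee_fin.
by rewrite [X in `|X|](deriveD dx dy) ler_normD.
Qed.

Lemma ess_norm_deriveZ (l : R) (x : WSpace) :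
  (ess_norm_derive (l *: x)%R = `|l|%:E * ess_norm_derive x)%E.
Proof.
rewrite !ess_norm_deriveE -ess_supZl//; last exact: mu_setT_gt0.
apply: eq_ess_sup; apply: filterS (W_derive_ae x).
  exact: (ae_filter_ringOfSetsType mu).
move=> s hx /=; case: ifPn => rs; last by rewrite mule0.
move: rs; rewrite inE => rs; have [sr dx] := hx rs.
by rewrite !derive_on_hitv// -EFinM -normrZ [X in `|X|](deriveZ l dx).
Qed.

Lemma W_normD x y : W_norm (x + y) <= W_norm x + W_norm y.
Proof.
rewrite /W_norm ge_max; apply/andP; split.
  by apply: (le_trans (ler_normD _ _)); apply: lerD; rewrite le_max lexx.
apply: (@le_trans _ _ (fine (ess_norm_derive x) + fine (ess_norm_derive y))).
  rewrite -fineD ?ess_norm_derive_fin// fine_le ?fin_numD ?ess_norm_derive_fin//.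
  exact: ess_norm_deriveD.
by apply: lerD; rewrite le_max lexx orbT.
Qed.

Lemma W_normZ (l : R) x : W_norm (l *: x) = `|l| * W_norm x.
Proof.
by rewrite /W_norm ess_norm_deriveZ fineM ?ess_norm_derive_fin// normrZ maxr_pMr.
Qed.

Lemma W_norm_eq0 x : W_norm x = 0 -> x = 0.
Proof.
move=> x0; apply/val_inj/eqP; rewrite /= -normr_le0 -x0.
by rewrite /W_norm le_max lexx.
Qed.

HB.instance Definition _ :=
  Lmodule_isNormed.Build R WSpace W_normD W_normZ W_norm_eq0.

End lipschitz_histories.

Section operators.
Context {R : realType}.

(* Extended-real valued, so that an unbounded map gets +oo and not the junk
   value of sup. *)
Definition op_norm {X Y : normedModType R} (f : X -> Y) : \bar R :=
  ereal_sup [set `|f x|%:E | x in [set x : X | `|x| <= 1]].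

Definition op_continuous {T : topologicalType} {X Y : normedModType R}
    (D : T -> X -> Y) : Prop :=
  forall p, op_norm (fun v => D q v - D p v) @[q --> p] --> 0%E.

End operators.

Definition continuous_flow {R : realType} {Omega : topologicalType}
    (sigma : R -> Omega -> Omega) : Prop :=
  [/\ continuous (fun p : R * Omega => sigma p.1 p.2),
      forall omega, sigma 0 omega = omega &
      forall s t omega, sigma (s + t) omega = sigma s (sigma t omega)].

Section delay_equation.
Context {R : realType} {r : {posnum R}} {n : nat} {Omega : metricType R}.
Local Notation Rn := 'rV[R]_n.
Local Notation C := (CSpace r n).
Local Notation W := (WSpace r n).
Variable sigma : R -> Omega -> Omega.
Variable F : Omega -> Rn -> Rn -> Rn.
Variable tau : Omega -> C -> R.

Definition D2F (omega : Omega) (a b : Rn) : Rn -> Rn := 'd (F omega ^~ b) a.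
Definition D3F (omega : Omega) (a b : Rn) : Rn -> Rn := 'd (F omega a) b.
Definition D2tau (omega : Omega) (x : C) : C -> R := 'd (tau omega) x.

Definition cond_H1 : Prop :=
  [/\ continuous (fun p : Omega * Rn * Rn => F p.1.1 p.1.2 p.2),
      forall omega a b,
        differentiable (F omega ^~ b) a /\ differentiable (F omega a) b,
      op_continuous (fun p : Omega * Rn * Rn => D2F p.1.1 p.1.2 p.2) &
      op_continuous (fun p : Omega * Rn * Rn => D3F p.1.1 p.1.2 p.2)].

Definition cond_H2 : Prop :=
  [/\ continuous (fun p : Omega * C => tau p.1 p.2),
      forall omega x, differentiable (tau omega) x,
      op_continuous (fun p : Omega * C => D2tau p.1 p.2) &
      forall A : set (Omega * C), compact A ->
        exists2 L2 : R, 0 < L2 & forall omega x1 x2,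
          A (omega, x1) -> A (omega, x2) ->
          (op_norm (fun v => D2tau omega x1 v - D2tau omega x2 v)%R
             <= (L2 * `|x1 - x2|)%:E)%E].

(* The segment y_t, first as an element of C, then as an element of W. The
   default 0 of insubd is reached only when y_t is not in the space. *)
Definition segC (y : R -> Rn) (t : R) : C :=
  insubd 0 (fun s => y (t + clamp r s)).
Definition segW (y : R -> Rn) (t : R) : W := insubd 0 (segC y t).

Definition is_sol (omega : Omega) (x : W) (b : \bar R) (y : R -> Rn) : Prop :=
  [/\ {in hitv r, y =1 x},
      {within [set t : R | - r%:num <= t /\ (t%:E < b)%E], continuous y} &
      forall t : R, 0 <= t -> (t%:E < b)%E ->
        has_derive_on `[0, +oo[ y t
          (F (sigma t omega) (y t)
             (y (t - tau (sigma t omega) (segC y t))))].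

Definition sol_time (omega : Omega) (x : W) : \bar R :=
  ereal_sup [set b : \bar R | (0 < b)%E /\ exists y, is_sol omega x b y].

(* The maximal solution; its values beyond sol_time are irrelevant. *)
Definition sol (omega : Omega) (x : W) : R -> Rn :=
  xget (cst 0) [set y | is_sol omega x (sol_time omega x) y].

Definition usol (t : R) (omega : Omega) (x : W) : W := segW (sol omega x) t.

Definition Pi (t : R) (p : Omega * W) : Omega * W :=
  (sigma t p.1, usol t p.1 p.2).

Definition positively_invariant (M : set (Omega * W)) : Prop :=
  forall p, M p ->
    sol_time p.1 p.2 = +oo%E /\ forall t, 0 <= t -> M (Pi t p).

Definition projects_over_base (M : set (Omega * W)) : Prop :=
  forall omega, exists x, M (omega, x).

Definition backward_extension (M : set (Omega * W)) (p : Omega * W) : Prop :=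
  exists theta : R -> Omega * W,
    [/\ {within [set s : R | s <= 0], continuous theta},
        forall s, s <= 0 -> M (theta s),
        theta 0 = p &
        forall s t, 0 <= t -> s <= - t -> Pi t (theta s) = theta (t + s)].

Definition Lop (p : Omega * W) (phi : C) : Rn :=
  let x := p.2 in
  let d := tau p.1 x in
  D2F p.1 (x 0) (x (- d)) (phi 0) + D3F p.1 (x 0) (x (- d)) (phi (- d))
  - D2tau p.1 x phi *:
      D3F p.1 (x 0) (x (- d)) (derive_on (hitv r) x (- d)).

Definition is_linear_sol (p : Omega * W) (v : C) (z : R -> Rn) : Prop :=
  [/\ {in hitv r, z =1 v},
      {within [set t : R | - r%:num <= t], continuous z} &
      forall t, 0 <= t ->
        has_derive_on `[0, +oo[ z t (Lop (Pi t p) (segC z t))].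

Definition linear_sol (p : Omega * W) (v : C) : R -> Rn :=
  xget (cst 0) [set z | is_linear_sol p v z].

Definition wlin (t : R) (p : Omega * W) (v : C) : W := segW (linear_sol p v) t.

Definition lyapunov_exponent (p : Omega * W) (v : W) : \bar R :=
  limf_esup (fun t : R => t^-1%:E * lne `|wlin t p v|%:E)%E (pinfty_nbhs R).

Definition upper_lyapunov_exponent (K : set (Omega * W)) : \bar R :=
  ereal_sup [set ereal_sup [set lyapunov_exponent p v | v in [set v | v != 0]]
            | p in K].

Definition rho0 (K : set (Omega * W)) : R := sup [set `|p.2| | p in K].

Definition C_exp_stable (K : set (Omega * W)) (beta : R) : Prop :=
  forall rho, rho0 K < rho -> exists k1 delta1, [/\ 0 < k1, 0 < delta1 &
    forall omega (xb x : W), K (omega, xb) ->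
      `|x| <= rho -> `|toC x - toC xb| <= delta1 ->
      [/\ sol_time omega x = +oo%E,
          forall t, - r%:num <= t ->
            `|sol omega x t - sol omega xb t|
              <= k1 * expR (- beta * t) * `|toC x - toC xb| &
          forall t, 0 <= t ->
            `|toC (usol t omega x) - toC (usol t omega xb)|
              <= k1 * expR (beta * r%:num) * expR (- beta * t)
                 * `|toC x - toC xb|]].

Definition W_exp_stable (K : set (Omega * W)) (beta : R) : Prop :=
  exists k2 delta2, [/\ 1 <= k2, 0 < delta2 &
    forall omega (xb x : W), K (omega, xb) -> `|x - xb| < delta2 ->
      sol_time omega x = +oo%E /\
      forall t, 0 <= t ->
        `|usol t omega x - usol t omega xb|
          <= k2 * expR (- beta * t) * `|x - xb|].

End delay_equation.

(* Main.v *)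
Require Import Defs.
From HB Require Import structures.
From mathcomp Require Import all_boot all_order all_algebra.
From mathcomp Require Import all_classical all_reals all_analysis.
From mathcomp Require Import ess_sup_inf.
From mathcomp Require Import lra ring.

Set Implicit Arguments.
Unset Strict Implicit.
Unset Printing Implicit Defensive.

Import Order.TTheory GRing.Theory Num.Theory.
Import numFieldNormedType.Exports.

Local Open Scope classical_set_scope.
Local Open Scope ring_scope.

(* Every point of K is the time-r image of another point of K, so the histories
   in K are C^1 and the W-topology and the C-topology agree on K; hence the
   operators L(p), p in K, are bounded uniformly, and t -> L(Pi(t, p)) is
   continuous when paired with a continuous history. The time-r linearized flow
   maps C boundedly into W, and the unit ball of W is compact in C, so pointwise
   exponential decay along K is uniform: lambda < 0 gives
   |w(t, p, v)|_W <= k e^(-beta t) |v|_W for every beta < - lambda.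

   On a fixed time interval the difference of the solutions through x and xb is
   w(t, xb, x - xb) up to o(|x - xb|_W), uniformly over K. Iterating a long
   enough time step turns the uniform linear decay into nonlinear decay in W;
   since a solution starting C-close to K is W-close to K after time r, this
   also gives the decay in C. Conversely, applying a stability estimate to
   xb + h v and letting h tend to 0 gives the exponential decay of w(t, xb, v).

   Global existence near K is obtained by truncating the values of the history
   at rho0 + 1: the truncated equation has global solutions, and a truncated
   solution that stays at distance at most 1 from K solves the equation. *)

(** The obstacle is the state-dependent delay. For the C-norm, [x (- tau omega x)] is Lipschitz in
    [x] only among histories with a common Lipschitz constant. Estimates are therefore made on the
    sets [hist_ball A N], which are convex and compact in C; they contain the segments of a solution
    because a bound on F along the solution bounds its Lipschitz constant. For the same reason the
    first-order expansion of the right-hand side at a point of K has an error e |h|_C only for h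
    small in W: a change of the delay moves the value of h by at most |h|_W times that change.
    Functions of time live on the whole line and are frozen outside the interval that matters.
    Gronwall and the Picard contraction are both derived from the mean value inequality with the
    majorant e^(2 l t): integrating l e^(2 l t) gives half of e^(2 l t), and this 1/2 is the
    contraction factor. Two strict inequalities between rates are spent: one to make the linear
    decay uniform and absorb its constants, one to pass to the nonlinear equation. Hence every beta
    below - lambda is reached, but not - lambda itself. *)

Lemma nbhs_normW {R : realType} (V : normedModType R) (x : V) (d : R) (P : set V) :
  0 < d -> (forall y, `|x - y| < d -> P y) -> nbhs x P.
Proof.
by move=> d0 H; apply/nbhs_ballP; exists d => // y; rewrite -ball_normE; exact: H.
Qed.

Lemma lipschitz_continuous {R : realType} (V : normedModType R) (f : R -> V) N : 0 <= N ->
  (forall s t, `|f s - f t| <= N * `|s - t|) -> continuous f.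
Proof.
move=> N0 fN s; apply/(@cvgrPdist_le _ _ _ (nbhs s) _ f) => e e0.
have d0 : 0 < e / (N + 1) by rewrite divr_gt0// ltr_wpDl.
apply: (nbhs_normW (x := s) d0) => t st; apply: (le_trans (fN _ _)).
rewrite (@le_trans _ _ ((N + 1) * `|s - t|))//; first by rewrite ler_wpM2r// lerDl.
by rewrite mulrC -ler_pdivlMr ?ltr_wpDl// ltW.
Qed.

(** * Derivatives on the half line and the mean value inequality *)

Section derivative_on_half_line.
Context {R : realType}.
Local Notation Rp := [set` `[0 : R, +oo[].

Lemma has_derive_on_is_derive (V : normedModType R) (y : R -> V) (t : R) l :
  0 < t -> has_derive_on Rp y t l -> is_derive t 1 y l.
Proof.
move=> t0; rewrite /has_derive_on.
have -> : within [set h | Rp (h + t)] 0^' = 0^'.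
  apply/seteqP; split=> A; rewrite /within /=; last by apply: filterS => h Ah _.
  have : \forall h \near 0^', Rp (h + t).
    apply: nbhs_dnbhs; apply/nbhs_ballP; exists t => //= h.
    by rewrite /ball/= sub0r normrN ltr_norml in_itv/= andbT => /andP[]; lra.
  by apply: filterS2 => h hs; exact.
have -> : growth_rate_on y t = (fun h => h^-1 *: ((y \o shift t) (h *: 1) - y t)).
  by apply/funext => h; rewrite /growth_rate_on /= [h *: 1]mulr1.
move=> yl; split; first by apply/cvg_ex; exists l.
exact/cvg_lim.
Qed.

Lemma is_derive_has_derive_on (V : normedModType R) A (y : R -> V) (t : R) l :
  is_derive t 1 y l -> has_derive_on A y t l.
Proof.
move=> [dy yl]; rewrite /has_derive_on.
have -> : growth_rate_on y t = (fun h => h^-1 *: ((y \o shift t) (h *: 1) - y t)).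
  by apply/funext => h; rewrite /growth_rate_on /= [h *: 1]mulr1.
have h : (fun h => h^-1 *: ((y \o shift t) (h *: 1) - y t)) @ 0^' --> l.
  by rewrite -yl; exact: dy.
apply: cvg_trans h; apply: cvg_app; exact: cvg_within.
Qed.

Lemma has_derive_onB (V : normedModType R) A (y z : R -> V) (t : R) l m :
  has_derive_on A y t l -> has_derive_on A z t m ->
  has_derive_on A (fun s => y s - z s) t (l - m).
Proof.
move=> yl zm; rewrite /has_derive_on.
have -> : growth_rate_on (fun s => y s - z s) t =
    (fun h => growth_rate_on y t h - growth_rate_on z t h).
  by apply/funext => h; rewrite /growth_rate_on -scalerBr opprD addrACA -opprD.
exact: cvgB.
Qed.

Lemma has_derive_onZ (V : normedModType R) A (y : R -> V) (t c : R) l :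
  has_derive_on A y t l -> has_derive_on A (fun s => c *: y s) t (c *: l).
Proof.
move=> yl; rewrite /has_derive_on.
have -> : growth_rate_on (fun s => c *: y s) t = (fun h => c *: growth_rate_on y t h).
  by apply/funext => h; rewrite /growth_rate_on -scalerBr scalerA mulrC -scalerA.
exact: cvgZl_tmp.
Qed.

Lemma is_derive_mulr (c t : R) : is_derive t 1 (fun s => c * s) c.
Proof.
have h := is_deriveZ c (is_derive_id t (1 : R)).
by apply: (is_derive_eq h); rewrite [_ *: _]mulr1.
Qed.

Lemma is_derive_coord n (y : R -> 'rV[R]_n) (t : R) (l : 'rV[R]_n) j :
  is_derive t 1 y l -> is_derive t 1 (fun s => y s ord0 j) (l ord0 j).
Proof.
move=> [dy yl]; have dj : derivable (fun s => y s ord0 j) t 1.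
  by have /derivable_mxP := dy; exact.
split => //; rewrite -yl derive_mx// mxE; congr ('D_1 _ t).
Qed.

Lemma is_derive_rV n (y : R -> 'rV[R]_n) (t : R) (l : 'rV[R]_n) :
  (forall j, is_derive t 1 (fun s => y s ord0 j) (l ord0 j)) ->
  is_derive t 1 y l.
Proof.
move=> H; have dy : derivable y t 1.
  by apply/derivable_mxP => i j; rewrite ord1; have [] := H j.
split => //; rewrite derive_mx//; apply/rowP => j; rewrite mxE.
by have [_ <-] := H j.
Qed.

Lemma rV_norm_le n (v : 'rV[R]_n) M : 0 <= M ->
  (forall j, `|v ord0 j| <= M) -> `|v| <= M.
Proof.
move=> M0 H; rewrite [leLHS]mx_normrE; apply: bigmax_le => // -[i j] _ /=.
by rewrite ord1.
Qed.

Lemma coord_norm_le n (v : 'rV[R]_n) j : `|v ord0 j| <= `|v|.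
Proof.
rewrite [leRHS]mx_normrE.
exact: (le_bigmax _ (fun ij => `|v ij.1 ij.2|) (ord0, j)).
Qed.

(** Both [E + y] and [E - y] have a nonnegative derivative, and the mean value theorem compares
    their values at the endpoints. Such majorants [E] take the place of integrals of [|dy|] in the
    estimates below. *)
Lemma mean_value_ineq1 (y dy E e : R -> R) (a b : R) :
  a <= b -> {within `[a, b], continuous y} -> {within `[a, b], continuous E} ->
  (forall t, a < t < b -> is_derive t 1 y (dy t)) ->
  (forall t, a < t < b -> is_derive t 1 E (e t)) ->
  (forall t, a < t < b -> `|dy t| <= e t) ->
  `|y b - y a| <= E b - E a.
Proof.
rewrite le_eqVlt => /predU1P[<- *|ab cy cE hy hE le]; first by rewrite !subrr normr0.
have key (s : R) : `|s| = 1 -> 0 <= (E b + s * y b) - (E a + s * y a).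
  move=> s1.
  have cf : {within `[a, b], continuous (fun t => E t + s * y t)}.
    by move=> t; apply: cvgD; [exact: cE|apply: cvgMl_tmp; exact: cy].
  have df t : t \in `]a, b[ ->
      is_derive t 1 (fun t => E t + s * y t) (e t + s * dy t).
    rewrite in_itv/= => tab; exact: (is_deriveD (hE _ tab) (is_deriveZ s (hy _ tab))).
  have [c cab ->] := MVT ab df cf.
  rewrite mulr_ge0 ?subr_ge0//; last exact: ltW.
  rewrite in_itv/= in cab; have := le _ cab.
  have := ler_norm (- (s * dy c)); rewrite normrN normrM s1 mul1r; lra.
rewrite ler_norml; have := key 1 (normr1 _); have := key (-1).
by rewrite normrN1 => /(_ erefl); rewrite !mul1r !mulN1r => h1 h2; apply/andP; split; lra.
Qed.

Lemma mean_value_ineq n (y dy : R -> 'rV[R]_n) (E e : R -> R) (a b : R) :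
  a <= b -> {within `[a, b], continuous y} -> {within `[a, b], continuous E} ->
  (forall t, a < t < b -> is_derive t 1 y (dy t)) ->
  (forall t, a < t < b -> is_derive t 1 E (e t)) ->
  (forall t, a < t < b -> `|dy t| <= e t) ->
  `|y b - y a| <= E b - E a.
Proof.
move=> ab cy cE hy hE le; apply: rV_norm_le => [|j].
  (* The scalar inequality for the zero function gives [0 <= E b - E a]; for [n = 0] no coordinate
     could provide it. *)
  have c0 : {within `[a, b], continuous (fun=> 0 : R)}.
    by apply: continuous_subspaceT => t; exact: cvg_cst.
  have := mean_value_ineq1 ab c0 cE (fun t _ => is_derive_cst (0 : R) t 1) hE.
  by rewrite subrr normr0; apply=> t /le; apply: le_trans.
rewrite !mxE; apply: (mean_value_ineq1 ab _ cE (fun t tab => is_derive_coord j (hy t tab)) hE).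
  move=> t; apply: (@cvg_comp _ _ _ y (fun v : 'rV[R]_n => v ord0 j) _ _ _ (cy t)).
  exact: coord_continuous.
by move=> t /le; apply: le_trans; exact: coord_norm_le.
Qed.

End derivative_on_half_line.

(** * Initial value problems and a Gronwall inequality with delay *)

Section ivp.
Context {R : realType} {n : nat}.
Local Notation Rn := 'rV[R]_n.
Implicit Types s t u : R.
Local Notation Rp := [set` `[0 : R, +oo[].

Lemma eq_has_derive_on (V : normedModType R) A (y z : R -> V) (t : R) l :
  A t -> (forall s, A s -> y s = z s) ->
  has_derive_on A y t l -> has_derive_on A z t l.
Proof.
move=> At yz; apply: cvg_trans; apply: near_eq_cvg.
rewrite near_withinE; apply: nearW => h Ah.
by rewrite /growth_rate_on !yz.
Qed.

Lemma has_derive_on_shift (V : normedModType R) A B (y : R -> V) (t c : R) l :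
  (forall s, B s -> A (s + c)) -> has_derive_on A y (t + c) l ->
  has_derive_on B (fun s => y (s + c)) t l.
Proof.
move=> AB; rewrite /has_derive_on.
have -> : growth_rate_on (fun s => y (s + c)) t = growth_rate_on y (t + c).
  by apply/funext => h; rewrite /growth_rate_on addrA.
apply: cvg_trans; apply: cvg_app => U.
rewrite /nbhs/= /within/=; have FF := dnbhs_filter (0 : R).
by apply: filterS => h + Bh; apply; rewrite addrA; exact: AB.
Qed.

Lemma is_derive_expRM (c t : R) :
  is_derive t 1 (fun s => expR (c * s)) (c * expR (c * t)).
Proof.
rewrite mulrC.
exact: (@is_derive1_comp _ expR (fun s => c * s) t _ _ (is_derive_expR _) (is_derive_mulr c t)).
Qed.

(** Integration starts at -1, so that 0 is an interior point and the derivative at 0 is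
    two-sided. *)
Lemma primitive1 (f : R -> R) : continuous f ->
  exists P : R -> R, P 0 = 0 /\ forall t : R, -1 < t -> is_derive t 1 P (f t).
Proof.
move=> cf.
pose F x := (\int[lebesgue_measure]_(t in [set` `[-1, x]%R]) (f t)).
exists (fun t => F t - F 0); split => [|t t1]; first by rewrite subrr.
have int : lebesgue_measure.-integrable `[-1, t + 1] (EFin \o f).
  apply: continuous_compact_integrable; first exact: segment_compact.
  exact: continuous_subspaceT.
have [] := @continuous_FTC1_closed _ f (-1) t (t + 1) _ int t1 (cf t); first by rewrite ltrDl.
rewrite -/F derive1E => dF FE.
have h : is_derive t 1 F (f t) by split.
have := is_deriveB h (is_derive_cst (F 0) t 1); by rewrite subr0.
Qed.

Lemma primitive (f : R -> Rn) : continuous f ->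
  exists P : R -> Rn, P 0 = 0 /\ forall t : R, -1 < t -> is_derive t 1 P (f t).
Proof.
move=> cf.
have /choice[P HP] (j : 'I_n) : exists P : R -> R,
    P 0 = 0 /\ forall t : R, -1 < t -> is_derive t 1 P (f t ord0 j).
  apply: (@primitive1 (fun t => f t ord0 j)) => t.
  apply: (@cvg_comp _ _ _ f (fun v : 'rV[R]_n => v ord0 j) _ _ _ (cf t)).
  exact: coord_continuous.
exists (fun t => \row_j P j t); split.
  by apply/rowP => j; rewrite !mxE; have [] := HP j.
move=> t t1; apply: is_derive_rV => j.
rewrite (_ : (fun s => _) = P j); last by apply/funext => s; rewrite mxE.
by have [_] := HP j; exact.
Qed.

(** The right-hand side [g] is a function of time alone: a step of the Picard iteration is
    [ivp x (G^~ y) z], and a solution is the case [z = y]. The past is prescribed on all of ]-oo, 0]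
    because histories are extended by constants. *)
Definition ivp (x g y : R -> Rn) : Prop :=
  [/\ continuous y, forall s, s <= 0 -> y s = x s &
      forall t, 0 <= t -> has_derive_on Rp y t (g t)].

Lemma is_derive_continuous (V : normedModType R) (y : R -> V) (t : R) l :
  is_derive t 1 y l -> {for t, continuous y}.
Proof. by move=> [dy _]; apply/differentiable_continuous/derivable1_diffP. Qed.

Lemma ivp_exists (x g : R -> Rn) : continuous x -> continuous g ->
  (forall s, 0 <= s -> x s = x 0) -> exists y, ivp x g y.
Proof.
move=> cx cg x0; have [P [P0 dP]] := primitive cg.
have PE s : s <= 0 -> P (Num.max s 0) = 0 by move=> s0; rewrite (max_idPr s0).
exists (fun t => x t + P (Num.max t 0)); split.
- move=> t; apply: cvgD; first exact: cx.
  have cm : {for t, continuous (fun t : R => Num.max t 0)}.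
    apply: (@continuous_max _ _ (fun t => t) (fun=> 0)); first exact: cvg_id.
    exact: cvg_cst.
  apply: (@continuous_comp _ _ _ (fun t : R => Num.max t 0) P) => //.
  apply: (@is_derive_continuous _ _ _ (g (Num.max t 0))); apply: dP.
  by rewrite lt_max; apply/orP; right; rewrite ltrN10.
- by move=> s s0; rewrite PE// addr0.
- move=> t t0; apply: (@eq_has_derive_on _ _ (fun t => P t + x 0)).
  + by rewrite /= in_itv/= t0.
  + move=> s; rewrite /= in_itv/= andbT => s0.
    by rewrite (max_idPl s0) addrC (x0 s).
  + apply: is_derive_has_derive_on.
    have h := dP t (lt_le_trans (ltrN10 _) t0).
    have := is_deriveD h (is_derive_cst (x 0) t 1); by rewrite addr0.
Qed.

Lemma history_bounded (y : R -> Rn) A T : continuous y -> 0 <= A ->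
  (forall s, s <= 0 -> `|y s| <= A) ->
  exists2 M, 0 <= M & forall s, s <= T -> `|y s| <= M.
Proof.
move=> cy A0 yA.
have /compact_bounded[M [_ /(_ (M + 1))]] : compact [set y s | s in `[0, T]].
  apply: continuous_compact; last exact: segment_compact.
  exact: continuous_subspaceT.
rewrite ltrDl ltr01 => /(_ isT) HM; exists (Num.max A (M + 1)).
  by rewrite le_max A0.
move=> s sT; have [s0|s0] := leP s 0; first by rewrite le_max yA.
rewrite le_max [X in _ || X]HM ?orbT//.
by exists s => //; rewrite /= in_itv/= sT ltW.
Qed.

(* The a priori bound (2 a + M0 / 2^k) e^(2 l t), a = A + g T, reproduces itself
   with k + 1 in place of k when it is integrated. *)
Lemma delay_gronwall (D d : R -> Rn) (l A g T : R) :
  0 < l -> 0 <= g -> continuous D ->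
  (forall s, s <= 0 -> `|D s| <= A) ->
  (forall t, 0 < t < T -> has_derive_on Rp D t (d t)) ->
  (forall t M, 0 < t < T -> (forall s, s <= t -> `|D s| <= M) ->
     `|d t| <= l * M + g) ->
  forall t, 0 <= t <= T -> `|D t| <= 2 * (A + g * T) * expR (2 * l * t).
Proof.
move=> l0 g0 cD DA hD hd t /andP[t0 tT].
have T0 : 0 <= T by exact: le_trans tT.
pose a := A + g * T.
have A0 : 0 <= A by apply: le_trans (DA 0 _).
have a0 : 0 <= a by rewrite addr_ge0 ?mulr_ge0.
have [M0 M0_0 HM0] := history_bounded T cD A0 DA.
have H k : forall t, t <= T ->
    `|D t| <= (2 * a + M0 / 2 ^+ k) * expR (2 * l * Num.max t 0).
  elim: k => [|k IH] {t0 tT} t tT.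
    rewrite expr0 divr1 (le_trans (HM0 _ tT))//.
    have e1 : 1 <= expR (2 * l * Num.max t 0).
      by rewrite -expR0 ler_expR !mulr_ge0// ?le_max ?lexx ?orbT// ltW.
    by rewrite (@le_trans _ _ (2 * a + M0))// ?lerDr ?ler_peMr// ?addr_ge0 ?mulr_ge0.
  have [t0|/ltW t0] := leP t 0.
    rewrite mulr0 expR0 mulr1 (le_trans (DA _ t0))//.
    have : 0 <= M0 / 2 ^+ k.+1 by rewrite divr_ge0// exprn_ge0.
    have : 0 <= g * T by rewrite mulr_ge0.
    rewrite /a; move: (_ / _) => w; move: (g * T) => v; lra.
  set Mk := M0 / 2 ^+ k in IH.
  have MkE : M0 / 2 ^+ k.+1 = Mk / 2 by rewrite exprSr invfM mulrA.
  have Mk0 : 0 <= Mk by rewrite divr_ge0// exprn_ge0.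
  (* Integrating [expR (2 * l * t)] divides by [2 * l], so the coefficient of [e] is halved in [E],
     and with it the part [Mk]. *)
  pose E t := (a + Mk / 2) * expR (2 * l * t) + g * t.
  pose e t := l * ((2 * a + Mk) * expR (2 * l * t)) + g.
  have dE (s : R) : is_derive s 1 E (e s).
    have h1 := is_deriveZ (a + Mk / 2) (is_derive_expRM (2 * l) s).
    have h2 := is_deriveZ g (is_derive_id s (1 : R)).
    apply: (is_derive_eq (is_deriveD h1 h2)).
    rewrite /e [_%:A]mulr1; congr (_ + g); rewrite /GRing.scale/=.
    by field.
  have cE : continuous E by move=> v; exact: is_derive_continuous (dE v).
  have := @mean_value_ineq _ n D d E e 0 t t0 (continuous_subspaceT cD)
    (continuous_subspaceT cE) _ (fun s _ => dE s) _.
  rewrite /E !mulr0 expR0 mulr1 addr0 => hh.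
  have {hh} : `|D t - D 0| <= (a + Mk / 2) * expR (2 * l * t) + g * t - (a + Mk / 2).
    apply: hh => s /andP[s0 st].
      apply: has_derive_on_is_derive => //; apply: hD.
      by rewrite s0 (lt_le_trans st).
    apply: hd; first by rewrite s0 (lt_le_trans st).
    move=> u us; apply: (le_trans (IH u _)).
      by rewrite (le_trans us)// ltW// (lt_le_trans st).
    rewrite ler_wpM2l ?addr_ge0 ?mulr_ge0// ler_expR.
    have l20 : 0 <= 2 * l by rewrite mulr_ge0// ltW.
    by rewrite (ler_wpM2l l20)// ge_max us ltW.
  have := DA 0 (lexx _); have := ler_normD (D t - D 0) (D 0); rewrite subrK.
  have : g * t <= g * T by rewrite ler_wpM2l.
  have : 1 <= expR (2 * l * t).
    by rewrite -expR0 ler_expR !mulr_ge0// ltW.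
  rewrite MkE; set X := expR _; move: `|D t| `|D t - D 0| `|D 0| => u v w.
  move=> X1 gt uvw wA vle.
  have h3 : a <= a * X by rewrite ler_peMr.
  have e1 : (a + Mk / 2) * X = a * X + Mk / 2 * X by rewrite mulrDl.
  have e2 : (2 * a + Mk / 2) * X = 2 * (a * X) + Mk / 2 * X by rewrite mulrDl mulrA.
  rewrite e1 in vle; rewrite e2.
  have aE : a = A + g * T by [].
  move: (a * X) (Mk / 2 * X) h3 vle => Y Z h3 vle.
  move: (g * t) (g * T) gt aE vle => p q gt aE vle; lra.
have {}H k : `|D t| <= (2 * a + M0 / 2 ^+ k) * expR (2 * l * t).
  by have := H k t tT; rewrite (max_idPl t0).
have lim : ((2 * a + M0 / 2 ^+ k) * expR (2 * l * t)) @[k --> \oo] -->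
    ((2 * a + M0 * 0) * expR (2 * l * t)).
  apply: cvgMr_tmp; apply: cvgD; first exact: cvg_cst.
  apply: cvgMl_tmp.
  rewrite (_ : (fun k => _) = (fun k => (2^-1 : R) ^+ k)); last first.
    by apply/funext => k; rewrite exprVn.
  by apply: cvg_expr; rewrite ger0_norm// invf_lt1// ltr1n.
rewrite mulr0 addr0 in lim; rewrite -/a -(cvg_lim _ lim)//.
apply: limr_ge; first by apply/cvg_ex; eexists; exact: lim.
exact: nearW.
Qed.

Lemma delay_gronwall0 (D d : R -> Rn) (l A T t : R) : 0 < l -> continuous D ->
  (forall s, s <= 0 -> `|D s| <= A) ->
  (forall s, 0 < s < T -> has_derive_on Rp D s (d s)) ->
  (forall s M, 0 < s < T -> (forall u, u <= s -> `|D u| <= M) -> `|d s| <= l * M) ->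
  0 <= T -> t <= T -> `|D t| <= 2 * A * expR (2 * l * T).
Proof.
move=> l0 cD DA hD hd T0 tT.
have A2 : 0 <= 2 * A by rewrite mulr_ge0// (le_trans _ (DA 0 (lexx 0))).
have [t0|/ltW t0] := leP t 0.
  apply: le_trans (DA t t0) (le_trans _ (ler_peMr A2 _)).
    by rewrite ler_peMl ?ler1n// (le_trans _ (DA 0 (lexx 0))).
  by rewrite -expR0 ler_expR !mulr_ge0// ltW.
have := @delay_gronwall D d l A 0 T l0 (lexx 0) cD DA hD _ t.
rewrite mul0r addr0 t0 tT => h; apply: le_trans (h _ isT) _.
  by move=> s M sT HM; rewrite addr0; exact: hd.
by rewrite ler_wpM2l// ler_expR ler_wpM2l// mulr_ge0// ltW.
Qed.

Lemma linear_le_expR (l N t : R) : 0 < l -> 0 <= N ->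
  N * t <= N / (2 * l) * expR (2 * l * t).
Proof.
move=> l0 N0; rewrite -[leRHS]mulrA ler_wpM2l// ler_pdivlMl ?mulr_gt0//.
by rewrite (le_trans _ (expR_ge1Dx _))// lerDr.
Qed.

End ivp.

(** * Picard iteration *)

Section picard.
Context {R : realType} {n : nat}.
Implicit Types s t u : R.
Local Notation Rn := 'rV[R]_n.

Lemma geometric_small (M e : R) : 0 <= M -> 0 < e ->
  exists k0 : nat, forall k, (k0 <= k)%N -> M / 2 ^+ k <= e.
Proof.
move=> M0 e0.
have : (M * (2^-1 : R) ^+ k) @[k --> \oo] --> M * 0.
  apply: cvgMl_tmp; apply: cvg_expr.
  by rewrite ger0_norm// invf_lt1// ltr1n.
rewrite mulr0 => /cvgrPdist_le/(_ _ e0)[k0 _ H]; exists k0 => k /H.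
by rewrite sub0r normrN exprVn ger0_norm// divr_ge0// exprn_ge0.
Qed.

Lemma geometric_cauchy_cvg (u : nat -> Rn) (M : R) : 0 <= M ->
  (forall k, `|u k.+1 - u k| <= M / 2 ^+ k) ->
  exists y, forall k, `|u k - y| <= 2 * M / 2 ^+ k.
Proof.
move=> M0 H.
have Hm k m : `|u (k + m)%N - u k| <= 2 * M / 2 ^+ k - 2 * M / 2 ^+ (k + m).
  elim: m => [|m IH]; first by rewrite addn0 !subrr normr0.
  rewrite addnS (le_trans (ler_distD (u (k + m)%N) _ _))//.
  have := H (k + m)%N; rewrite exprSr invfM.
  set a := 2 ^- (k + m) in IH *; move=> h; rewrite -/a in h.
  have -> : 2 * M * (a / 2) = M * a by field.
  lra.
have cu : cvgn u.
  apply: cauchy_cvg; apply: cauchy_exP => e e0.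
  have [k0 Hk] := @geometric_small (2 * M) (e / 2) (mulr_ge0 (ler0n _ 2) M0) (divr_gt0 e0 (ltr0n _ 2)).
  exists (u k0); exists k0 => // m km; rewrite -ball_normE/= distrC.
  rewrite -(subnKC km) (le_lt_trans (Hm _ _))//.
  have := Hk k0 (leqnn _); have : 0 <= 2 * M / 2 ^+ (k0 + (m - k0)).
    by rewrite divr_ge0 ?mulr_ge0// exprn_ge0.
  lra.
exists (lim (u @ \oo)) => k.
rewrite distrC; have cd : `|u m - u k| @[m --> \oo] --> `|lim (u @ \oo) - u k|.
  by apply: cvg_norm; apply: cvgB => //; exact: cvg_cst.
rewrite -(cvg_lim _ cd)//; apply: limr_le; first by apply/cvg_ex; eexists; exact: cd.
exists k => // m km; rewrite /= -(subnKC km) (le_trans (Hm _ _))// lerBlDr lerDl.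
by rewrite divr_ge0 ?mulr_ge0// exprn_ge0.
Qed.

(* P is a closed class of functions, invariant under the iteration, on which G
   is l-Lipschitz; iterates contract by 1/2 in the norm sup |y t| e^(-2 l t). *)
Lemma picard (P : (R -> Rn) -> Prop) (G : R -> (R -> Rn) -> Rn)
    (x y0 : R -> Rn) (l N : R) : 0 < l -> 0 <= N ->
  continuous x -> (forall s, 0 <= s -> x s = x 0) -> P y0 ->
  (forall y, P y -> continuous y /\ forall s, s <= 0 -> y s = x s) ->
  (forall y, P y -> continuous (G^~ y)) ->
  (forall y z, P y -> ivp x (G^~ y) z -> P z) ->
  (forall (u : nat -> R -> Rn) y, (forall k, P (u k)) ->
    (forall T e, 0 < e -> exists k0, forall k t, (k0 <= k)%N -> t <= T ->
      `|u k t - y t| <= e) -> P y) ->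
  (forall y z t M, P y -> P z -> 0 <= t ->
    (forall s, s <= t -> `|y s - z s| <= M) -> `|G t y - G t z| <= l * M) ->
  (forall z, ivp x (G^~ y0) z -> forall t, 0 <= t ->
    `|z t - y0 t| <= N * expR (2 * l * t)) ->
  exists y, P y /\ ivp x (G^~ y) y.
Proof.
move=> l0 N0 cx x0 Py0 HP HG HS Hlim Hlip HN.
have l20 : 0 <= 2 * l by rewrite mulr_ge0// ltW.
have /choice[S SP] : forall y, exists z, P y -> P z /\ ivp x (G^~ y) z.
  move=> y; have [Py|nPy] := pselect (P y); last by exists y.
  have [z Hz] := ivp_exists cx (HG _ Py) x0.
  by exists z => _; split => //; exact: HS Hz.
pose u := fix u (k : nat) := if k is k'.+1 then S (u k') else y0.
have Pu k : P (u k) by elim: k => // k /SP[].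
have Su k : ivp x (G^~ (u k)) (u k.+1) by have [] := SP _ (Pu k).
pose E t := expR (2 * l * Num.max t 0).
have E0 t : 0 < E t by exact: expR_gt0.
have EE s t : s <= t -> E s <= E t.
  move=> st; rewrite ler_expR ler_wpM2l// ge_max !le_max st lexx orbT.
  by rewrite andbT.
have contr y z y' z' M : P y -> P z -> ivp x (G^~ y) y' -> ivp x (G^~ z) z' ->
    0 <= M ->
    (forall t, `|y t - z t| <= M * E t) -> forall t, `|y' t - z' t| <= M / 2 * E t.
  move=> Py Pz [cy' y'0 dy'] [cz' z'0 dz'] M0 yz t.
  have [t0|t0] := leP t 0.
    by rewrite y'0// z'0// subrr normr0 mulr_ge0// ?divr_ge0// ltW.
  pose e t := l * (M * expR (2 * l * t)).
  pose EE' t := M / 2 * expR (2 * l * t).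
  have dE (s : R) : is_derive s 1 EE' (e s).
    have h1 := is_deriveZ (M / 2) (is_derive_expRM (2 * l) s).
    by apply: (is_derive_eq h1); rewrite /e /GRing.scale/=; field.
  have cE : continuous EE' by move=> v; exact: is_derive_continuous (dE v).
  have cD : continuous (fun s => y' s - z' s) by move=> v; apply: cvgB; [exact: cy'|exact: cz'].
  have := @mean_value_ineq _ n _ (fun t => G t y - G t z) EE' e 0 t (ltW t0)
    (continuous_subspaceT cD) (continuous_subspaceT cE) _ (fun s _ => dE s) _.
  rewrite (y'0 0 (lexx 0)) (z'0 0 (lexx 0)) subrr subr0 /EE' mulr0 expR0 mulr1 /E (max_idPl (ltW t0)).
  move=> hh; have {hh} : `|y' t - z' t| <= M / 2 * expR (2 * l * t) - M / 2.
    apply: hh => s /andP[s0 st].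
      by apply: has_derive_on_is_derive => //; apply: has_derive_onB;
        [apply: dy'|apply: dz']; exact: ltW.
    apply: Hlip => //; first exact: ltW.
    move=> v vs; rewrite (le_trans (yz v))// ler_wpM2l//.
    by rewrite (le_trans (EE _ _ vs))// /E (max_idPl (ltW s0)).
  lra.
have Hu k t : `|u k.+1 t - u k t| <= (N * E t) / 2 ^+ k.
  elim: k t => [|k IH] t.
    rewrite expr0 divr1; have [t0|/ltW t0] := leP t 0.
      have [_ e1 _] := Su 0%N; have [_ e2] := HP _ Py0.
      have -> : u 0%N t = x t by apply: e2.
      by rewrite e1// subrr normr0 mulr_ge0// ltW.
    by rewrite (le_trans (HN _ (Su 0%N) _ t0))// /E (max_idPl t0).
  have Nk : 0 <= N / 2 ^+ k by rewrite divr_ge0// exprn_ge0.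
  have := contr _ _ _ _ _ (Pu k.+1) (Pu k) (Su k.+1) (Su k) Nk _ t.
  move=> h; rewrite (le_trans (h _))//; last by rewrite exprSr invfM; lra.
  by move=> s; rewrite (le_trans (IH s))// mulrAC.
have /choice[y Hy] : forall t, exists a, forall k, `|u k t - a| <= 2 * (N * E t) / 2 ^+ k.
  by move=> t; apply: geometric_cauchy_cvg => //; rewrite mulr_ge0// ltW.
have Py : P y.
  apply: (Hlim u) => // T e e0.
  have [|k0 Hk] := @geometric_small (2 * (N * E T)) e _ e0.
    by rewrite !mulr_ge0// ltW.
  exists k0 => k t /Hk + tT; apply: le_trans; apply: (le_trans (Hy _ _)).
  rewrite ler_wpM2r// ?invr_ge0 ?exprn_ge0// ler_wpM2l// ler_wpM2l//; exact: EE.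
exists y; split => //; have [_ Sy] := SP _ Py.
(* The iterates converge to [y] by construction and to [S y] by the contraction. *)
suff SE : S y = y by rewrite SE in Sy.
apply/funext => t; apply/eqP; rewrite -subr_eq0 -normr_le0.
apply/ler_addgt0Pr => e e0; rewrite add0r.
have [|k0 Hk] := @geometric_small (2 * (N * E t)) e _ e0.
  by rewrite !mulr_ge0// ltW.
have N2 : 0 <= 2 * N / 2 ^+ k0 by rewrite divr_ge0 ?mulr_ge0// exprn_ge0.
have := contr _ _ _ _ _ (Pu k0) Py (Su k0) Sy N2 _ t.
move=> h; rewrite (le_trans (ler_distD (u k0.+1 t) _ _))//.
have h1 := Hy t k0.+1; have h2 := Hk _ (leqnn _).
have {}h : `|u k0.+1 t - S y t| <= 2 * N / 2 ^+ k0 / 2 * E t.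
  by apply: h => s; rewrite (le_trans (Hy s k0))// mulrA mulrAC.
rewrite distrC; move: h h1 h2; rewrite exprSr invfM; set q := 2 ^- k0.
set a := `|_|; set b := `|_|.
have -> : 2 * N * q / 2 * E t = N * E t * q by lra.
have -> : 2 * (N * E t) * (q / 2) = N * E t * q by lra.
have -> : 2 * (N * E t) * q = 2 * (N * E t * q) by lra.
lra.
Qed.

End picard.

(** * Uniformity over compact sets *)

Section compactness.
Context {R : realType}.

(** A Lebesgue number argument. Only [q] has to lie in [A], which later allows points near a compact
    set to be compared with points of it. *)
Lemma compact_uniform_radius (X : pseudoMetricType R) (A : set X)
    (Q : X -> X -> Prop) : compact A ->
  (forall p, A p -> exists2 d : R, 0 < d &
     forall q q', ball p d q -> ball p d q' -> Q q q') ->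
  exists2 d : R, 0 < d & forall q q', A q -> ball q d q' -> Q q q'.
Proof.
move=> /compact_near_coveringP cA H.
have : \forall d \near (0 : R)^'+, A `<=` (fun q => forall q', ball q d q' -> Q q q').
  apply: cA => p /H[d d0 Hd].
  exists (ball p (d / 2), [set e : R | e < d / 2]) => /=.
    split; first by apply: nbhsx_ballx; rewrite divr_gt0.
    by apply: nbhs_right_lt; rewrite divr_gt0.
  move=> [q e] /= [pq ed] q' qq'; apply: Hd.
    by apply: le_ball pq; lra.
  rewrite (splitr d); apply: ball_triangle pq _; apply: le_ball qq'; exact: ltW.
move=> HA; have [d [d0 Hd]] := filter_ex (filterI (nbhs_right_gt (0 : R)) HA).
by exists d => // q q' /Hd; exact.
Qed.

Lemma compact_uniform_bound (X : topologicalType) (A : set X)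
    (Q : R -> X -> Prop) : compact A ->
  (forall M M' q, M <= M' -> Q M q -> Q M' q) ->
  (forall p, A p -> exists M, \forall q \near p, Q M q) ->
  exists2 M, 0 < M & forall q, A q -> Q M q.
Proof.
move=> /compact_near_coveringP cA mono H.
have : \forall M \near +oo%R, A `<=` Q M.
  apply: cA => p /H[M HM].
  exists ([set q | Q M q], [set M' : R | M <= M']) => /=.
    by split => //; apply: nbhs_pinfty_ge; exact: num_real.
  move=> [q M'] /= [qM MM']; exact: mono qM.
move=> HA; have [M [M0 HM]] :=
  filter_ex (filterI (nbhs_pinfty_gt (num_real (0 : R))) HA).
by exists M.
Qed.

End compactness.

(** * Operator norms and norm-continuous families of operators *)

Section op_norm.
Context {R : realType}.

Lemma op_norm_le (X Y : normedModType R) (f : X -> Y) (c : R) :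
  (forall (a : R) v, f (a *: v) = a *: f v) -> (op_norm f <= c%:E)%E ->
  forall v, `|f v| <= c * `|v|.
Proof.
move=> hom fc v.
have [->|v0] := eqVneq v 0.
  by have := hom 0 0; rewrite !scale0r => ->; rewrite !normr0 mulr0.
have nv : 0 < `|v| by rewrite normr_gt0.
rewrite -ler_pdivrMr// mulrC.
have -> : `|v|^-1 * `|f v| = `|f (`|v|^-1 *: v)|.
  by rewrite hom normrZ normfV normr_id.
rewrite -lee_fin; apply: le_trans fc; apply: ereal_sup_ubound.
exists (`|v|^-1 *: v) => //=.
by rewrite normrZ normfV normr_id mulVf ?lexx// gt_eqF.
Qed.

Variables (X Y : normedModType R).

Lemma op_continuous_near (T : topologicalType) (D : T -> X -> Y) :
  op_continuous D -> (forall p (a : R) v, D p (a *: v) = a *: D p v) ->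
  forall p (e : R), 0 < e ->
    \forall q \near p, forall v, `|D q v - D p v| <= e * `|v|.
Proof.
move=> cD hom p e e0.
have : nbhs 0%E [set x | (x < e%:E)%E].
  by apply: open_ereal_lt'; rewrite lte_fin.
move=> e0n; have : \forall q \near p, (op_norm (fun v => D q v - D p v)%R < e%:E)%E.
  exact: (cD p _ e0n).
apply: filterS => q /ltW h v.
apply: (op_norm_le (f := fun v => D q v - D p v)) => // a w.
by rewrite !hom scalerBr.
Qed.

Lemma op_continuous_bounded (T : topologicalType) (D : T -> X -> Y) A :
  op_continuous D -> (forall p (a : R) v, D p (a *: v) = a *: D p v) ->
  (forall p, exists M, forall v, `|D p v| <= M * `|v|) -> compact A ->
  exists2 M, 0 < M & forall p, A p -> forall v, `|D p v| <= M * `|v|.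
Proof.
move=> cD hom bD cA.
apply: (compact_uniform_bound (Q := fun M p => forall v, `|D p v| <= M * `|v|)) => //.
  by move=> M M' q MM' H v; rewrite (le_trans (H v))// ler_wpM2r.
move=> p _; have [M HM] := bD p; exists (M + 1).
have := op_continuous_near cD hom p ltr01; apply: filterS => q H v.
have -> : D q v = D p v + (D q v - D p v) by rewrite addrC subrK.
rewrite (le_trans (ler_normD _ _))// mulrDl lerD//; exact: H.
Qed.

Lemma op_continuous_uniform (T : pseudoMetricType R) (D : T -> X -> Y) A e :
  op_continuous D -> (forall p (a : R) v, D p (a *: v) = a *: D p v) ->
  compact A -> 0 < e ->
  exists2 d : R, 0 < d & forall p q, A p -> ball p d q ->
    forall v, `|D q v - D p v| <= e * `|v|.
Proof.
move=> cD hom cA e0.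
apply: (compact_uniform_radius
  (Q := fun p q => forall v, `|D q v - D p v| <= e * `|v|)) => // p _.
have := op_continuous_near cD hom p (divr_gt0 e0 (ltr0n _ 2)).
move=> /nbhs_ballP[d /= d0 Hd]; exists d => // q q' pq pq' v.
have -> : D q' v - D q v = (D q' v - D p v) - (D q v - D p v).
  by rewrite opprB addrA subrK.
rewrite (le_trans (ler_normB _ _))// (splitr e) mulrDl lerD//; exact: Hd.
Qed.

Lemma diff_bounded (f : X -> Y) x : differentiable f x ->
  exists M, forall v, `|'d f x v| <= M * `|v|.
Proof.
move=> df; have /linear_bounded_continuous/linear_boundedP := diff_continuous df.
move=> /pinfty_ex_gt0[M M0 HM]; exists M => v; exact: HM.
Qed.

Lemma is_derive_line (f : X -> Y) x h (t : R) : differentiable f (x + t *: h) ->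
  is_derive t 1 (fun s : R => f (x + s *: h)) ('d f (x + t *: h) h).
Proof.
move=> df; have dh : derivable f (x + t *: h) h by exact: diff_derivable.
rewrite -(deriveE h df).
have E : (fun u : R => u^-1 *: (((fun s : R => f (x + s *: h)) \o shift t) (u *: 1) -
     f (x + t *: h))) =
   (fun u : R => u^-1 *: ((f \o shift (x + t *: h)) (u *: h) - f (x + t *: h))).
  apply/funext => u /=; congr (_ *: (f _ - _)).
  by rewrite [u *: 1]mulr1 scalerDl addrCA.
by split; rewrite ?/derivable /derive E//.
Qed.

End op_norm.

(** * Mean value inequalities for differentiable maps *)

Section mean_value.
Context {R : realType}.

Lemma is_derive_scaler (V : normedModType R) (c : V) (t : R) :
  is_derive t 1 (fun s : R => s *: c) c.
Proof.
have h := @is_derive_line R _ _ (id : V -> V) 0 c t ex_diff.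
rewrite diff_val in h.
suff -> : (fun s : R => s *: c) = (fun s => id (0 + s *: c)) by exact: h.
by apply/funext => s; rewrite /= add0r.
Qed.

(** The one-variable inequality is a parameter because the codomains ['rV[R]_n] and [R] have
    separate versions of it. The vector [c] is the expected increment: [c = 0] gives Lipschitz
    bounds, and the derivative at a reference point applied to [h] gives linearization errors. *)
Lemma diff_mean_value_gen (X V : normedModType R) (f : X -> V) x h c M :
  (forall (y dy : R -> V) (E e : R -> R), {within `[0, 1], continuous y} ->
    {within `[0, 1], continuous E} ->
    (forall t : R, 0 < t < 1 -> is_derive t 1 y (dy t)) ->
    (forall t : R, 0 < t < 1 -> is_derive t 1 E (e t)) ->
    (forall t : R, 0 < t < 1 -> `|dy t| <= e t) -> `|y 1 - y 0| <= E 1 - E 0) ->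
  (forall t : R, 0 <= t <= 1 -> differentiable f (x + t *: h) /\
     `|'d f (x + t *: h) h - c| <= M) -> `|f (x + h) - f x - c| <= M.
Proof.
move=> mvi H.
pose y (t : R) := f (x + t *: h) - t *: c.
have dy (t : R) : 0 <= t <= 1 -> is_derive t 1 y ('d f (x + t *: h) h - c).
  move=> /H[df _]; have h1 := is_derive_line df.
  exact: (is_deriveB h1 (is_derive_scaler c t)).
have dE := is_derive_mulr M.
have := @mvi y (fun t => 'd f (x + t *: h) h - c) (fun t => M * t) (fun=> M).
rewrite /y !scale1r !scale0r addr0 subr0 mulr0 mulr1 subr0 addrAC; apply.
- apply: (@continuous_in_subspaceT _ _ `[0 : R, 1]%classic y) => s.
  by rewrite inE/= in_itv/= => /dy; exact: is_derive_continuous.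
- by apply: continuous_subspaceT => t; apply: is_derive_continuous (is_derive_mulr M t).
- by move=> t /andP[t0 t1]; apply: dy; rewrite !ltW.
- by move=> t /andP[t0 t1]; have [] := H t; rewrite ?(ltW t0) ?(ltW t1).
Qed.

Lemma diff_mean_value (X : normedModType R) n (f : X -> 'rV[R]_n) x h c M :
  (forall t : R, 0 <= t <= 1 -> differentiable f (x + t *: h) /\
     `|'d f (x + t *: h) h - c| <= M) -> `|f (x + h) - f x - c| <= M.
Proof.
apply: diff_mean_value_gen => y dy E e cy cE hy hE le.
exact: (mean_value_ineq ler01 cy cE hy hE le).
Qed.

Lemma diff_mean_value1 (X : normedModType R) (f : X -> R) x h (c : R) M :
  (forall t : R, 0 <= t <= 1 -> differentiable f (x + t *: h) /\
     `|'d f (x + t *: h) h - c| <= M) -> `|f (x + h) - f x - c| <= M.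
Proof.
apply: diff_mean_value_gen => y dy E e cy cE hy hE le.
exact: (mean_value_ineq1 ler01 cy cE hy hE le).
Qed.

End mean_value.

(** * From an almost everywhere bound on the derivative to a Lipschitz bound *)

Section lipschitz_bound.
Context {R : realType}.
Local Notation mu := (@lebesgue_measure R).

(** The Stieltjes measure of [g] is absolutely continuous, and Lebesgue differentiation identifies
    its Radon-Nikodym density with the derivative of [g] almost everywhere. The density is thus at
    most [M], and [g b - g a] is its integral. *)
Lemma nd_lipschitz_ae_bound (g : R -> R) (K M a b : R) : 0 < K -> 0 <= M ->
  {homo g : x y / x <= y} ->
  (forall x y, x <= y -> g y - g x <= K * (y - x)) ->
  {ae mu, forall x, x \in `]a, b[ -> derivable g x 1 -> 'D_1 g x <= M} ->
  a <= b -> g b - g a <= M * (b - a).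
Proof.
move=> K0 M0 ndg gK gM.
rewrite le_eqVlt => /predU1P[<-|ab]; first by rewrite !subrr mulr0.
have cg : continuous g.
  apply: (lipschitz_continuous (ltW K0)) => x y.
  have [xy|/ltW yx] := leP x y.
    by rewrite distrC ger0_norm ?subr_ge0 ?ndg// distrC ger0_norm ?subr_ge0// gK.
  by rewrite ger0_norm ?subr_ge0 ?ndg// ger0_norm ?subr_ge0// gK.
have rcg := right_continuousW cg.
pose gc : cumulative R R :=
  HB.pack g (isCumulative.Build R _ R g ndg rcg).
pose D : set (measurableTypeR R) := `]a, b]%classic.
have mD : measurable D by exact: measurable_itv.
have itvE (x y : R) : x <= y ->
    lebesgue_stieltjes_measure gc `]x, y]%classic = (g y - g x)%:E.
  move=> xy; transitivity (wlength gc `]x, y]%classic).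
    by apply: (@measurable_mu_extE _ _ _ (wlength gc)); exact: is_ocitv.
  by rewrite wlength_itv_bnd.
have nuDy : (lebesgue_stieltjes_measure gc D < +oo)%E.
  by rewrite itvE ?ltW// ltry.
pose nu := mfrestr mD nuDy.
have numu : nu `<< mu.
  apply/null_content_dominatesP => A mA A0; rewrite /nu /= /mfrestr /mrestr.
  apply: (stieltjes_null K0) => //.
  by apply/eqP; rewrite eq_le measure_ge0 andbT -A0 le_measure ?inE//; exact: measurableI.
have [h [h0 hfin hint nuE]] := radon_nikodym_sigma_finite numu.
pose f := fine \o h.
have fE : EFin \o f = h by apply/funext => x /=; rewrite fineK.
have intf y : mu.-integrable [set` Interval (BRight a) (BRight y)] (EFin \o f).
  by rewrite fE; apply: (integrableS measurableT).
have locf : locally_integrable [set: R] f.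
  by apply: open_integrable_locally; [exact: openT|rewrite fE].
have nuDE : (g b - g a)%:E = (\int[mu]_(x in D) h x)%E.
  rewrite -nuE// /nu /= /mfrestr /mrestr setIid itvE//; exact: ltW.
have muD : (\int[mu]_(x in D) M%:E = (M * (b - a))%:E)%E.
  have := @lebesgue_measure_itv R (`]a, b]); rewrite /= lte_fin ab -EFinB => E1.
  rewrite integral_cst// EFinM; congr (_ * _)%E; exact: E1.
rewrite -lee_fin nuDE -muD; apply: ae_ge0_le_integral => //.
- by apply: measurable_funS (measurable_int _ hint).
(* The half-open interval [D] contains [b], where the hypothesis on the derivative says nothing. *)
- have Db : {ae mu, forall s : R, s != b}.
    exists [set b]; split => //; first exact: lebesgue_measure_set1.
    by move=> s /= /negP; rewrite negbK => /eqP.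
  apply: filterS3 gM Db (FTC1 intf locf).
    exact: (ae_filter_ringOfSetsType mu).
  move=> x gMx xb /= dFx.
  rewrite /D /= in_itv/= => /andP[ax]; rewrite le_eqVlt (negbTE xb)/= => xltb.
  have xab : x \in `]a, b[ by rewrite in_itv/= ax.
  have [dF dFE] := dFx ax.
  have E1 : {near x, (fun y => \int[mu]_(t in `]a, y]) f t + g a) =1 g}.
    near=> y.
    have ay : a < y by near: y; exact: lt_nbhsr.
    have yb : y < b by near: y; exact: lt_nbhsl.
    change (fine (\int[mu]_(t in `]a, y]) (EFin \o f) t)%E + g a = g y); rewrite fE.
    rewrite -nuE; last exact: measurable_itv.
    rewrite /nu /= /mfrestr /mrestr.
    rewrite (_ : _ `&` _ = `]a, y]%classic); last first.
      apply/setIidPl => z; rewrite /D /= !in_itv/= => /andP[-> zy].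
      by rewrite (le_trans zy)// ltW.
    by rewrite itvE ?ltW//= subrK.
  have h1 : is_derive x 1 (fun y => \int[mu]_(t in `]a, y]) f t) (f x).
    by split; [exact: dF|rewrite -derive1E; exact: dFE].
  have h2 := is_deriveD h1 (is_derive_cst (g a) x 1).
  have h3 : is_derive x 1 g (f x + 0).
    exact: (near_eq_is_derive E1 h2).
  have -> : h x = (f x)%:E by rewrite -fE.
  have [dg fx] := h3; rewrite addr0 in fx.
  by rewrite lee_fin -fx; exact: gMx.
Unshelve. all: by end_near. Qed.

(** Adding [K1 * x] to [g] or to [- g] makes it nondecreasing and raises the derivative bound to
    [M + K1]; the added increment [K1 * (b - a)] is subtracted at the end. *)
Lemma lipschitz_ae_bound (g : R -> R) (K M a b : R) : 0 <= M ->
  (forall x y, `|g x - g y| <= K * `|x - y|) ->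
  {ae mu, forall x, x \in `]a, b[ -> derivable g x 1 -> `|'D_1 g x| <= M} ->
  a <= b -> `|g b - g a| <= M * (b - a).
Proof.
move=> M0 gK gM ab.
pose K1 := `|K| + 1.
have K1K : K <= K1 by rewrite /K1 (le_trans (ler_norm _))// lerDl.
have K10 : 0 < K1 by rewrite /K1 ltr_wpDl.
have gK1 x y : x <= y -> `|g y - g x| <= K1 * (y - x).
  move=> xy; rewrite (le_trans (gK _ _))// ger0_norm ?subr_ge0//.
  by rewrite ler_wpM2r// subr_ge0.
have key (s : R) : `|s| = 1 -> s * (g b - g a) <= M * (b - a).
  move=> s1.
  pose f x := s * g x + K1 * x.
  have sg x y : x <= y -> `|s * (g y - g x)| <= K1 * (y - x).
    by move=> /gK1; rewrite normrM s1 mul1r.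
  have ndf : {homo f : x y / x <= y}.
    move=> x y xy; rewrite /f; have := sg _ _ xy.
    by rewrite ler_norml mulrBr => /andP[]; lra.
  have fK x y : x <= y -> f y - f x <= (2 * K1) * (y - x).
    move=> xy; rewrite /f; have := sg _ _ xy.
    by rewrite ler_norml mulrBr => /andP[]; lra.
  have K20 : 0 < 2 * K1 by rewrite mulr_gt0.
  have MK0 : 0 <= M + K1 by rewrite addr_ge0// ltW.
  have := @nd_lipschitz_ae_bound f (2 * K1) (M + K1) a b K20 MK0 ndf fK _ ab.
  rewrite /f => H; have {H} : s * g b + K1 * b - (s * g a + K1 * a) <= (M + K1) * (b - a).
    apply: H; apply: filterS gM; first exact: (ae_filter_ringOfSetsType mu).
    move=> x H xab df.
    have s0 : s != 0 by rewrite -normr_eq0 s1 oner_eq0.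
    have dg : is_derive x 1 g (s^-1 * ('D_1 f x - K1)).
      have d1 : is_derive x 1 f ('D_1 f x) by split.
      have d2 := is_deriveZ s^-1 (is_deriveB d1 (is_derive_mulr K1 x)).
      rewrite (_ : g = s^-1 \*: (f - (fun y => K1 * y)))//.
      apply/funext => y; change (g y = s^-1 * (s * g y + K1 * y - K1 * y)).
      by rewrite addrK mulKf.
    have := H xab; rewrite derive_val; case: dg => dg _ /(_ dg).
    rewrite normrM normfV s1 invr1 mul1r ler_norml => /andP[_]; lra.
  rewrite mulrBr; lra.
rewrite ler_norml; have := key 1 (normr1 _).
have := key (-1); rewrite normrN1 => /(_ erefl).
by rewrite mul1r mulN1r; lra.
Qed.

End lipschitz_bound.

(** * The norms of C and W, and compactness of equi-Lipschitz histories *)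

Section history_spaces.
Context {R : realType} {r : {posnum R}} {n : nat}.
Implicit Types s t u : R.
Local Notation mu := (@lebesgue_measure R).
Local Notation C := (CSpace r n).
Local Notation W := (WSpace r n).

Lemma C_continuous (x : C) : continuous x.
Proof. by have := Cfun_hist x; rewrite inE => -[]. Qed.

Lemma C_clamp (x : C) s : x (clamp r s) = x s.
Proof. by have := Cfun_hist x; rewrite inE => -[_ {2}<-]. Qed.

Lemma C_norm_ge (x : C) s : `|x s| <= `|x|.
Proof. by rewrite -C_clamp; apply: sup_norm_ge; exact: clamp_in. Qed.

Lemma C_norm_le (x : C) M : (forall s, hitv r s -> `|x s| <= M) -> `|x| <= M.
Proof. exact: sup_norm_le. Qed.

Lemma C_right (x : C) s : 0 <= s -> x s = x 0.
Proof.
move=> s0; rewrite -C_clamp /clamp (min_idPl s0) (max_idPr _)//.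

Qed.

Lemma W_norm_C (x : W) : `|toC x| <= `|x|.
Proof. by rewrite [leRHS]/Num.Def.normr/= /W_norm le_max lexx. Qed.

(** A Lipschitz function is controlled by its almost everywhere derivative. Together with the
    converse [W_norm_le], this lets the rest of the proof use the W-norm as a bound on values and
    Lipschitz constants, without exceptional null sets. *)
Lemma W_lip (x : W) s t : `|x s - x t| <= `|x| * `|s - t|.
Proof.
have /lip_histP[K xK] := toC_lip x.
suff H a b : hitv r a -> hitv r b -> a <= b -> `|x b - x a| <= `|x| * (b - a).
  rewrite -(C_clamp x s) -(C_clamp x t).
  apply: (@le_trans _ _ (`|x| * `|clamp r s - clamp r t|)); last first.
    by rewrite ler_wpM2l// clamp_lip.
  have [st|/ltW st] := leP (clamp r s) (clamp r t).
    rewrite distrC (distrC (clamp r s)) (ger0_norm (_ : 0 <= clamp r t - _)) ?subr_ge0//.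
    by apply: H => //; exact: clamp_in.
  rewrite (ger0_norm (_ : 0 <= clamp r s - _)) ?subr_ge0//.
  by apply: H => //; exact: clamp_in.
move=> ha hb ab; apply: rV_norm_le => [|j].
  by rewrite mulr_ge0// subr_ge0.
rewrite !mxE; apply: (lipschitz_ae_bound (g := fun t => x t ord0 j) (K := K)) => //.
  move=> u v; apply: le_trans (xK u v).
  by have := coord_norm_le (x u - x v) j; rewrite !mxE.
have := @ess_sup_ge _ _ _ mu (fun s =>
  (if s \in hitv r then `|derive_on (hitv r) x s| else 0)%:E).
rewrite -ess_norm_deriveE; apply: filterS2 (W_derivable_ae x).
  exact: (ae_filter_ringOfSetsType mu).
move=> c dx + cab.
have cr : c \in `]- r%:num, 0[.
  move: ha hb cab; rewrite /hitv/= !in_itv/= => /andP[ra _] /andP[_ b0] /andP[ac cb].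
  by rewrite (le_lt_trans ra)// (lt_le_trans cb).
rewrite mem_set; last first.
  by move: cr; rewrite /hitv/= !in_itv/= => /andP[/ltW-> /ltW->].
rewrite derive_on_hitv// => le1 dj.
have le2 : `|'D_1 x c| <= `|x|.
  rewrite [leRHS]/Num.Def.normr/= /W_norm le_max; apply/orP; right.
  rewrite -lee_fin fineK ?ess_norm_derive_fin//.
apply: le_trans le2; have := coord_norm_le ('D_1 x c) j.
by rewrite derive_mx ?mxE//; exact: dx.
Qed.

Lemma W_norm_le (x : W) M : `|toC x| <= M ->
  (forall s t, hitv r s -> hitv r t -> `|x s - x t| <= M * `|s - t|) ->
  `|x| <= M.
Proof.
move=> xM lM; rewrite [leLHS]/Num.Def.normr/= /W_norm ge_max xM/=.
have M0 : 0 <= M by exact: le_trans xM.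
rewrite -lee_fin fineK ?ess_norm_derive_fin// ess_norm_deriveE.
apply/ess_supP.
apply: filterS (W_derive_ae x); first exact: (ae_filter_ringOfSetsType mu).
move=> s /= hs; case: ifPn => rs; last by rewrite lee_fin.
move: rs; rewrite inE => /hs[sr xs]; rewrite derive_on_hitv// lee_fin.
rewrite /derive -lim_norm//; apply: limr_le.
  by apply/cvg_ex; eexists; apply: cvg_norm; exact: xs.
near=> h; have h0 : h != 0 by near: h; exact: nbhs_dnbhs_neq.
rewrite normrZ normfV ler_pdivrMl ?normr_gt0// mulrC.
rewrite /= [h *: 1]mulr1 -(C_clamp x (h + s)) -(C_clamp x s).
apply: (le_trans (lM _ _ (clamp_in _ _) (clamp_in _ _))).
by rewrite ler_wpM2l// (le_trans (clamp_lip _ _ _))// addrK.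
Unshelve. all: by end_near. Qed.

Lemma ultra_image_cvg (T : Type) (X : topologicalType) (U : set_system T)
    (f : T -> X) (A : set X) : UltraFilter U -> compact A -> U (f @^-1` A) ->
  exists2 c, A c & f @ U --> c.
Proof.
move=> UU cA UA; have [c [Ac clc]] := cA _ (fmap_proper_filter f _) UA.
exists c => // V Vc; have [//|nV] := in_ultra_setVsetC (f @^-1` V) UU.
by have [z [/= nVz /nVz]] := clc (~` V) V nV Vc.
Qed.

Lemma normV_ball_compact A : compact [set v : 'rV[R]_n | `|v| <= A].
Proof.
apply: bounded_closed_compact.
  by exists A; split; [exact: num_real|move=> M AM v /= vA; rewrite (le_trans vA)// ltW].
by apply: (closed_comp (f := fun v : 'rV[R]_n => `|v|)) (@closed_le R A) => v _; exact: norm_continuous.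
Qed.

(** Arzela-Ascoli with ultrafilters: the values converge at every time, the limit inherits both
    bounds, and the common Lipschitz constant spreads closeness at [s] to a neighbourhood of [s], so
    that the convergence is uniform on the compact [-r, 0]. *)
Lemma hist_ball_compact (A N : R) :
  compact [set x : C | (forall s, `|x s| <= A) /\
    forall s t, `|x s - x t| <= N * `|s - t|].
Proof.
set B := [set _ | _]; rewrite compact_ultra => U UU UB.
have PU : ProperFilter U by exact: ultra_proper.
have FU : Filter U by case: PU.
have [x0 [x0A x0N]] := filter_ex UB.
have A0 : 0 <= A by apply: le_trans (x0A 0).
have N0 : 0 <= N.
  by have := x0N 0 1; rewrite sub0r normrN normr1 mulr1; exact: le_trans.
have /choice[f Hf] : forall s : R, exists c : 'rV[R]_n, (fun x : C => x s) @ U --> c.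
  move=> s; have [|c _ cc] := ultra_image_cvg (f := fun x : C => x s) UU (@normV_ball_compact A).
    by apply: filterS UB => x [xA _]; exact: xA.
  by exists c.
have fA s : `|f s| <= A.
  have h : (fun x : C => `|x s|) @ U --> `|f s| by apply: cvg_norm; exact: Hf.
  rewrite -(cvg_lim _ h)//; apply: limr_le.
    by apply/cvg_ex; eexists; exact: h.
  by apply: filterS UB => x [xA _]; exact: xA.
have fN s t : `|f s - f t| <= N * `|s - t|.
  have h : (fun x : C => `|x s - x t|) @ U --> `|f s - f t|.
    by apply: cvg_norm; apply: cvgB; exact: Hf.
  rewrite -(cvg_lim _ h)//; apply: limr_le.
    by apply/cvg_ex; eexists; exact: h.
  by apply: filterS UB => x [_ xN]; exact: xN.
have fh : f \in @hist R r n.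
  rewrite inE; split; first exact: lipschitz_continuous fN.
  apply/funext => s /=; apply: (cvg_unique _ (Hf (clamp r s))) => //.
  rewrite (_ : (fun x : C => x (clamp r s)) = fun x => x s); first exact: Hf.
  by apply/funext => x; rewrite C_clamp.
exists (MkCSpace fh); split; first by split.
move=> V /nbhs_ballP[e /= e0 eV].
have cI : compact (hitv r) by exact: segment_compact.
have : \forall x \near (U : set_system C), hitv r `<=` (fun s => `|f s - (x : C) s| < e / 2).
  move/compact_near_coveringP : cI; apply => s rs.
  have N1 : 0 < N + 1 by rewrite ltr_wpDl.
  exists ([set t | `|s - t| < e / 8 / (N + 1)], [set x | B x /\ `|f s - x s| < e / 8]) => /=.
    split.
      apply/nbhs_ballP; exists (e / 8 / (N + 1)) => /=; first by rewrite !divr_gt0.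
      by move=> t; rewrite -ball_normE.
    have h9 : U [set x : C | `|f s - x s| < e / 8].
      by have /cvgrPdist_lt := Hf s; apply; exact: divr_gt0.
    exact: (filterI UB h9).
  move=> [t x] /= [st [[_ xN] fs]].
  have Nst : N * `|s - t| <= e / 8.
    rewrite (@le_trans _ _ ((N + 1) * `|s - t|))//.
      by rewrite ler_wpM2r// lerDl.
    by rewrite mulrC -ler_pdivlMr// ltW.
  have h1 := fN t s; rewrite (distrC t) in h1.
  have h2 := xN s t.
  have h3 := ler_distD (f s) (f t) (x t).
  have h4 := ler_distD (x s) (f s) (x t).
  rewrite /=; lra.
apply: filterS => x Hx; apply: eV; rewrite -ball_normE/=.
rewrite (@le_lt_trans _ _ (e / 2))//; last by lra.
by apply: C_norm_le => s /Hx /ltW.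
Unshelve. all: by end_near. Qed.

End history_spaces.

(** * Segments of functions and truncation of histories *)

Section segments.
Context {R : realType} {r : {posnum R}} {n : nat}.
Implicit Types s t u : R.
Local Notation Rn := 'rV[R]_n.
Local Notation C := (CSpace r n).
Local Notation W := (WSpace r n).

Lemma C_subE (x y : C) s : (x - y)%R s = x s - y s. Proof. by []. Qed.

Lemma C_scaleE (a : R) (x : C) s : (a *: x)%R s = a *: x s. Proof. by []. Qed.

Lemma C_addE (x y : C) s : (x + y)%R s = x s + y s. Proof. by []. Qed.

Lemma clamp_bounds s : - r%:num <= clamp r s <= 0.
Proof. by have := clamp_in r s; rewrite /hitv/= in_itv. Qed.

Lemma clamp_continuous : continuous (clamp r).
Proof.
move=> s; apply/cvgrPdist_lt => e e0; apply: (nbhs_normW (x := s) e0) => t.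
by apply: le_lt_trans; exact: clamp_lip.
Qed.

Lemma clampK s : clamp r (clamp r s) = clamp r s.
Proof. by rewrite clamp_id//; exact: clamp_in. Qed.

Lemma segCE (y : R -> Rn) t s : continuous y ->
  segC (r := r) y t s = y (t + clamp r s).
Proof.
move=> cy; rewrite /segC.
have yh : (fun s => y (t + clamp r s)) \in @hist R r n.
  rewrite inE; split; last by apply/funext => u /=; rewrite clampK.
  move=> u; apply: (@continuous_comp _ _ _ (fun s => t + clamp r s) y).
    by apply: cvgD; [exact: cvg_cst|exact: clamp_continuous].
  exact: cy.
by rewrite insubdK.
Qed.

Lemma segC_norm_le (y : R -> Rn) t M : continuous y ->
  (forall s, t - r%:num <= s <= t -> `|y s| <= M) -> `|segC (r := r) y t| <= M.
Proof.
move=> cy H; apply: C_norm_le => s _; rewrite segCE//; apply: H.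
by have := clamp_bounds s => /andP[h1 h2]; apply/andP; split; lra.
Qed.

Lemma segCB (y z : R -> Rn) t : continuous y -> continuous z ->
  segC (r := r) y t - segC z t = segC (fun s => y s - z s) t.
Proof.
move=> cy cz; apply: CfunP => s _.
rewrite C_subE !segCE// => u.
by apply: cvgB; [exact: cy|exact: cz].
Qed.

Lemma segC_dist_le (y z : R -> Rn) t M : continuous y -> continuous z ->
  (forall s, t - r%:num <= s <= t -> `|y s - z s| <= M) ->
  `|segC (r := r) y t - segC z t| <= M.
Proof.
move=> cy cz H; rewrite segCB//; apply: segC_norm_le => // s.
by apply: cvgB; [exact: cy|exact: cz].
Qed.

Lemma segC_lip (y : R -> Rn) t N : continuous y -> 0 <= N ->
  (forall s u, t - r%:num <= s <= t -> t - r%:num <= u <= t ->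
     `|y s - y u| <= N * `|s - u|) ->
  forall s u, `|segC (r := r) y t s - segC (r := r) y t u| <= N * `|s - u|.
Proof.
move=> cy N0 H s u; rewrite !segCE//.
have /andP[h1 h2] := clamp_bounds s; have /andP[h3 h4] := clamp_bounds u.
have h5 : t - r%:num <= t + clamp r s <= t by apply/andP; split; lra.
have h6 : t - r%:num <= t + clamp r u <= t by apply/andP; split; lra.
apply: (le_trans (H _ _ h5 h6)).
by rewrite opprD addrACA subrr add0r ler_wpM2l// clamp_lip.
Qed.

Lemma uniform_continuous_segment (y : R -> Rn) a b e : continuous y -> 0 < e ->
  exists2 d, 0 < d & forall s t, a <= s <= b -> `|s - t| < d -> `|y s - y t| <= e.
Proof.
move=> cy e0.
have cI : compact [set` `[a, b]] by exact: segment_compact.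
have [p _|d d0 H] := compact_uniform_radius (Q := fun s t => `|y s - y t| <= e) cI.
  have e2 : 0 < e / 2 by rewrite divr_gt0.
  have /cvgrPdist_le/(_ _ e2)/nbhs_ballP[d /= d0 Hd] := cy p.
  exists d => // s t ps pt.
  rewrite (le_trans (ler_distD (y p) _ _))// (splitr e) lerD//; last exact: Hd.
  by rewrite distrC; exact: Hd.
exists d; first by [].
move=> s t sab st; have sI : [set` `[a, b]] s by rewrite /= in_itv.
by apply: (H _ _ sI); rewrite -ball_normE.
Qed.

Lemma segC_continuous (y : R -> Rn) : continuous y ->
  continuous (segC (r := r) y : R -> C).
Proof.
move=> cy t; apply/cvgrPdist_le => e e0.
have [d d0 Hd] := uniform_continuous_segment (t - r%:num) t cy e0.
apply: (nbhs_normW (x := t) d0) => u tu.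
apply: C_norm_le => s _.
rewrite C_subE !segCE//.
have /andP[h1 h2] := clamp_bounds s; apply: Hd; first by apply/andP; split; lra.
by rewrite opprD addrACA subrr addr0.
Qed.

Lemma segWE (y : R -> Rn) t N : continuous y -> 0 <= N ->
  (forall s u, t - r%:num <= s <= t -> t - r%:num <= u <= t ->
     `|y s - y u| <= N * `|s - u|) ->
  toC (segW (r := r) y t) = segC y t.
Proof.
move=> cy N0 H; rewrite /segW.
have yh : segC y t \in @lip_hist R r n.
  by apply/lip_histP; exists N => s u; exact: segC_lip.
by rewrite insubdK.
Qed.

Lemma eq_segC (y z : R -> Rn) t :
  (forall s, t - r%:num <= s <= t -> y s = z s) -> segC (r := r) y t = segC z t.
Proof.
move=> H; rewrite /segC; congr insubd; apply/funext => s; apply: H.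
by have := clamp_bounds s => /andP[h1 h2]; apply/andP; split; lra.
Qed.

Lemma segC_shift (y : R -> Rn) t c : segC (r := r) (fun s => y (s + c)) t = segC y (t + c).
Proof. by rewrite /segC; congr insubd; apply/funext => s; rewrite addrAC. Qed.

Lemma eq_segW (y z : R -> Rn) t :
  (forall s, t - r%:num <= s <= t -> y s = z s) -> segW (r := r) y t = segW z t.
Proof. by move=> H; rewrite /segW (eq_segC H). Qed.

Lemma segment_norm_le (V : normedModType R) (x y : V) A t : `|x| <= A -> `|y| <= A ->
  0 <= t <= 1 -> `|x + t *: (y - x)| <= A.
Proof.
move=> xA yA /andP[t0 t1].
have -> : x + t *: (y - x) = (1 - t) *: x + t *: y.
  by rewrite scalerBr scalerBl scale1r addrCA addrA [in RHS]addrC addrA.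
rewrite (le_trans (ler_normD _ _))// !normrZ (ger0_norm t0) ger0_norm ?subr_ge0//.
have -> : A = (1 - t) * A + t * A by rewrite -mulrDl subrK mul1r.
by rewrite lerD// ler_wpM2l// subr_ge0.
Qed.

Definition truncR (B a : R) : R := Num.max (- B) (Num.min B a).

Lemma truncR_lip B a b : `|truncR B a - truncR B b| <= `|a - b|.
Proof.
wlog ab : a b / a <= b => [H|].
  by have [/H//|/ltW/H] := leP a b; rewrite distrC (distrC b).
rewrite distrC (distrC a) (ger0_norm (_ : 0 <= b - a)) ?subr_ge0//.
rewrite /truncR ler_norml.
have [h1|h1] := leP B a; have [h2|h2] := leP B b;
  have [h3|h3] := leP (- B) B; have [h4|h4] := leP (- B) a;
  have [h5|h5] := leP (- B) b; apply/andP; split; lra.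
Qed.

Lemma truncR_le B a : 0 <= B -> `|truncR B a| <= B.
Proof.
move=> B0; rewrite /truncR ler_norml.
have [h1|h1] := leP B a; have [h3|h3] := leP (- B) B; have [h4|h4] := leP (- B) a;
  apply/andP; split; lra.
Qed.

Lemma truncR_id B a : `|a| <= B -> truncR B a = a.
Proof.
by rewrite ler_norml => /andP[h1 h2]; rewrite /truncR (min_idPr h2) (max_idPr h1).
Qed.

(** Truncation is done by coordinates, which suits the max norm: the map is 1-Lipschitz and fixes
    the ball of radius [B]. Truncating a history thus preserves its Lipschitz constants. *)
Definition truncV (B : R) (v : Rn) : Rn := \row_j truncR B (v ord0 j).

Lemma truncV_lip B v w : `|truncV B v - truncV B w| <= `|v - w|.
Proof.
apply: rV_norm_le => // j; rewrite !mxE (le_trans (truncR_lip _ _ _))//.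
by have := coord_norm_le (v - w) j; rewrite !mxE.
Qed.

Lemma truncV_le B v : 0 <= B -> `|truncV B v| <= B.
Proof. by move=> B0; apply: rV_norm_le => // j; rewrite mxE truncR_le. Qed.

Lemma truncV_id B v : `|v| <= B -> truncV B v = v.
Proof.
move=> vB; apply/rowP => j; rewrite mxE truncR_id//.
by rewrite (le_trans (coord_norm_le _ _)).
Qed.

Lemma truncV_continuous B : continuous (truncV B).
Proof.
move=> v; apply/(@cvgrPdist_lt _ _ _ (nbhs v) _ (truncV B)) => e e0.
apply: (nbhs_normW (x := v) e0) => w.
by apply: le_lt_trans; exact: truncV_lip.
Qed.

Lemma truncC_hist B (x : C) : truncV B \o x \in @hist R r n.
Proof.
rewrite inE; split; last by apply/funext => s /=; rewrite C_clamp.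
move=> s; apply: continuous_comp; [exact: C_continuous|exact: truncV_continuous].
Qed.

Definition truncC B (x : C) : C := MkCSpace (truncC_hist B x).

Lemma truncC_dist B (x y : C) : `|truncC B x - truncC B y| <= `|x - y|.
Proof.
apply: C_norm_le => s _; rewrite C_subE (le_trans (truncV_lip _ _ _))//.
by rewrite -C_subE C_norm_ge.
Qed.

Lemma truncC_le B (x : C) s : 0 <= B -> `|truncC B x s| <= B.
Proof. exact: truncV_le. Qed.

Lemma truncC_id B (x : C) : `|x| <= B -> truncC B x = x.
Proof.
move=> xB; apply: CfunP => s _; apply: truncV_id.
by rewrite (le_trans (C_norm_ge x s)).
Qed.

Lemma truncC_continuous B : continuous (truncC B).
Proof.
move=> x; apply/(@cvgrPdist_lt _ _ _ (nbhs x) _ (truncC B)) => e e0.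
apply: (nbhs_normW (x := x) e0) => w.
by apply: le_lt_trans; exact: truncC_dist.
Qed.

End segments.

(** * Regularity of the right-hand side *)

Section right_hand_side.
Context {R : realType} {r : {posnum R}} {n : nat} {Omega : metricType R}.
Local Notation Rn := 'rV[R]_n.
Local Notation C := (CSpace r n).
Local Notation W := (WSpace r n).
Implicit Types (s t u : R) (omega : Omega).

Record delay_hyps (sigma : R -> Omega -> Omega) (F : Omega -> Rn -> Rn -> Rn)
    (tau : Omega -> C -> R) : Prop := DelayHyps {
  base_compact : compact [set: Omega];
  base_flow : continuous_flow sigma;
  delay_range : forall omega x, 0 <= tau omega x <= r%:num;
  delay_H1 : cond_H1 F;
  delay_H2 : cond_H2 tau }.

Variables (sigma : R -> Omega -> Omega) (F : Omega -> Rn -> Rn -> Rn)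
  (tau : Omega -> C -> R).
Hypothesis H : delay_hyps sigma F tau.

Definition rhs (omega : Omega) (x : C) : Rn := F omega (x 0) (x (- tau omega x)).

Lemma ball_pair (X Y : pseudoMetricType R) (x x' : X) (y y' : Y) e :
  ball x e x' -> ball y e y' -> ball (x, y) e (x', y').
Proof. by []. Qed.

Lemma delay_hitv omega x : hitv r (- tau omega x).
Proof.
by have := delay_range H omega x; rewrite /hitv/= in_itv/= lerN2 oppr_le0 andbC.
Qed.

Lemma D2F_hom (p : Omega * Rn * Rn) (a : R) v :
  D2F F p.1.1 p.1.2 p.2 (a *: v) = a *: D2F F p.1.1 p.1.2 p.2 v.
Proof. exact: linearZ. Qed.

Lemma D3F_hom (p : Omega * Rn * Rn) (a : R) v :
  D3F F p.1.1 p.1.2 p.2 (a *: v) = a *: D3F F p.1.1 p.1.2 p.2 v.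
Proof. exact: linearZ. Qed.

Lemma D2tau_hom (p : Omega * C) (a : R) v :
  D2tau tau p.1 p.2 (a *: v) = a *: D2tau tau p.1 p.2 v.
Proof. exact: linearZ. Qed.

Definition box A : set (Omega * Rn * Rn) :=
  [set p | `|p.1.2| <= A /\ `|p.2| <= A].

Lemma box_compact A : compact (box A).
Proof.
have := compact_setX (compact_setX (base_compact H) (@normV_ball_compact R n A)) (@normV_ball_compact R n A).
by congr compact; apply/seteqP; split => -[[w a] b] /=; [case=> -[_ ? ?]|case].
Qed.

Definition hist_ball A N : set C :=
  [set x | (forall s, `|x s| <= A) /\ forall s t, `|x s - x t| <= N * `|s - t|].

Lemma hist_ball_pair_compact A N : compact [set p : Omega * C | hist_ball A N p.2].
Proof.
have := compact_setX (base_compact H) (@hist_ball_compact R r n A N).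
by congr compact; apply/seteqP; split => -[w x] /=; [case|].
Qed.

Lemma D2F_bounded A : exists2 M, 0 < M & forall omega a b, `|a| <= A -> `|b| <= A ->
  forall v, `|D2F F omega a b v| <= M * `|v|.
Proof.
have [cF dF c2 c3] := delay_H1 H.
have [|M M0 HM] := op_continuous_bounded c2 D2F_hom _ (@box_compact A).
  by move=> [[w a] b]; apply: diff_bounded; have [] := dF w a b.
by exists M => // w a b aA bA v; apply: (HM (w, a, b)).
Qed.

Lemma D3F_bounded A : exists2 M, 0 < M & forall omega a b, `|a| <= A -> `|b| <= A ->
  forall v, `|D3F F omega a b v| <= M * `|v|.
Proof.
have [cF dF c2 c3] := delay_H1 H.
have [|M M0 HM] := op_continuous_bounded c3 D3F_hom _ (@box_compact A).
  by move=> [[w a] b]; apply: diff_bounded; have [] := dF w a b.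
by exists M => // w a b aA bA v; apply: (HM (w, a, b)).
Qed.

Lemma D2tau_bounded (A : set (Omega * C)) : compact A ->
  exists2 M, 0 < M & forall omega x, A (omega, x) ->
  forall v, `|D2tau tau omega x v| <= M * `|v|.
Proof.
move=> cA; have [ct dt c2 _] := delay_H2 H.
have [|M M0 HM] := op_continuous_bounded c2 D2tau_hom _ cA.
  by move=> [w x]; apply: diff_bounded; exact: dt.
by exists M => // w x Ax v; apply: (HM (w, x)).
Qed.

Lemma F_lip A : exists2 l, 0 < l & forall omega a b a' b',
  `|a| <= A -> `|b| <= A -> `|a'| <= A -> `|b'| <= A ->
  `|F omega a b - F omega a' b'| <= l * (`|a - a'| + `|b - b'|).
Proof.
have [cF dF c2 c3] := delay_H1 H.
have [M2 M20 HM2] := D2F_bounded A; have [M3 M30 HM3] := D3F_bounded A.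
exists (M2 + M3) => [|w a b a' b' aA bA a'A b'A]; first exact: addr_gt0.
have h2 : `|F w a b - F w a' b| <= M2 * `|a - a'|.
  have := @diff_mean_value R _ n (F w ^~ b) a' (a - a') 0 (M2 * `|a - a'|).
  rewrite (addrC a' (a - a')) subrK subr0; apply => t t01.
  split; first by have [] := dF w (a' + t *: (a - a')) b.
  by rewrite subr0; apply: HM2 => //; exact: segment_norm_le.
have h3 : `|F w a' b - F w a' b'| <= M3 * `|b - b'|.
  have := @diff_mean_value R _ n (F w a') b' (b - b') 0 (M3 * `|b - b'|).
  rewrite (addrC b' (b - b')) subrK subr0; apply => t t01.
  split; first by have [] := dF w a' (b' + t *: (b - b')).
  by rewrite subr0; apply: HM3 => //; exact: segment_norm_le.
rewrite (le_trans (ler_distD (F w a' b) _ _))// (le_trans (lerD h2 h3))//.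
have := normr_ge0 (a - a'); have := normr_ge0 (b - b'); nra.
Qed.

Lemma hist_ball_segment A N x y t : hist_ball A N x -> hist_ball A N y ->
  0 <= t <= 1 -> hist_ball A N (x + t *: (y - x)).
Proof.
move=> [xA xN] [yA yN] t01; split=> [s|s u].
  by rewrite C_addE C_scaleE C_subE; apply: segment_norm_le.
rewrite !C_addE !C_scaleE !C_subE.
have -> : x s + t *: (y s - x s) - (x u + t *: (y u - x u)) =
    (x s - x u) + t *: ((y s - y u) - (x s - x u)).
  rewrite opprD addrACA -scalerBr; congr (_ + _ *: _).
  by rewrite opprD addrACA -opprD.
exact: segment_norm_le.
Qed.

(** Continuity bounds [D2tau] on compact sets, and a ball of C is in general not compact. The
    segment between two points of [hist_ball A N] stays in this set, on which [D2tau] is bounded. *)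
Lemma tau_lip A N : exists2 l, 0 < l & forall omega x y,
  hist_ball A N x -> hist_ball A N y ->
  `|tau omega x - tau omega y| <= l * `|x - y|.
Proof.
have [ct dt c2 _] := delay_H2 H.
have [M M0 HM] := D2tau_bounded (@hist_ball_pair_compact A N).
exists M => // w x y xA yA.
have := @diff_mean_value1 R _ (tau w) y (x - y) 0 (M * `|x - y|).
rewrite (addrC y (x - y)) subrK subr0; apply => t t01; split; first exact: dt.
by rewrite subr0; apply: HM; exact: hist_ball_segment.
Qed.

(** The delayed values split as (x - y)(- tau x) + (y(- tau x) - y(- tau y)). The second difference
    is where the Lipschitz constant [N] of the history enters. *)
Lemma rhs_lip A N : exists2 l, 0 < l & forall omega x y,
  hist_ball A N x -> hist_ball A N y ->
  `|rhs omega x - rhs omega y| <= l * `|x - y|.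
Proof.
have [l1 l10 Hl1] := F_lip A; have [l2 l20 Hl2] := tau_lip A N.
exists (l1 * (2 + `|N| * l2)) => [|w x y hx hy].
  rewrite mulr_gt0//; have : 0 <= `|N| * l2 by rewrite mulr_ge0// ltW.
  lra.
have [xA xN] := hx; have [yA yN] := hy.
rewrite /rhs (le_trans (Hl1 _ _ _ _ _ _ _ _ _))// -mulrA ler_wpM2l ?(ltW l10)//.
rewrite mulrDl mulr2n mulrDl mul1r -addrA lerD//.
  by rewrite -C_subE C_norm_ge.
rewrite (le_trans (ler_distD (y (- tau w x)) _ _))// lerD//.
  by rewrite -C_subE C_norm_ge.
rewrite (le_trans (yN _ _))// (@le_trans _ _ (`|N| * `|- tau w x - - tau w y|))//.
  by rewrite ler_wpM2r// ler_norm.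
rewrite -mulrA ler_wpM2l// opprK addrC distrC; exact: Hl2.
Qed.

Lemma F_bounded A : exists2 M, 0 < M & forall omega a b,
  `|a| <= A -> `|b| <= A -> `|F omega a b| <= M.
Proof.
have [cF _ _ _] := delay_H1 H.
have [||M M0 HM] := compact_uniform_bound
   (Q := fun (M : R) (p : Omega * Rn * Rn) => `|F p.1.1 p.1.2 p.2| <= M) (@box_compact A).
- by move=> M M' q MM' h; exact: le_trans MM'.
- move=> p _; exists (`|F p.1.1 p.1.2 p.2| + 1).
  have /(@cvgrPdist_le _ _ _ (nbhs p))/(_ 1 ltr01) := cF p.
  apply: filterS => q; rewrite distrC => h.
  by have := ler_normD (F q.1.1 q.1.2 q.2 - F p.1.1 p.1.2 p.2) (F p.1.1 p.1.2 p.2); rewrite subrK; lra.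
by exists M => // w a b aA bA; apply: (HM (w, a, b)).
Qed.

Lemma rhs_bounded A : exists2 M, 0 < M & forall omega (x : C),
  (forall s, `|x s| <= A) -> `|rhs omega x| <= M.
Proof. by have [M M0 HM] := F_bounded A; exists M => // w x xA; exact: HM. Qed.

Lemma pair_continuous (T U V : topologicalType) (f : T -> U) (g : T -> V) (z : T) :
  {for z, continuous f} -> {for z, continuous g} ->
  {for z, continuous (fun z : T => (f z, g z))}.
Proof.
move=> cf cg.
exact: (@cvg_pair _ _ _ (nbhs z) (nbhs (f z)) (nbhs (g z)) _ _ _ f g cf cg).
Qed.

Lemma eval_continuous : continuous (fun p : C * R => p.1 p.2).
Proof.
move=> [x s]; apply/(@cvgrPdist_le _ _ _ (nbhs (x, s)) _ (fun p : C * R => p.1 p.2)) => e e0.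
have e2 : 0 < e / 2 by rewrite divr_gt0.
have /(@cvgrPdist_le _ _ _ (nbhs s))/(_ _ e2) h1 := @C_continuous _ _ _ x s.
have h2 : \forall y \near x, `|x - y| < e / 2 by apply: (nbhs_normW (x := x) e2).
exists ([set y | `|x - y| < e / 2], [set t | `|x s - x t| <= e / 2]) => //= -[y t] /= [xy st].
rewrite (le_trans (ler_distD (x t) _ _))// (splitr e) lerD//.
by rewrite -C_subE (le_trans (C_norm_ge _ _))// ltW.
Qed.

Lemma rhs_continuous : continuous (fun p : Omega * C => rhs p.1 p.2).
Proof.
have [cF _ _ _] := delay_H1 H; have [ct _ _ _] := delay_H2 H.
move=> p; rewrite /rhs.
have c1 (T : topologicalType) (f : T -> C) (g : T -> R) (z : T) :
   {for z, continuous f} -> {for z, continuous g} ->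
   {for z, continuous (fun z : T => f z (g z))}.
  move=> cf cg; apply: (@continuous_comp _ _ _ (fun z : T => (f z, g z)) (fun p : C * R => p.1 p.2)).
    exact: pair_continuous.
  exact: eval_continuous.
apply: (@continuous_comp _ _ _ (fun p : Omega * C => (p.1, p.2 0, p.2 (- tau p.1 p.2)))
   (fun p : Omega * Rn * Rn => F p.1.1 p.1.2 p.2)); last exact: cF.
have h1 : {for p, continuous (fun p : Omega * C => p.2 0)}.
  by apply: (c1 _ (fun p : Omega * C => p.2) (fun=> 0)); [exact: cvg_snd|exact: cvg_cst].
have h2 : {for p, continuous (fun p : Omega * C => p.2 (- tau p.1 p.2))}.
  apply: (c1 _ (fun p : Omega * C => p.2) (fun p => - tau p.1 p.2)); first exact: cvg_snd.
  by apply: cvgN; exact: ct.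
have h0 : {for p, continuous (fun p : Omega * C => p.1)} by exact: cvg_fst.
exact: (pair_continuous (pair_continuous h0 h1) h2).
Qed.

(** * Global, local and truncated solutions *)

Local Notation Rp := [set` `[0 : R, +oo[].

Lemma local_has_derive_on (V : normedModType R) A (y z : R -> V) t l d :
  0 < d -> A t -> (forall s, A s -> `|s - t| < d -> y s = z s) ->
  has_derive_on A y t l -> has_derive_on A z t l.
Proof.
move=> d0 At yz; apply: cvg_trans; apply: near_eq_cvg.
rewrite near_withinE; apply: nbhs_dnbhs.
apply: (nbhs_normW (x := 0 : R) d0) => h; rewrite sub0r normrN => hd Ah.
by rewrite /growth_rate_on !yz// ?addrK// subrr normr0.
Qed.

Lemma continuous_comp_within (T U : topologicalType) (A : set R) (f : R -> U)
    (g : T -> R) : {within A, continuous f} -> continuous g ->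
  (forall z, A (g z)) -> continuous (f \o g).
Proof.
move=> /subspace_continuousP cf cg Ag z.
move=> V /(cf _ (Ag z)) hV.
have h : nbhs z (g @^-1` [set w | A w -> V (f w)]) := cg z _ hV.
by apply: filterS h => w /=; apply; exact: Ag.
Qed.

Lemma derive_dist_le (y g : R -> Rn) a b N : continuous y -> 0 <= a -> a <= b ->
  (forall t, a < t < b -> has_derive_on Rp y t (g t)) ->
  (forall t, a < t < b -> `|g t| <= N) -> `|y b - y a| <= N * (b - a).
Proof.
move=> cy a0 ab hy hg.
have cE : continuous (fun t => N * t).
  by move=> v; exact: is_derive_continuous (is_derive_mulr N v).
rewrite mulrBr; apply: (mean_value_ineq ab (continuous_subspaceT cy)
  (continuous_subspaceT cE) _ (fun s _ => is_derive_mulr N s) hg) => t tab.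
apply: has_derive_on_is_derive; last exact: hy.
by case/andP: tab => a1 _; exact: le_lt_trans a1.
Qed.

Lemma lip_glue (y : R -> Rn) N T :
  (forall s t, s <= 0 -> t <= 0 -> `|y s - y t| <= N * `|s - t|) ->
  (forall s t, 0 <= s -> s <= t -> t <= T -> `|y t - y s| <= N * (t - s)) ->
  forall s t, s <= T -> t <= T -> `|y s - y t| <= N * `|s - t|.
Proof.
move=> h1 h2.
suff H3 s t : s <= t -> t <= T -> `|y t - y s| <= N * (t - s).
  move=> s t sT tT; have [st|/ltW st] := leP s t.
    by rewrite distrC (distrC s) (ger0_norm (_ : 0 <= t - s)) ?subr_ge0// H3.
  by rewrite (ger0_norm (_ : 0 <= s - t)) ?subr_ge0// H3.
move=> st tT; have [s0|s0] := leP 0 s; first exact: h2.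
have [t0|t0] := leP 0 t; last first.
  by have := h1 t s (ltW t0) (ltW s0); rewrite ger0_norm ?subr_ge0.
have := h1 0 s (lexx _) (ltW s0); rewrite sub0r ger0_norm ?oppr_ge0 ?(ltW s0)//.
have := h2 0 t (lexx _) t0 tT; rewrite subr0.
have := ler_distD (y 0) (y t) (y s); lra.
Qed.

Lemma flow_path_continuous omega : continuous (sigma^~ omega).
Proof.
have [cs _ _] := base_flow H; move=> t.
apply: (@continuous_comp _ _ _ (fun t => (t, omega)) (fun p : R * Omega => sigma p.1 p.2)).
  apply: (@pair_continuous _ _ _ (fun t => t) (fun=> omega)).
    exact: cvg_id.
  exact: cvg_cst.
exact: cs.
Qed.

Lemma rhs_path_continuous omega (y : R -> C) : continuous y ->
  continuous (fun t => rhs (sigma t omega) (y t)).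
Proof.
move=> cy t.
apply: (@continuous_comp _ _ _ (fun t => (sigma t omega, y t))
   (fun p : Omega * C => rhs p.1 p.2)).
  apply: pair_continuous; [exact: flow_path_continuous|exact: cy].
exact: (rhs_continuous).
Qed.

Definition tsol B omega (x : C) (y : R -> Rn) :=
  ivp x (fun t => rhs (sigma t omega) (truncC B (segC y t))) y.

Definition gsol omega (x : C) (y : R -> Rn) :=
  ivp x (fun t => rhs (sigma t omega) (segC y t)) y.

(** A solution on [0, T[ is carried by a continuous function on the whole line that is unconstrained
    after [T], so that its segments never take a default value. *)
Definition lsol omega (x : C) T (y : R -> Rn) :=
  [/\ continuous y, forall s, s <= 0 -> y s = x s &
    forall t, 0 <= t -> t < T -> has_derive_on Rp y t (rhs (sigma t omega) (segC y t))].

Lemma truncC_segC_ball (y : R -> Rn) B N t : 0 <= B -> 0 <= N -> continuous y ->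
  (forall s u, s <= t -> u <= t -> `|y s - y u| <= N * `|s - u|) ->
  hist_ball B N (truncC (r := r) B (segC y t)).
Proof.
move=> B0 N0 cy yN; split=> [s|s u]; first exact: truncC_le.
rewrite (le_trans (truncV_lip _ _ _))//; apply: segC_lip => //.
by move=> v w /andP[_ vt] /andP[_ wt]; exact: yN.
Qed.

Lemma segC_ball (y : R -> Rn) B N t : 0 <= N -> continuous y ->
  (forall s, s <= t -> `|y s| <= B) ->
  (forall s u, s <= t -> u <= t -> `|y s - y u| <= N * `|s - u|) ->
  hist_ball B N (segC (r := r) y t).
Proof.
move=> N0 cy yB yN; split=> [s|s u].
  rewrite segCE//; apply: yB.
  by have /andP[_ h] := @clamp_bounds R r s; lra.
apply: segC_lip => // v w /andP[_ vt] /andP[_ wt]; exact: yN.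
Qed.

Lemma tsol_lip B M omega (x : W) y : 0 <= B ->
  (forall omega (x : C), (forall s, `|x s| <= B) -> `|rhs omega x| <= M) ->
  tsol B omega x y ->
  forall s t, `|y s - y t| <= Num.max `|x| M * `|s - t|.
Proof.
move=> B0 HM [cy y0 dy] s t.
apply: (@lip_glue y _ (Num.max s t)); rewrite ?le_max ?lexx ?orbT//.
  move=> u v u0 v0; rewrite !y0// (le_trans (W_lip x u v))//.
  by rewrite ler_wpM2r// le_max lexx.
move=> u v u0 uv _; apply: (derive_dist_le cy u0 uv) => w /andP[uw _].
  by apply: dy; rewrite (le_trans u0)// ltW.
by rewrite (le_trans (HM _ _ _)) ?le_max ?lexx ?orbT// => c; exact: truncC_le.
Qed.

(** The truncated right-hand side is bounded by [M], so the iteration preserves the class of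
    functions with Lipschitz constant [N]. On this class the truncated segments lie in
    [hist_ball B N], where [rhs] is Lipschitz. *)
Lemma tsol_exists B omega (x : W) : 0 <= B -> exists y, tsol B omega x y.
Proof.
move=> B0; have [M M0 HM] := rhs_bounded B.
pose N := Num.max `|x| M.
have N0 : 0 <= N by rewrite le_max normr_ge0.
have [l l0 Hl] := rhs_lip B N.
pose G t (y : R -> Rn) := rhs (sigma t omega) (truncC B (segC y t)).
pose P (y : R -> Rn) := (forall s, s <= 0 -> y s = x s) /\
  forall s t, `|y s - y t| <= N * `|s - t|.
have Pc y : P y -> continuous y.
  by move=> [_ yN]; exact: lipschitz_continuous yN.
have Px : P x by split => // s t; rewrite (le_trans (W_lip x s t))// ler_wpM2r// le_max lexx.
have := @picard R n P G x x l (N / (2 * l)) l0 _ (@C_continuous _ _ _ x) (@C_right _ _ _ x) Px.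
case=> //.
- by rewrite divr_ge0// mulr_ge0// ltW.
- by move=> y Py; split; [exact: Pc|case: Py].
- move=> y /Pc cy; apply: rhs_path_continuous => t.
  apply: continuous_comp; [exact: segC_continuous|exact: truncC_continuous].
- move=> y z Py [cz z0 dz]; split => // s t.
  apply: (@lip_glue z _ (Num.max s t)); rewrite ?le_max ?lexx ?orbT//.
    by move=> u v u0 v0; rewrite !z0//; case: Px => _; exact.
  move=> u v u0 uv _; apply: (derive_dist_le cz u0 uv) => w /andP[uw _].
    by apply: dz; rewrite (le_trans u0)// ltW.
  by rewrite (le_trans (HM _ _ _)) ?le_max ?lexx ?orbT// => c; exact: truncC_le.
- move=> u y Pu uy; split => [s s0|s t].
    apply/eqP; rewrite -subr_eq0 -normr_le0; apply/ler_addgt0Pr => e e0; rewrite add0r.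
    have [k0 Hk] := uy s e e0; have [us _] := Pu k0.
    by rewrite -us// distrC; exact: Hk.
  apply/ler_addgt0Pr => e e0; have e2 : 0 < e / 2 by rewrite divr_gt0.
  have [k0 Hk] := uy (Num.max s t) _ e2; have [_ uN] := Pu k0.
  have := Hk k0 s (leqnn _); rewrite le_max lexx => /(_ isT).
  have := Hk k0 t (leqnn _); rewrite le_max lexx orbT => /(_ isT).
  have := uN s t; have := ler_distD (u k0 s) (y s) (y t).
  have := ler_distD (u k0 t) (u k0 s) (y t); rewrite (distrC (y s) (u k0 s)); lra.
- move=> y z t K Py Pz t0 yz; have cy := Pc _ Py; have cz := Pc _ Pz.
  have [_ yN] := Py; have [_ zN] := Pz.
  rewrite (le_trans (Hl _ _ _ _ _))//; [exact: truncC_segC_ball..|].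
  rewrite ler_wpM2l ?(ltW l0)// (le_trans (truncC_dist _ _ _))//.
  by apply: segC_dist_le => // s /andP[_]; exact: yz.
- move=> z [cz z0 dz] t t0.
  have h : `|z t - x t| <= N * t.
    rewrite (C_right x t0) -(z0 0 (lexx 0)) -[X in _ * X](subr0 t).
    apply: (derive_dist_le cz (lexx 0) t0) => s /andP[s0 _].
      by apply: dz; exact: ltW.
    rewrite (le_trans (HM _ _ _)) ?le_max ?lexx ?orbT// => c.
    exact: truncC_le.
  exact: le_trans h (linear_le_expR t l0 N0).
by move=> y [_ iy]; exists y.
Qed.

Lemma lsol_bounded omega (x : W) T y : lsol omega x T y ->
  exists2 A, 0 <= A & forall s, s <= T -> `|y s| <= A.
Proof.
move=> [cy y0 _]; apply: (@history_bounded _ _ y `|x| T cy) => // s s0.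
by rewrite y0// (le_trans (C_norm_ge _ _))// W_norm_C.
Qed.

Lemma lsol_lip omega (x : W) T y A M :
  (forall omega (x : C), (forall s, `|x s| <= A) -> `|rhs omega x| <= M) ->
  lsol omega x T y -> (forall s, s <= T -> `|y s| <= A) ->
  forall s t, s <= T -> t <= T -> `|y s - y t| <= Num.max `|x| M * `|s - t|.
Proof.
move=> HM [cy y0 dy] yA; apply: lip_glue.
  move=> s u s0 u0; rewrite !y0// (le_trans (W_lip _ _ _))// ler_wpM2r//.
  by rewrite le_max lexx.
move=> s u s0 su uT; apply: (derive_dist_le cy s0 su) => v /andP[sv vu].
  apply: dy; first by rewrite (le_trans s0)// ltW.
  by rewrite (lt_le_trans vu).
rewrite (le_trans (HM _ _ _)) ?le_max ?lexx ?orbT// => c; rewrite segCE//; apply: yA.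
by have /andP[_ h] := @clamp_bounds R r c; lra.
Qed.

(** Both solutions are bounded up to [T], hence equi-Lipschitz there, and their segments lie in a
    common [hist_ball A N] depending on the two solutions. Gronwall then applies with zero initial
    difference. *)
Lemma lsol_unique omega (x : W) T y z : lsol omega x T y -> lsol omega x T z ->
  forall t, t <= T -> y t = z t.
Proof.
move=> hy hz t tT; have [cy y0 dy] := hy; have [cz z0 dz] := hz.
have [t0|/ltW t0] := leP t 0; first by rewrite y0// z0.
have [A1 A10 yA] := lsol_bounded hy; have [A2 A20 zA] := lsol_bounded hz.
pose A := Num.max A1 A2.
have [M M0 HM] := rhs_bounded A.
pose N := Num.max `|x| M.
have N0 : 0 <= N by rewrite le_max normr_ge0.
have {}yA s : s <= T -> `|y s| <= A by move=> /yA h; rewrite le_max h.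
have {}zA s : s <= T -> `|z s| <= A by move=> /zA h; rewrite le_max h orbT.
have yN := lsol_lip HM hy yA; have zN := lsol_lip HM hz zA.
have [l l0 Hl] := rhs_lip A N.
have := @delay_gronwall0 R n (fun s => y s - z s)
  (fun t => rhs (sigma t omega) (segC y t) - rhs (sigma t omega) (segC z t)) l 0 T t l0.
rewrite mulr0 mul0r => h; apply/eqP; rewrite -subr_eq0 -normr_le0; apply: h => //.
- by move=> s; apply: cvgB; [exact: cy|exact: cz].
- by move=> s s0; rewrite y0// z0// subrr normr0.
- move=> s /andP[s0 sT]; apply: has_derive_onB; [apply: dy|apply: dz] => //; exact: ltW.
- move=> s Q /andP[s0 sT] HQ; rewrite (le_trans (Hl _ _ _ _ _))//.
  + apply: segC_ball => // [u us|u v us vs]; [apply: yA|apply: yN];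
      by rewrite (le_trans _ (ltW sT)).
  + apply: segC_ball => // [u us|u v us vs]; [apply: zA|apply: zN];
      by rewrite (le_trans _ (ltW sT)).
  rewrite ler_wpM2l ?(ltW l0)//; apply: segC_dist_le => // u /andP[_]; exact: HQ.
- exact: le_trans tT.
Qed.

(** * Comparison with the maximal solution, and time shifts *)

Local Notation is_sol := (is_sol sigma F tau).
Local Notation sol := (sol sigma F tau).
Local Notation sol_time := (sol_time sigma F tau).

Lemma continuous_maxr c : continuous (fun t => Num.max t c).
Proof.
by move=> t; apply: (@continuous_max _ _ (fun t => t) (fun=> c)); [exact: cvg_id|exact: cvg_cst].
Qed.

Lemma continuous_minr c : continuous (fun t => Num.min t c).
Proof.
by move=> t; apply: (@continuous_min _ _ (fun t => t) (fun=> c)); [exact: cvg_id|exact: cvg_cst].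
Qed.

Lemma rhs_segC omega (y z : R -> Rn) t : continuous z ->
  (forall s, t - r%:num <= s <= t -> y s = z s) ->
  F omega (y t) (y (t - tau omega (segC y t))) = rhs omega (segC z t).
Proof.
move=> cz yz; rewrite /rhs -(eq_segC yz) (eq_segC yz) !segCE//.
have /andP[t0 tr] := delay_range H omega (segC z t).
rewrite !clamp_id; [|exact: (delay_hitv)|exact: hitv0].
by rewrite addr0 !yz//; apply/andP; split; rewrite ?lexx//; (have r0 : 0 < r%:num :> R by []); lra.
Qed.

(** The function in [is_sol] is arbitrary outside [-r, b[. Freezing it at -r and at [T < b] makes it
    continuous on the line without changing it on [-r, T]. *)
Lemma is_sol_lsol omega (x : W) b y T : is_sol omega x b y -> 0 <= T -> (T%:E < b)%E ->
  lsol omega x T (fun t => y (Num.min (Num.max t (- r%:num)) T)).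
Proof.
move=> [yx cy dy] T0 Tb.
have r0 : 0 < r%:num :> R by [].
have rT : - r%:num <= T by lra.
pose A := [set t : R | - r%:num <= t /\ (t%:E < b)%E].
pose g t := Num.min (Num.max t (- r%:num)) T.
have cg : continuous g.
  move=> t; apply: (@continuous_comp _ _ _ (fun t => Num.max t (- r%:num)) (fun t => Num.min t T)).
    exact: continuous_maxr.
  exact: continuous_minr.
have gE t : - r%:num <= t -> t <= T -> g t = t.
  by move=> h1 h2; rewrite /g (max_idPl h1) (min_idPl h2).
have gA t : A (g t).
  split; first by rewrite le_min rT le_max lexx orbT.
  by apply: le_lt_trans Tb; rewrite lee_fin ge_min lexx orbT.
have cz : continuous (y \o g) by exact: (continuous_comp_within cy cg gA).
split => //.
- move=> s s0; rewrite -/(g s); have -> : g s = clamp r s.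
    rewrite /g /clamp (min_idPr s0) maxC; apply/min_idPl.
    by rewrite ge_max rT (le_trans s0).
  rewrite -[RHS]C_clamp; apply: yx; rewrite inE; exact: clamp_in.
- move=> t t0 tT.
  apply: (@local_has_derive_on _ Rp y (y \o g) t _ (T - t)).
  + by rewrite subr_gt0.
  + by rewrite /= in_itv/= t0.
  + move=> s; rewrite /= in_itv/= andbT => s0 sT; rewrite gE//.
      by rewrite (le_trans _ s0)// oppr_le0.
    by have := ler_norm (s - t); lra.
  have tb : (t%:E < b)%E by apply: lt_trans Tb; rewrite lte_fin.
  have := dy t t0 tb; rewrite (@rhs_segC _ y (y \o g))// => s /andP[s1 s2] /=.
  by rewrite gE//; lra.
Qed.

Lemma gsol_lsol omega (x : C) y T : gsol omega x y -> lsol omega x T y.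
Proof. by move=> [cy y0 dy]; split => // t t0 _; exact: dy. Qed.

(** [sol_time] is a supremum of existence times, so an infinite value only yields one solution for
    each integer time; uniqueness glues them. *)
Lemma lsol_gsol omega (x : W) : (forall k : nat, exists y, lsol omega x k%:R y) ->
  exists y, gsol omega x y.
Proof.
move=> /choice[Y HY].
have YE k m t : t <= k%:R -> t <= m%:R -> Y k t = Y m t.
  move=> tk tm; wlog km : k m tk tm / (k <= m)%N => [h|].
    by have [/h|/ltnW/h] := leqP k m; [|move=> ->]; auto.
  apply: (lsol_unique (HY k)) => //.
  have [cy y0 dy] := HY m; split=> // s s0 sk; apply: dy => //.
  by rewrite (lt_le_trans sk)// ler_nat.
(* The strict inequality [t < k t] leaves room: near [t] the glued function is the single function
   [Y (k t)]. *)
pose k t := (Num.trunc `|t|).+1.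
have tk t : t < (k t)%:R.
  by rewrite (le_lt_trans (ler_norm t))// truncnS_gt.
pose y t := Y (k t) t.
have yE m t : t <= m%:R -> y t = Y m t by move=> tm; apply: YE => //; exact: ltW.
have loc t : {near t, Y (k t) =1 y}.
  have d0 : 0 < (k t)%:R - t by rewrite subr_gt0.
  apply: (nbhs_normW (x := t) d0) => s st; rewrite (yE (k t))//.
  by have := ler_norm (s - t); rewrite distrC in st; lra.
have cy : continuous y.
  move=> t; have [cY _ _] := HY (k t).
  have h := cY t; rewrite /continuous_at -(yE (k t) t (ltW (tk t))) in h.
  by apply: cvg_trans h; exact: (near_eq_cvg (loc t)).
exists y; split=> //.
- by move=> s s0; rewrite (yE 0%N)//; have [_ + _] := HY 0%N; apply.
- move=> t t0; have [cY Y0 dY] := HY (k t).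
  apply: (@local_has_derive_on _ Rp (Y (k t)) y t _ ((k t)%:R - t)).
  + by rewrite subr_gt0.
  + by rewrite /= in_itv/= t0.
  + move=> s _ sT; rewrite (yE (k t))//.
    by have := ler_norm (s - t); lra.
  have := dY t t0 (tk t); rewrite (eq_segC (z := y))// => s /andP[_ st].
  by rewrite (yE (k t))// (le_trans st)// ltW.
Qed.

Lemma gsol_is_sol omega (x : W) y : gsol omega x y -> is_sol omega x +oo%E y.
Proof.
move=> [cy y0 dy]; split.
- by move=> s; rewrite inE /hitv/= in_itv/= => /andP[_]; exact: y0.
- exact: continuous_subspaceT.
- by move=> t t0 _; rewrite (@rhs_segC _ y y)//; exact: dy.
Qed.

Lemma sol_time_gsol omega (x : W) : sol_time omega x = +oo%E -> exists y, gsol omega x y.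
Proof.
move=> xoo; apply: lsol_gsol => k.
have : (k%:R%:E < sol_time omega x)%E by rewrite xoo ltry.
move=> /ereal_sup_gt[b [b0 [y yb]] kb].
by eexists; apply: is_sol_lsol yb _ kb; exact: ler0n.
Qed.

(** A global solution shows that [sol] is not the default of [xget]. Since [sol] may be any
    solution, uniqueness is needed to identify it, and it does so only from -r on. *)
Lemma gsol_sol omega (x : W) y : gsol omega x y ->
  sol_time omega x = +oo%E /\ forall t, - r%:num <= t -> sol omega x t = y t.
Proof.
move=> gy; have yoo := gsol_is_sol gy.
have xoo : sol_time omega x = +oo%E.
  apply/eqP; rewrite -leye_eq; apply: ereal_sup_ubound.
  by split; [exact: ltry|exists y].
split=> // t rt.
have soloo : is_sol omega x +oo%E (sol omega x).
  by rewrite /sol xoo; apply: xgetPex; exists y.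
pose T := Num.max t 0.
have T0 : 0 <= T by rewrite le_max lexx orbT.
have tT : t <= T by rewrite le_max lexx.
have := lsol_unique (is_sol_lsol soloo T0 (ltry _)) (gsol_lsol T gy) tT.
by rewrite (max_idPl rt) (min_idPl tT).
Qed.

Lemma gsol_segW omega (x : W) y t : gsol omega x y -> toC (segW (r := r) y t) = segC y t.
Proof.
move=> gy; have ly := gsol_lsol t gy; have [A A0 yA] := lsol_bounded ly.
have [M M0 HM] := rhs_bounded A; have [cy _ _] := gy.
have N0 : 0 <= Num.max `|x| M by rewrite le_max normr_ge0.
by apply: (segWE cy N0) => s u /andP[_ h1] /andP[_ h2]; exact: (lsol_lip HM ly yA).
Qed.

(** The values before -r are frozen, so that the past of the shifted function is the segment
    [segC y c] on all of ]-oo, 0], as [ivp] demands. *)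
Definition shiftn (y : R -> Rn) c t := y (Num.max t (- r%:num) + c).

Lemma shiftn_continuous y c : continuous y -> continuous (shiftn y c).
Proof.
move=> cy t; apply: (@continuous_comp _ _ _ (fun t => Num.max t (- r%:num) + c) y); last exact: cy.
by apply: cvgD; [exact: continuous_maxr|exact: cvg_cst].
Qed.

Lemma segC_shiftn y c t : 0 <= t -> segC (shiftn y c) t = segC (r := r) y (t + c).
Proof.
move=> t0; rewrite -segC_shift; apply: eq_segC => s /andP[h _].
by rewrite /shiftn (max_idPl _)//; lra.
Qed.

Lemma segW_shiftn y c t : 0 <= t -> segW (shiftn y c) t = segW (r := r) y (t + c).
Proof. by move=> t0; rewrite /segW segC_shiftn. Qed.

Lemma shiftn_past y c s : continuous y -> s <= 0 -> shiftn y c s = segC (r := r) y c s.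
Proof.
move=> cy s0; rewrite segCE// /shiftn /clamp (min_idPr s0) maxC addrC.
by [].
Qed.

Lemma ivp_shift (x : R -> Rn) g y c : 0 <= c -> ivp x g y ->
  ivp (segC (r := r) y c) (fun t => g (t + c)) (shiftn y c).
Proof.
move=> c0 [cy y0 dy]; split.
- exact: shiftn_continuous.
- by move=> s s0; exact: shiftn_past.
- move=> t t0; have tc : 0 <= t + c by exact: addr_ge0.
  have rp : Rp t by rewrite /= in_itv/= t0.
  apply: (@eq_has_derive_on _ _ _ (fun s => y (s + c))) => //.
    move=> s; rewrite /= in_itv/= andbT => s0; rewrite /shiftn (max_idPl _)//.
    by rewrite (le_trans _ s0)// oppr_le0.
  apply: (@has_derive_on_shift _ _ Rp) (dy _ tc) => s.
  by rewrite /= !in_itv/= !andbT => s0; exact: addr_ge0.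
Qed.

Lemma eq_ivp (x g g' y : R -> Rn) : (forall t, 0 <= t -> g t = g' t) ->
  ivp x g y -> ivp x g' y.
Proof. by move=> gg [cy y0 dy]; split => // t t0; rewrite -gg//; exact: dy. Qed.

Lemma flowD omega s t : sigma (s + t) omega = sigma s (sigma t omega).
Proof. by have [_ _ ->] := base_flow H. Qed.

Lemma flow0 omega : sigma 0 omega = omega.
Proof. by have [_ -> _] := base_flow H. Qed.

Lemma gsol_shift omega (x : W) y c : 0 <= c -> gsol omega x y ->
  gsol (sigma c omega) (segW (r := r) y c) (shiftn y c).
Proof.
move=> c0 gy; rewrite (gsol_segW _ gy); apply: eq_ivp (ivp_shift c0 gy) => t t0.
by rewrite segC_shiftn// flowD.
Qed.

End right_hand_side.

(** * Uniform smallness on compact sets, distances and exponential rates *)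

Lemma compact_uniform_small {R : realType} (X : topologicalType) (A : set X)
    (Q : R -> X -> Prop) : compact A ->
  (forall d d' q, d' <= d -> Q d q -> Q d' q) ->
  (forall p, A p -> exists2 d, 0 < d & \forall q \near p, Q d q) ->
  exists2 d, 0 < d & forall q, A q -> Q d q.
Proof.
move=> cA mono HQ.
have [|p /HQ[d d0 hd]|M M0 HM] :=
  @compact_uniform_bound R X A (fun M q => 0 < M /\ Q M^-1 q) cA.
- move=> M M' q MM' [M0 hq]; have M'0 := lt_le_trans M0 MM'.
  by split => //; apply: mono hq; rewrite lef_pV2.
- by exists d^-1; apply: filterS hd => q hq; rewrite invr_gt0 invrK.
by exists M^-1; [rewrite invr_gt0|move=> q /HM[]].
Qed.

Lemma dist_quad {R : realType} (V : normedModType R) (a a' b b' : V) :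
  `|a' - b'| <= `|a - a'| + `|b - b'| + `|a - b|.
Proof.
have := ler_distD a a' b'; have := ler_distD b a b'.
rewrite (distrC a' a); lra.
Qed.

Lemma dist_quad_le {R : realType} (V : normedModType R) (a a' b b' : V) e1 e2 e3 :
  `|a - a'| <= e1 -> `|b - b'| <= e2 -> `|a - b| <= e3 ->
  `|a' - b'| <= e1 + e2 + e3.
Proof.
by move=> h1 h2 h3; apply: le_trans (dist_quad a a' b b') _; exact: lerD (lerD h1 h2) h3.
Qed.

Lemma dist_refl_le {R : realType} (V : normedModType R) (a : V) : `|a - a| <= 0.
Proof. by rewrite subrr normr0. Qed.

Lemma quarter_split {R : realType} (m : R) : m = m / 4 + m / 4 + m / 2.
Proof. by lra. Qed.

Lemma dist_chain_le {R : realType} (V : normedModType R) (a b c : V) e1 e2 :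
  `|a - b| <= e1 -> `|b - c| <= e2 -> `|a - c| <= e1 + e2.
Proof. by move=> h1 h2; apply: le_trans (ler_distD b a c) _; exact: lerD. Qed.

Lemma norm_eq_le (R : numDomainType) (V : normedZmodType R) (a b : V) (c : R) :
  a = b -> `|b| <= c -> `|a| <= c.
Proof. by move=> ->. Qed.

Lemma expRN_le1 (R : realType) (a b : R) : 0 <= a -> 0 <= b -> expR (- a * b) <= 1.
Proof. by move=> a0 b0; rewrite -expR0 ler_expR mulNr oppr_le0 mulr_ge0. Qed.

Section rate_constants.
Context {R : realType}.
Implicit Types (a b c f k s t : R).

Lemma rate_shift b s t k c f :
  k * expR (- b * (t - s)) * (c * f) = k * c * expR (b * s) * expR (- b * t) * f.
Proof.
have -> : - b * (t - s) = b * s + - b * t by ring.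
by rewrite expRD; ring.
Qed.

Lemma le_rate b s t k c a f : 0 <= b -> t <= s -> 1 <= k -> 0 <= a -> a <= c -> 0 <= f ->
  a * f <= k * c * expR (b * s) * expR (- b * t) * f.
Proof.
move=> b0 ts k1 a0 ac f0; apply: ler_wpM2r => //.
rewrite -mulrA -expRD -[leLHS]mulr1; apply: ler_pM => //.
  by apply: (le_trans ac); apply: ler_peMl k1; exact: le_trans ac.
by rewrite -expR0 ler_expR mulNr -mulrBr mulr_ge0// subr_ge0.
Qed.

Lemma rate_le b s t k c f : 0 <= b -> s <= t -> 0 <= k -> 0 <= c -> 0 <= f ->
  k * expR (- b * (t - s)) * (c * f) <= k * c * f.
Proof.
move=> b0 st k0 c0 f0; rewrite -[leRHS]mulrA; apply: ler_wpM2r; first exact: mulr_ge0.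
by apply: ler_piMr => //; apply: expRN_le1 => //; rewrite subr_ge0.
Qed.

End rate_constants.

Section growth_rates.
Context {R : realType}.
Implicit Types (f : R -> \bar R) (a t N : R).

(** The case [N = 0] is included: there [lne] is -oo and both sides hold for every rate. *)
Lemma lne_rate_le a t N : 0 < t -> 0 <= N ->
  (t^-1%:E * lne N%:E <= a%:E)%E = (N <= expR (a * t)).
Proof.
move=> t0; rewrite le_eqVlt => /predU1P[<-|N0].
  by rewrite le0_lneNy// gt0_muleNy ?lte_fin ?invr_gt0// leNye expR_ge0.
rewrite lne_EFin// -EFinM lee_fin mulrC ler_pdivrMr//.
by rewrite -[LHS]ler_expR lnK// posrE.
Qed.

Lemma limf_esup_pinfty_le f (a : \bar R) M : (forall t, M < t -> (f t <= a)%E) ->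
  (limf_esup f (pinfty_nbhs R) <= a)%E.
Proof.
move=> fa; apply: (@le_trans _ _ (ereal_sup [set f t | t in [set t | M < t]])).
  apply: ereal_inf_lbound; exists [set t | M < t] => //.
  by exists M; split; [exact: num_real|].
by apply: ge_ereal_sup => _ [t Mt <-]; exact: fa.
Qed.

Lemma limf_esup_pinfty_lt f (a : \bar R) : (limf_esup f (pinfty_nbhs R) < a)%E ->
  exists M, forall t, M < t -> (f t < a)%E.
Proof.
move=> /ereal_inf_lt[_ [A [M [_ MA]] <-]] fa; exists M => t Mt.
apply: le_lt_trans fa; apply: ereal_sup_ubound; exists t => //; exact: MA.
Qed.

End growth_rates.

(** * Solutions starting in K *)

Section invariant_set.
Context {R : realType} {r : {posnum R}} {n : nat} {Omega : metricType R}.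
Local Notation Rn := 'rV[R]_n.
Local Notation C := (CSpace r n).
Local Notation W := (WSpace r n).
Local Notation Rp := [set` `[0 : R, +oo[].
Implicit Types (s t u : R) (omega : Omega) (x : W) (p q : Omega * W) (phi : C).

Record K_hyps (sigma : R -> Omega -> Omega) (F : Omega -> Rn -> Rn -> Rn)
    (tau : Omega -> C -> R) (K : set (Omega * W)) : Prop := KHyps {
  K_delay : delay_hyps sigma F tau;
  K_cpt : compact K;
  K_inv : positively_invariant sigma F tau K;
  K_back : forall p, K p -> backward_extension sigma F tau K p }.

Variables (sigma : R -> Omega -> Omega) (F : Omega -> Rn -> Rn -> Rn)
  (tau : Omega -> C -> R) (K : set (Omega * W)).
Hypothesis HK : K_hyps sigma F tau K.
Let H := K_delay HK.
Local Notation rhs := (rhs F tau).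
Local Notation gsol := (gsol sigma F tau).
Local Notation lsol := (lsol sigma F tau).
Local Notation is_sol := (is_sol sigma F tau).
Local Notation sol := (sol sigma F tau).
Local Notation sol_time := (sol_time sigma F tau).
Local Notation Pi := (Pi sigma F tau).

(* Opaque, so that failing unification problems do not unfold [sol]. *)
Fact Ksol_subproof : {f : Omega * W -> R -> Rn |
  forall p t, f p t = sol p.1 p.2 (Num.max t (- r%:num))}.
Proof. by eexists. Qed.

Definition Ksol := sval Ksol_subproof.

Lemma KsolE p t : Ksol p t = sol p.1 p.2 (Num.max t (- r%:num)).
Proof. exact: (svalP Ksol_subproof). Qed.

Lemma r_gt0 : 0 < r%:num :> R. Proof. by []. Qed.

(** Freezing at -r replaces the arbitrary values of [sol] before -r by those of the extended
    history, so that uniqueness gives equality of functions on the whole line. *)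
Lemma Ksol_gsol p : K p -> gsol p.1 p.2 (Ksol p).
Proof.
move=> Kp; have [/(sol_time_gsol H)[y gy] _] := K_inv HK Kp.
have [_ yE] := gsol_sol H gy.
have -> : Ksol p = y; last by [].
have [cy y0 _] := gy; apply/funext => t; rewrite KsolE.
rewrite yE ?le_max ?lexx ?orbT//.
have [//|rt] := leP (- r%:num) t.
have t0 : t <= 0 by rewrite (le_trans (ltW rt))// oppr_le0.
rewrite y0 ?oppr_le0// y0// -(C_clamp p.2 t); congr (p.2 _).
by rewrite /clamp (min_idPr t0) (max_idPl (ltW rt)).
Qed.

Lemma Ksol_continuous p : K p -> continuous (Ksol p).
Proof. by move=> /Ksol_gsol[]. Qed.

Lemma Ksol_past p s : K p -> s <= 0 -> Ksol p s = p.2 s.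
Proof. by move=> /Ksol_gsol[_ + _]; exact. Qed.

Lemma usol_Ksol p t : 0 <= t -> usol sigma F tau t p.1 p.2 = segW (Ksol p) t.
Proof.
move=> t0; apply: eq_segW => s /andP[h _]; rewrite KsolE (max_idPl _)//.
by rewrite (le_trans _ h)// -[leLHS]add0r lerD2r.
Qed.

Lemma Pi_in p t : K p -> 0 <= t -> K (Pi t p).
Proof. by move=> Kp; have [_] := K_inv HK Kp; exact. Qed.

Lemma Pi2E p t : K p -> 0 <= t -> toC (Pi t p).2 = segC (Ksol p) t.
Proof.
by move=> Kp t0; rewrite /= usol_Ksol// (gsol_segW H _ (Ksol_gsol Kp)).
Qed.

Lemma Pi_eval p t s : K p -> 0 <= t -> hitv r s -> (Pi t p).2 s = Ksol p (t + s).
Proof.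
move=> Kp t0 hs; rewrite Pi2E// segCE ?clamp_id//; exact: Ksol_continuous.
Qed.

Lemma Ksol_Pi p c t : K p -> 0 <= c -> - r%:num <= t -> Ksol (Pi c p) t = Ksol p (t + c).
Proof.
move=> Kp c0 rt; have gp := gsol_shift H c0 (Ksol_gsol Kp).
have gq := Ksol_gsol (Pi_in Kp c0); rewrite /= usol_Ksol// in gq.
have := lsol_unique H (gsol_lsol t gq) (gsol_lsol t gp) (lexx t).
rewrite /= /shiftn (max_idPl rt) => <-.
by rewrite /Defs.Pi usol_Ksol.
Qed.

(** Compactness of K in the W-topology bounds the norms, so that the real [sup] in [rho0] is an
    actual upper bound and not a default value. *)
Lemma rho0_ge p : K p -> `|p.2| <= rho0 K.
Proof.
move=> Kp; apply: ub_le_sup; last by exists p.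
have [||M M0 HM] := @compact_uniform_bound R _ K (fun M q => `|q.2| <= M) (K_cpt HK).
- by move=> M M' q MM' h; exact: le_trans MM'.
- move=> q _; exists (`|q.2| + 1).
  have : {for q, continuous (fun q : Omega * W => q.2)} by exact: cvg_snd.
  move=> /(@cvgrPdist_le _ _ _ (nbhs q))/(_ 1 ltr01); apply: filterS => q'.
  have := ler_normD (q'.2 - q.2) q.2; rewrite subrK distrC; lra.
by exists M => _ [q Kq <-]; exact: HM.
Qed.

Lemma rho0_ge0 p : K p -> 0 <= rho0 K.
Proof. by move=> /rho0_ge; exact: le_trans. Qed.

Lemma Ksol_le p t : K p -> `|Ksol p t| <= rho0 K.
Proof.
move=> Kp; have [t0|/ltW t0] := leP t 0.
  rewrite Ksol_past// (le_trans (C_norm_ge _ _))// (le_trans (W_norm_C _))//.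
  exact: rho0_ge.
have KP := Pi_in Kp t0.
have := Pi_eval Kp t0 (hitv0 r); rewrite addr0 => <-.
by rewrite (le_trans (C_norm_ge _ _))// (le_trans (W_norm_C _))// rho0_ge.
Qed.

Lemma K_ball p : K p -> hist_ball (rho0 K) (rho0 K) (toC p.2).
Proof.
move=> Kp; split=> [s|s t].
  by rewrite (le_trans (C_norm_ge _ _))// (le_trans (W_norm_C _))// rho0_ge.
by rewrite (le_trans (W_lip _ _ _))// ler_wpM2r// rho0_ge.
Qed.

Lemma K_backward p : K p -> exists q, K q /\ Pi r%:num q = p.
Proof.
move=> Kp; have [th [_ Kth th0 Hth]] := K_back HK Kp.
have r0 := ltW r_gt0.
exists (th (- r%:num)); split; first by apply: Kth; rewrite oppr_le0.
by rewrite (Hth (- r%:num) r%:num)// addrN.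
Qed.

(** * Derivatives of the histories in K *)

Lemma within_hitv_proper s : hitv r s ->
  ProperFilter (within [set h | hitv r (h + s)] 0^').
Proof.
move=> hs; apply: Build_ProperFilter_ex => B.
rewrite /within/= => /nbhs_ballP[d /= d0 Hd].
pose e := Num.min (d / 2) (r%:num / 2).
have r0 := r_gt0.
have e0 : 0 < e by rewrite lt_min !divr_gt0.
have ed : e <= d / 2 by rewrite ge_min lexx.
have er : e <= r%:num / 2 by rewrite ge_min lexx orbT.
have {}Hd (h : R) : `|h| = e -> hitv r (h + s) -> B h.
  move=> he hsh; apply: (Hd h); last exact: hsh.
    by rewrite -ball_normE/= sub0r normrN he; lra.
  by rewrite /= -normr_eq0 he gt_eqF.
move: hs; rewrite /hitv/= in_itv/= => /andP[rs s0].
(* One of the two sides of [s] in [-r, 0] has length at least r / 2 and so has room for an increment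
   of size [e]. *)
have [sr|sr] := leP s (- r%:num / 2).
  exists e; apply: Hd; first by rewrite ger0_norm// ltW.
  by rewrite /hitv/= in_itv/=; apply/andP; split; lra.
exists (- e); apply: Hd; first by rewrite normrN ger0_norm// ltW.
by rewrite /hitv/= in_itv/=; apply/andP; split; lra.
Qed.

Lemma derive_onE (V : normedModType R) (y : R -> V) s l : hitv r s ->
  has_derive_on (hitv r) y s l -> derive_on (hitv r) y s = l.
Proof. by move=> hs hl; have PF := within_hitv_proper hs; apply: cvg_lim. Qed.

Fact xd_subproof : {f : Omega * W -> R -> Rn |
  forall p s, f p s = derive_on (hitv r) p.2 s}.
Proof. by eexists. Qed.

Definition xd := sval xd_subproof.

Lemma xdE p s : xd p s = derive_on (hitv r) p.2 s.
Proof. exact: (svalP xd_subproof). Qed.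

(* A point of K is the time-[r] image of another point q of K, so its history
   solves the equation on all of [-r, 0]; this gives the derivative at -r and
   the compatibility condition at 0. *)
Lemma K_derive p : K p -> exists g : R -> Rn, [/\ continuous g,
  (forall t s, 0 <= t -> hitv r s -> has_derive_on (hitv r) (Pi t p).2 s (g (t + s))),
  (forall t, 0 <= t -> g t = rhs (sigma t p.1) (segC (Ksol p) t)) &
  (forall a b c M, - r%:num <= a -> a <= b -> (forall u, a < u < b -> `|g u - c| <= M) ->
     `|Ksol p b - Ksol p a - (b - a) *: c| <= M * (b - a))].
Proof.
move=> Kp; have [q [Kq qp]] := K_backward Kp.
have r0 := r_gt0.
have gq := Ksol_gsol Kq; have [cq q0 dq] := gq.
have pE t : - r%:num <= t -> Ksol p t = Ksol q (t + r%:num).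
  by move=> rt; rewrite -qp Ksol_Pi// ltW.
(* [m t] is the time along [q] that corresponds to time [t] along [p], frozen before -r so that [g]
   is continuous on the whole line. *)
pose m t := Num.max t (- r%:num) + r%:num.
have cm : continuous m by move=> t; apply: cvgD; [exact: continuous_maxr|exact: cvg_cst].
have mE t : - r%:num <= t -> m t = t + r%:num by move=> rt; rewrite /m (max_idPl rt).
pose g t := rhs (sigma (m t) q.1) (segC (Ksol q) (m t)).
have gE t : - r%:num <= t -> has_derive_on Rp (Ksol q) (t + r%:num) (g t).
  by move=> rt; rewrite /g mE//; apply: dq; lra.
exists g; split.
- move=> t; apply: (@continuous_comp _ _ _ m (fun t => rhs (sigma t q.1) (segC (Ksol q) t))).
    exact: cm.
  by apply: (rhs_path_continuous H); exact: segC_continuous.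
- move=> t s t0 hs.
  have hrs := hs; move: hrs; rewrite /hitv/= in_itv/= => /andP[rs s0].
  have rts : - r%:num <= t + s by lra.
  apply: (@eq_has_derive_on _ _ _ (fun s => Ksol q (s + (t + r%:num)))) => //.
    move=> u hu; rewrite Pi_eval// pE; last by move: hu; rewrite /hitv/= in_itv/=; lra.
    by congr (Ksol q _); rewrite addrCA addrA.
  apply: (@has_derive_on_shift _ _ Rp); last first.
    have -> : s + (t + r%:num) = t + s + r%:num by rewrite addrCA addrA.
    exact: gE.
  by move=> u; rewrite /hitv/= !in_itv/= andbT; lra.
- move=> t t0; rewrite /g mE; last by lra.
  have -> : sigma (t + r%:num) q.1 = sigma t p.1 by rewrite (flowD H) -qp.
  apply: (congr1 (rhs (sigma t p.1))).
  transitivity (segC (r := r) (fun s => Ksol q (s + r%:num)) t).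
    exact: esym (segC_shift _ _ _).
  apply: eq_segC => s /andP[h _].
  by rewrite pE//; lra.
- move=> a b c M ra ab gM.
  rewrite !pE//; last by lra.
  set a' := a + r%:num; set b' := b + r%:num.
  have a0 : 0 <= a' by rewrite /a'; lra.
  have ab' : a' <= b' by rewrite /a' /b'; lra.
  have dc := is_derive_scaler c.
  have := @derive_dist_le R n (fun t => Ksol q t - t *: c)
     (fun t => g (t - r%:num) - c) a' b' M _ a0 ab' _ _.
  have -> : b' - a' = b - a by rewrite /a' /b'; lra.
  have -> : Ksol q b' - b' *: c - (Ksol q a' - a' *: c) =
      Ksol q b' - Ksol q a' - (b - a) *: c.
    rewrite opprD addrACA -opprD -scalerBl; congr (_ - _ *: c).
    by rewrite /a' /b'; lra.
  apply.
  + move=> t; apply: cvgB; first exact: cq.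
    exact: is_derive_continuous (dc t).
  + move=> t /andP[h1 h2]; apply: has_derive_onB.
      by have := gE (t - r%:num); rewrite subrK; apply; rewrite /a' in h1; lra.
    exact: is_derive_has_derive_on.
  + move=> t /andP[h1 h2]; apply: gM; rewrite /a' in h1; rewrite /b' in h2.
    by apply/andP; split; lra.
Qed.

Lemma Pi0 p : K p -> Pi 0 p = p.
Proof.
move=> Kp; rewrite [RHS]surjective_pairing; congr pair; first exact: (flow0 H).
apply/val_inj/CfunP => s; rewrite inE => hs.
rewrite [LHS](_ : _ = (Pi 0 p).2 s)// Pi_eval// add0r Ksol_past//.
by move: hs; rewrite /hitv/= in_itv/= => /andP[].
Qed.

Lemma K_has_derive p s : K p -> hitv r s -> has_derive_on (hitv r) p.2 s (xd p s).
Proof.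
move=> Kp hs; have [g [_ Hg _ _]] := K_derive Kp.
have := Hg 0 s (lexx _) hs; rewrite Pi0// => h.
by rewrite xdE (derive_onE hs h).
Qed.

Lemma has_derive_on_hitv_le (V : normedModType R) (y : R -> V) s l M : hitv r s ->
  (forall t, hitv r t -> `|y t - y s| <= M * `|t - s|) ->
  has_derive_on (hitv r) y s l -> `|l| <= M.
Proof.
move=> hs yM hl; have PF := within_hitv_proper hs.
have FF : Filter (within [set h | hitv r (h + s)] 0^') by case: PF.
have h : (fun h => `|growth_rate_on y s h|) @ within [set h | hitv r (h + s)] 0^' --> `|l|.
  by apply: cvg_norm; exact: hl.
rewrite -(cvg_lim _ h)//; apply: limr_le; first by apply/cvg_ex; eexists; exact: h.
rewrite near_withinE; near=> v => hv.
have v0 : v != 0 by near: v; exact: nbhs_dnbhs_neq.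
rewrite /growth_rate_on normrZ normfV ler_pdivrMl ?normr_gt0// mulrC.
by rewrite (le_trans (yM _ hv))// addrK.
Unshelve. all: by end_near. Qed.

(** Histories in K are differentiable at every point of [-r, 0], so the Lipschitz constant of the
    difference bounds the difference of the derivatives pointwise. *)
Lemma xd_dist p q s : K p -> K q -> hitv r s -> `|xd p s - xd q s| <= `|p.2 - q.2|.
Proof.
move=> Kp Kq hs.
have h := has_derive_onB (K_has_derive Kp hs) (K_has_derive Kq hs).
apply: has_derive_on_hitv_le h => // t _.
have -> : p.2 t - q.2 t - (p.2 s - q.2 s) = (p.2 - q.2) t - (p.2 - q.2) s by [].
exact: W_lip.
Qed.

Lemma xd_le p s : K p -> hitv r s -> `|xd p s| <= rho0 K.
Proof.
move=> Kp hs; apply: has_derive_on_hitv_le (K_has_derive Kp hs) => // t _.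
by have [_] := K_ball Kp; exact.
Qed.

Lemma xd_Pi p t s g : K p -> 0 <= t -> hitv r s ->
  (forall t s, 0 <= t -> hitv r s -> has_derive_on (hitv r) (Pi t p).2 s (g (t + s))) ->
  xd (Pi t p) s = g (t + s).
Proof. by move=> Kp t0 hs Hg; rewrite xdE; exact: derive_onE (Hg _ _ t0 hs). Qed.

Lemma K_mean_value p a b c M : K p -> hitv r a -> hitv r b ->
  (forall u, hitv r u -> `|u - a| <= `|b - a| -> `|xd p u - c| <= M) ->
  `|p.2 b - p.2 a - (b - a) *: c| <= M * `|b - a|.
Proof.
move=> Kp ha hb hM; have [g [_ Hg _ Hmv]] := K_derive Kp.
have gE u : hitv r u -> g u = xd p u.
  by move=> hu; have := xd_Pi Kp (lexx _) hu Hg; rewrite add0r Pi0// => <-.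
have ha' := ha; have hb' := hb.
move: ha' hb'; rewrite /hitv/= !in_itv/= => /andP[ra a0] /andP[rb b0].
have hu u v w : - r%:num <= v -> w <= 0 -> v < u < w -> hitv r u.
  by move=> rv w0 /andP[vu uw]; rewrite /hitv/= in_itv/=; apply/andP; split; lra.
have [ab|/ltW ba] := leP a b.
  rewrite (ger0_norm (_ : 0 <= b - a)) ?subr_ge0//.
  rewrite -(Ksol_past Kp a0) -(Ksol_past Kp b0); apply: Hmv => // u uab.
  rewrite gE; last exact: (hu _ _ _ ra b0 uab).
  apply: hM; first exact: (hu _ _ _ ra b0 uab).
  by case/andP: uab => au ub; rewrite !ger0_norm ?subr_ge0// ?lerB// ?ltW.
have -> : `|b - a| = a - b by rewrite distrC ger0_norm ?subr_ge0.
have -> : p.2 b - p.2 a - (b - a) *: c = - (p.2 a - p.2 b - (a - b) *: c).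
  by rewrite opprD opprB opprK -[in RHS](opprB b a) scaleNr.
rewrite normrN -(Ksol_past Kp a0) -(Ksol_past Kp b0); apply: Hmv => // u uab.
rewrite gE; last exact: (hu _ _ _ rb a0 uab).
apply: hM; first exact: (hu _ _ _ rb a0 uab).
case/andP: uab => au ub; rewrite (distrC u a) (distrC b a).
by rewrite (@ger0_norm _ (a - u)) ?(@ger0_norm _ (a - b)); lra.
Qed.

(** Each derivative is uniformly continuous, and W-close histories have uniformly close derivatives;
    an e / 3 argument and compactness of K in W make the modulus common. *)
Lemma xd_equicontinuous e : 0 < e -> exists2 d, 0 < d & forall p s t, K p ->
  hitv r s -> hitv r t -> `|s - t| < d -> `|xd p s - xd p t| <= e.
Proof.
move=> e0; have e3 : 0 < e / 3 by rewrite divr_gt0.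
have e3E : e = e / 3 + e / 3 + e / 3 by lra.
have [||d d0 Hd] := compact_uniform_small (Q := fun d p => K p -> forall s t,
    hitv r s -> hitv r t -> `|s - t| < d -> `|xd p s - xd p t| <= e) (K_cpt HK).
- by move=> d d' q dd' h Kq s t hs ht st; apply: h => //; exact: lt_le_trans dd'.
- move=> p Kp; have [g [cg Hg _ _]] := K_derive Kp.
  have gE u : hitv r u -> g u = xd p u.
    by move=> hu; have := xd_Pi Kp (lexx _) hu Hg; rewrite add0r Pi0// => <-.
  have [d d0 Hd] := uniform_continuous_segment (- r%:num) 0 cg e3.
  exists d => //.
  have : {for p, continuous (fun q : Omega * W => q.2)} by exact: cvg_snd.
  move=> /(@cvgrPdist_le _ _ _ (nbhs p))/(_ _ e3); apply: filterS => q pq Kq s t hs ht st.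
  have h1 := le_trans (xd_dist Kp Kq hs) pq.
  have h2 := le_trans (xd_dist Kp Kq ht) pq.
  have : `|xd p s - xd p t| <= e / 3.
    by rewrite -!gE//; apply: Hd => //; move: hs; rewrite /hitv/= in_itv.
  move=> h3; apply: le_trans (dist_quad (xd p s) (xd q s) (xd p t) (xd q t)) _.
  by rewrite [leRHS]e3E; exact: (lerD (lerD h1 h2) h3).
by exists d => // p s t Kp hs ht st; exact: Hd.
Qed.

(* The W-topology and the C-topology agree on the compact set K. *)
Lemma K_W_small e : 0 < e -> exists2 d, 0 < d & forall p q, K p -> K q ->
  `|toC p.2 - toC q.2| < d -> `|p.2 - q.2| <= e.
Proof.
move=> e0; have e2 : 0 < e / 2 by rewrite divr_gt0.
have near2 (p : Omega * W) e' : 0 < e' -> \forall q \near p, `|p.2 - q.2| < e'.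
  move=> e'0; have : {for p, continuous (fun q : Omega * W => q.2)} by exact: cvg_snd.
  by move=> /(@cvgrPdist_lt _ _ _ (nbhs p)); apply.
have [||d d0 Hd] := compact_uniform_small
    (Q := fun d (z : (Omega * W) * (Omega * W)) => `|toC z.1.2 - toC z.2.2| < d ->
      `|z.1.2 - z.2.2| <= e) (compact_setX (K_cpt HK) (K_cpt HK)).
- by move=> d d' q dd' h hd'; apply: h; exact: lt_le_trans dd'.
- move=> [p q] _; have [pq|pq] := eqVneq p.2 q.2.
    exists 1 => //; exists ([set p' | `|p.2 - p'.2| < e / 2], [set q' | `|q.2 - q'.2| < e / 2]).
      by split; exact: near2.
    move=> [p' q'] /= [h1 h2] _; rewrite -pq in h2.
    have := dist_quad_le (ltW h1) (ltW h2) (dist_refl_le p.2).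
    by rewrite addr0 -splitr.
  (* Distinct histories are at C-distance [m > 0]. Near the pair the distance stays at least
     [m / 2], so the premise fails there. *)
  pose m := `|toC p.2 - toC q.2|.
  have mE : m = m / 4 + m / 4 + m / 2 by exact: quarter_split.
  have m0 : 0 < m.
    by rewrite normr_gt0 subr_eq0; apply: contra pq => /eqP h; apply/eqP/val_inj.
  have m4 : 0 < m / 4 by rewrite divr_gt0.
  exists (m / 2); first by rewrite divr_gt0.
  exists ([set p' | `|p.2 - p'.2| < m / 4], [set q' | `|q.2 - q'.2| < m / 4]).
    by split; exact: near2.
  move=> [p' q'] /= [h1 h2] h3.
  have h4 : `|toC p.2 - toC p'.2| < m / 4 by apply: le_lt_trans h1; exact: (W_norm_C (p.2 - p'.2)).
  have h5 : `|toC q.2 - toC q'.2| < m / 4 by apply: le_lt_trans h2; exact: (W_norm_C (q.2 - q'.2)).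
  rewrite distrC in h4; rewrite distrC in h5.
  exfalso; have : `|toC p.2 - toC q.2| < m / 4 + m / 4 + m / 2.
    apply: le_lt_trans (dist_quad (toC p'.2) (toC p.2) (toC q'.2) (toC q.2)) _.
    exact: ltrD (ltrD h4 h5) h3.
  by rewrite -mE ltxx.
by exists d => // p q Kp Kq; apply: (Hd (p, q)).
Qed.

(** * The operators L(p) for p in K *)

Local Notation Lop := (Lop F tau).

Definition delay p : R := tau p.1 p.2.

Lemma delay_hitvN p : hitv r (- delay p).
Proof. exact: (delay_hitv H). Qed.

Definition D2 p : Rn -> Rn := D2F F p.1 (p.2 0) (p.2 (- delay p)).
Definition D3 p : Rn -> Rn := D3F F p.1 (p.2 0) (p.2 (- delay p)).
Definition Dt p : C -> R := D2tau tau p.1 p.2.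

Lemma LopE p phi : Lop p phi = D2 p (phi 0) + D3 p (phi (- delay p)) -
  Dt p phi *: D3 p (xd p (- delay p)).
Proof. by rewrite xdE. Qed.

Lemma D2B p (v w : Rn) : D2 p (v - w) = D2 p v - D2 p w.
Proof. exact: linearB. Qed.
Lemma D3B p (v w : Rn) : D3 p (v - w) = D3 p v - D3 p w.
Proof. exact: linearB. Qed.
Lemma DtB p phi psi : Dt p (phi - psi) = Dt p phi - Dt p psi.
Proof. exact: linearB. Qed.
Lemma D2Z p (c : R) (v : Rn) : D2 p (c *: v) = c *: D2 p v.
Proof. exact: linearZ. Qed.
Lemma D3Z p (c : R) (v : Rn) : D3 p (c *: v) = c *: D3 p v.
Proof. exact: linearZ. Qed.
Lemma DtZ p (c : R) phi : Dt p (c *: phi) = c * Dt p phi.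
Proof. exact: linearZ. Qed.

Lemma LopB p phi psi : Lop p (phi - psi) = Lop p phi - Lop p psi.
Proof.
rewrite !LopE !C_subE D2B D3B DtB scalerBl.
move: (D2 _ _) (D2 _ _) (D3 _ _) (D3 _ _) (_ *: _) (_ *: _) => a b c d e f.
by apply/rowP => j; rewrite !mxE; ring.
Qed.

Lemma LopZ p (c : R) phi : Lop p (c *: phi) = c *: Lop p phi.
Proof.
rewrite !LopE !C_scaleE D2Z D3Z DtZ -scalerA.
move: (D2 p _) (D3 p (phi _)) (Dt p phi *: _) => a b d.
by apply/rowP => j; rewrite !mxE; ring.
Qed.

Lemma K_eval_le p s : K p -> `|p.2 s| <= rho0 K.
Proof. by move=> Kp; have [h _] := K_ball Kp; exact: h. Qed.

Lemma D3_bounded : exists2 M, 0 < M & forall p, K p -> forall v, `|D3 p v| <= M * `|v|.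
Proof.
have [M M0 HM] := D3F_bounded H (rho0 K); exists M => // p Kp v.
by apply: HM; exact: K_eval_le.
Qed.

Lemma D2_bounded : exists2 M, 0 < M & forall p, K p -> forall v, `|D2 p v| <= M * `|v|.
Proof.
have [M M0 HM] := D2F_bounded H (rho0 K); exists M => // p Kp v.
by apply: HM; exact: K_eval_le.
Qed.

Lemma Dt_bounded : exists2 M, 0 < M & forall p, K p -> forall phi, `|Dt p phi| <= M * `|phi|.
Proof.
have [M M0 HM] := D2tau_bounded H (@hist_ball_pair_compact _ _ _ _ _ _ _ H (rho0 K) (rho0 K)).
by exists M => // p Kp v; apply: HM; exact: (K_ball).
Qed.

Lemma Lop_bounded : exists2 l, 0 < l & forall p phi, K p -> `|Lop p phi| <= l * `|phi|.
Proof.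
have [M2 M20 H2] := D2_bounded; have [M3 M30 H3] := D3_bounded.
have [Mt Mt0 Ht] := Dt_bounded.
(* The sign of [rho0 K] is read off a point of K, so the empty case is separated. *)
have [[p0 Kp0]|nK] := pselect (exists p, K p); last first.
  by exists 1 => // p phi Kp; case: nK; exists p.
have rho_ge0 := rho0_ge0 Kp0.
exists (M2 + M3 + Mt * (M3 * rho0 K)) => [|p phi Kp].
  by rewrite ltr_wpDr ?addr_gt0// !mulr_ge0// ltW.
rewrite LopE (le_trans (ler_normB _ _))// mulrDl lerD//.
  rewrite (le_trans (ler_normD _ _))// mulrDl lerD//.
    by rewrite (le_trans (H2 _ Kp _))// ler_wpM2l ?(ltW M20)// C_norm_ge.
  by rewrite (le_trans (H3 _ Kp _))// ler_wpM2l ?(ltW M30)// C_norm_ge.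
rewrite normrZ mulrAC ler_pM//; first exact: Ht.
rewrite (le_trans (H3 _ Kp _))// ler_wpM2l ?(ltW M30)//.
exact: (xd_le Kp (delay_hitvN p)).
Qed.

Lemma delay_uniform e : 0 < e -> exists2 d, 0 < d & forall p q, K p -> K q ->
  ball p.1 d q.1 -> `|toC p.2 - toC q.2| < d -> `|delay p - delay q| <= e.
Proof.
move=> e0; have [ct _ _ _] := delay_H2 H.
have [p _|d d0 Hd] := compact_uniform_radius
  (Q := fun z z' : Omega * C => `|tau z.1 z.2 - tau z'.1 z'.2| <= e)
  (@hist_ball_pair_compact _ _ _ _ _ _ _ H (rho0 K) (rho0 K)).
  have e2 : 0 < e / 2 by rewrite divr_gt0.
  have := ct p => /(@cvgrPdist_le _ _ _ (nbhs p))/(_ _ e2)/nbhs_ballP[d /= d0 hd].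
  exists d => // z z' /hd h1 /hd h2.
  rewrite (splitr e) (le_trans (ler_distD (tau p.1 p.2) _ _))// lerD//.
  by rewrite distrC.
exists d => // p q Kp Kq b1 b2.
apply: (Hd (p.1, toC p.2) (q.1, toC q.2)); first exact: (K_ball).
by apply: ball_pair => //; rewrite -ball_normE.
Qed.

Lemma derivatives_uniform e : 0 < e -> exists2 d, 0 < d & forall p, K p -> [/\
  forall w a b, ball (p.1, p.2 0, p.2 (- delay p)) d (w, a, b) ->
    forall v, `|D2F F w a b v - D2 p v| <= e * `|v|,
  forall w a b, ball (p.1, p.2 0, p.2 (- delay p)) d (w, a, b) ->
    forall v, `|D3F F w a b v - D3 p v| <= e * `|v| &
  forall w (x : C), ball (p.1, toC p.2) d (w, x) ->
    forall phi, `|D2tau tau w x phi - Dt p phi| <= e * `|phi|].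
Proof.
move=> e0; have [_ _ c2 c3] := delay_H1 H; have [_ _ ct _] := delay_H2 H.
have cb := @box_compact _ _ _ _ _ _ _ H (rho0 K).
have ch := @hist_ball_pair_compact _ _ _ _ _ _ _ H (rho0 K) (rho0 K).
have [d2 d20 Hd2] := op_continuous_uniform c2 (@D2F_hom _ _ _ F) cb e0.
have [d3 d30 Hd3] := op_continuous_uniform c3 (@D3F_hom _ _ _ F) cb e0.
have [dt dt0 Hdt] := op_continuous_uniform ct (@D2tau_hom _ _ _ _ tau) ch e0.
exists (Num.min (Num.min d2 d3) dt); first by rewrite !lt_min d20 d30.
set d := Num.min _ _ => p Kp.
have [dd2 dd3 ddt] : [/\ d <= d2, d <= d3 & d <= dt] by rewrite !ge_min !lexx ?orbT.
have pbox : box (rho0 K) (p.1, p.2 0, p.2 (- delay p)) by split; exact: K_eval_le.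
split=> [w a b h|w a b h|w x h].
- exact: (Hd2 _ _ pbox (le_ball dd2 h)).
- exact: (Hd3 _ _ pbox (le_ball dd3 h)).
- exact: (Hdt (p.1, toC p.2) _ (K_ball Kp) (le_ball ddt h)).
Qed.

(** Here [f] is the norm of [phi] and [g] the distance between its values at the two delays. The
    [A], [B], [C] are values of [D2], of [D3] on [phi], and of [D3] on the derivative of the
    history, and the [s] are values of [Dt]; the operators are changed before their arguments. *)
Lemma lop_diff_arith (A1 A2 B1 B2 B3 C1 C2 C3 : Rn) (s1 s2 e f g M Mt rho : R) :
  0 <= M -> 0 <= Mt -> 0 <= f -> 0 <= e -> 0 <= rho ->
  `|A1 - A2| <= e * f -> `|B1 - B2| <= e * f -> `|B2 - B3| <= M * g ->
  `|s1 - s2| <= e * f -> `|C1| <= M * rho -> `|s2| <= Mt * f ->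
  `|C1 - C2| <= e * rho -> `|C2 - C3| <= M * e ->
  `|A1 + B1 - s1 *: C1 - (A2 + B3 - s2 *: C3)| <=
    e * (2 + M * rho + Mt * rho + Mt * M) * f + M * g.
Proof.
move=> M0 Mt0 f0 e0 rho_ge0 hA hB hB' hs hC hs2 hC1 hC2.
have -> : A1 + B1 - s1 *: C1 - (A2 + B3 - s2 *: C3) =
   (A1 - A2) + (B1 - B2) + (B2 - B3) -
   ((s1 - s2) *: C1 + s2 *: ((C1 - C2) + (C2 - C3))).
  by apply/rowP => j; rewrite !mxE; ring.
have h1 : `|(s1 - s2) *: C1| <= e * f * (M * rho) by rewrite normrZ ler_pM.
have h2 : `|s2 *: ((C1 - C2) + (C2 - C3))| <= Mt * f * (e * rho + M * e).
  rewrite normrZ ler_pM// (le_trans (ler_normD _ _))// lerD//.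
have h3 := lerD (lerD (lerD hA hB) hB') (lerD h1 h2).
rewrite (le_trans (ler_normB _ _))//.
apply: (@le_trans _ _ (e * f + e * f + M * g + (e * f * (M * rho) + Mt * f * (e * rho + M * e)))).
  apply: le_trans h3; rewrite lerD//; last exact: ler_normD.
  by rewrite (le_trans (ler_normD _ _))// lerD2r ler_normD.
by rewrite le_eqVlt; apply/orP; left; apply/eqP; ring.
Qed.

(* Lop p phi is uniformly continuous in p up to the evaluation of phi at the
   two delays, which is why Lop is not norm continuous on C. *)
Lemma Lop_uniform : exists2 M, 0 < M & forall e, 0 < e -> exists2 d, 0 < d &
  forall p q, K p -> K q -> ball p.1 d q.1 -> `|toC p.2 - toC q.2| < d ->
    `|delay p - delay q| <= e /\ forall phi,
    `|Lop p phi - Lop q phi| <=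
      e * `|phi| + M * `|phi (- delay p) - phi (- delay q)|.
Proof.
have [M M0 H3] := D3_bounded; have [Mt Mt0 Ht] := Dt_bounded.
exists M => // e e0.
have [[p0 Kp0]|nK] := pselect (exists p, K p); last first.
  by exists 1 => // p q Kp; case: nK; exists p.
have rho_ge0 := rho0_ge0 Kp0; set rho := rho0 K in rho_ge0.
pose c := 2 + M * rho + Mt * rho + Mt * M.
have c0 : 0 < c.
  by rewrite /c !ltr_wpDr ?mulr_ge0// ltW.
pose e1 := e / c.
have e10 : 0 < e1 by rewrite divr_gt0.
have e12 : 0 < e1 / 2 by rewrite divr_gt0.
have e1c : e1 * c = e by rewrite divfK// gt_eqF.
have [d1 d10 Hd1] := derivatives_uniform e10.
have [de de0 Hde] := xd_equicontinuous e12.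
have [dw dw0 Hdw] := K_W_small e12.
pose m := Num.min (d1 / 2) (Num.min (de / 2) e).
have rho1 : 0 < rho + 1 by rewrite ltr_wpDl.
(* [q.2] has Lipschitz constant [rho], so a change of the delay by at most [eta] moves its value by
   at most [(rho + 1) * eta = m]. *)
pose eta := m / (rho + 1).
have m0 : 0 < m by rewrite !lt_min !divr_gt0.
have eta0 : 0 < eta by rewrite divr_gt0.
have etam : (rho + 1) * eta = m by rewrite mulrC divfK// gt_eqF.
have [dd dd0 Hdd] := delay_uniform eta0.
pose d := Num.min (Num.min d1 dw) (Num.min dd (m / 2)).
exists d; first by rewrite !lt_min d10 dw0 dd0 divr_gt0.
move=> p q Kp Kq b1 b2.
have [dd1 ddw dddd] : [/\ d <= d1, d <= dw & d <= dd].
  by rewrite !ge_min !lexx ?orbT.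
have dm : d <= m / 2 by rewrite !ge_min !lexx ?orbT.
have [md1 mde me] : [/\ m <= d1 / 2, m <= de / 2 & m <= e].
  by rewrite !ge_min !lexx ?orbT.
have tpq : `|delay p - delay q| <= eta.
  by apply: Hdd => //; [exact: le_ball b1|exact: lt_le_trans dddd].
have etam1 : eta <= m by rewrite -etam ler_peMl ?(ltW eta0)// lerDr.
split; first by rewrite (le_trans tpq)// (le_trans etam1).
move=> phi; rewrite -e1c !LopE.
have a0 : `|p.2 0 - q.2 0| < d by rewrite -C_subE (le_lt_trans (C_norm_ge _ _)).
have b0 : `|p.2 (- delay p) - q.2 (- delay q)| < d1.
  have : `|p.2 (- delay p) - q.2 (- delay q)| < m / 2 + m.
    rewrite (le_lt_trans (ler_distD (q.2 (- delay p)) _ _))// ltr_leD//.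
      by rewrite -C_subE (le_lt_trans (C_norm_ge _ _))// (lt_le_trans b2).
    have [_ qN] := K_ball Kq.
    rewrite (le_trans (qN _ _))// -etam ler_pM// ?lerDl// opprK addrC distrC//.
  move: `|_| => z hz; clear -hz md1 m0; lra.
have b1' : ball q.1 d1 p.1 by apply: ball_sym; exact: le_ball b1.
have close : ball (q.1, q.2 0, q.2 (- delay q)) d1 (p.1, p.2 0, p.2 (- delay p)).
  apply: ball_pair; first apply: ball_pair => //.
  - by rewrite -ball_normE/= distrC (lt_le_trans a0).
  - by rewrite -ball_normE/= distrC.
have closeC : ball (q.1, toC q.2) d1 (p.1, toC p.2).
  by apply: ball_pair => //; rewrite -ball_normE/= distrC (lt_le_trans b2).
have [/(_ _ _ _ close) F2 /(_ _ _ _ close) F3 /(_ _ _ closeC) Ft] := Hd1 q Kq.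
have hp := delay_hitvN p; have hq := delay_hitvN q.
have xpq : `|xd p (- delay p) - xd q (- delay q)| <= e1.
  rewrite (splitr e1) (le_trans (ler_distD (xd q (- delay p)) _ _))// lerD//.
    apply: le_trans (xd_dist Kp Kq hp) _.
    by apply: Hdw => //; exact: lt_le_trans ddw.
  apply: Hde => //; rewrite opprK addrC distrC (le_lt_trans tpq)//.
  by clear -etam1 mde de0; lra.
have f1 : `|D2 p (phi 0) - D2 q (phi 0)| <= e1 * `|phi|.
  by rewrite (le_trans (F2 _))// ler_wpM2l ?(ltW e10)// C_norm_ge.
have f2 : `|D3 p (phi (- delay p)) - D3 q (phi (- delay p))| <= e1 * `|phi|.
  by rewrite (le_trans (F3 _))// ler_wpM2l ?(ltW e10)// C_norm_ge.
have f3 : `|D3 q (phi (- delay p)) - D3 q (phi (- delay q))| <=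
    M * `|phi (- delay p) - phi (- delay q)|.
  by rewrite -D3B; exact: H3.
have f4 : `|D3 p (xd p (- delay p))| <= M * rho.
  by rewrite (le_trans (H3 _ Kp _))// ler_wpM2l ?(ltW M0)// (xd_le Kp hp).
have f5 : `|D3 p (xd p (- delay p)) - D3 q (xd p (- delay p))| <= e1 * rho.
  by rewrite (le_trans (F3 _))// ler_wpM2l ?(ltW e10)// (xd_le Kp hp).
have f6 : `|D3 q (xd p (- delay p)) - D3 q (xd q (- delay q))| <= M * e1.
  by rewrite -D3B (le_trans (H3 _ Kq _))// ler_wpM2l// ltW.
exact: (lop_diff_arith (ltW M0) (ltW Mt0) (normr_ge0 phi) (ltW e10) rho_ge0
  f1 f2 f3 (Ft phi) f4 (Ht _ Kq phi) f5 f6).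
Qed.

(** * First-order expansion of the right-hand side along K *)

Lemma linearization_arith (f11 f01 f00 A Y Z D : Rn) (s e f c g M : R) :
  `|f11 - f01 - A| <= e * f -> `|f01 - f00 - Y| <= e * (c * f) ->
  `|Y - (Z - s *: D)| <= M * (g * f) ->
  `|f11 - f00 - (A + Z - s *: D)| <= (e * (1 + c) + M * g) * f.
Proof.
move=> h1 h2 h3.
have -> : f11 - f00 - (A + Z - s *: D) =
    (f11 - f01 - A) + (f01 - f00 - Y) + (Y - (Z - s *: D)).
  by apply/rowP => j; rewrite !mxE; ring.
have -> : (e * (1 + c) + M * g) * f = e * f + e * (c * f) + M * (g * f) by ring.
rewrite (le_trans (ler_normD _ _))// lerD// (le_trans (ler_normD _ _))//.
exact: lerD.
Qed.

(** This expands the delayed value of xb + h when the delay moves by [- D]: [h', h] and [x', x] are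
    the values of h and xb at the new and the old delay, [X] is the derivative of xb at the old one,
    and [- s] is the linear approximation of [D]. *)
Lemma evaluation_arith (h' h x' x X : Rn) (D s e f d T rho : R) :
  0 <= d -> 0 <= e -> 0 <= f ->
  `|D| <= T * f -> `|h' - h| <= d * `|D| -> `|x' - x - D *: X| <= e * `|D| ->
  `|D + s| <= e * f -> `|X| <= rho -> d <= e ->
  `|h' + x' - x - (h - s *: X)| <= e * (2 * T + rho) * f.
Proof.
move=> d0 e0 f0 hD h1 h2 h3 hX de.
have -> : h' + x' - x - (h - s *: X) =
    (h' - h) + (x' - x - D *: X) + (D + s) *: X.
  by apply/rowP => j; rewrite !mxE; ring.
have -> : e * (2 * T + rho) * f = e * (T * f) + e * (T * f) + e * f * rho by ring.
rewrite (le_trans (ler_normD _ _))// lerD//; last by rewrite normrZ ler_pM.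
rewrite (le_trans (ler_normD _ _))// lerD//.
  by rewrite (le_trans h1)// ler_pM.
by rewrite (le_trans h2)// ler_wpM2l.
Qed.

(** The error is relative to the C-norm of the difference h, but h must be small in W: the term h(-
    tau') - h(- tau) is bounded by |h|_W |tau' - tau|, and |tau' - tau| is of order |h|_C. *)
Lemma rhs_linearization e : 0 < e -> exists2 d, 0 < d &
  forall p (phi : W), K p -> `|phi - p.2| <= d ->
    `|rhs p.1 phi - rhs p.1 p.2 - Lop p (toC phi - toC p.2)| <=
      e * `|toC phi - toC p.2|.
Proof.
move=> e0.
have [[p0 Kp0]|nK] := pselect (exists p, K p); last first.
  by exists 1 => // p phi Kp; case: nK; exists p.
have rho_ge0 := rho0_ge0 Kp0; set rho := rho0 K in rho_ge0.
have [M M0 HM3] := D3_bounded.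
have [T T0 HT] := tau_lip H (rho + 1) (rho + 1).
pose C0 := 1 + rho * T.
have C01 : 1 <= C0 by rewrite lerDl mulr_ge0// ltW.
pose c := 1 + C0 + M * (2 * T + rho).
have c0 : 0 < c.
  rewrite /c ltr_wpDr//; last by lra.
  by rewrite mulr_ge0 ?(ltW M0)// addr_ge0// mulr_ge0// ltW.
pose e1 := e / c.
have e10 : 0 < e1 by rewrite divr_gt0.
have e1c : e1 * c = e by rewrite divfK// gt_eqF.
have [_ dF _ _] := delay_H1 H; have [_ dtau _ _] := delay_H2 H.
have [d1' d10 Hd1] := derivatives_uniform e10.
have [de de0 Hde] := xd_equicontinuous e10.
have de2 : de / 2 < de by rewrite ltr_pdivrMr// ltr_pMr// ltr1n.
pose m := d1' / 2.
have m0 : 0 < m by rewrite divr_gt0.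
(* In this order: the arguments of the derivatives stay within the radius [d1'], the delay moves by
   less than the equicontinuity radius [de] of the derivatives, the Lipschitz constant of [h] is at
   most [e1], and [phi] stays in the ball of radius [rho + 1]. *)
pose d := Num.min (Num.min (m / C0) (de / 2 / T)) (Num.min e1 1).
have C00 : 0 < C0 := lt_le_trans ltr01 C01.
have d0 : 0 < d.
  have q1 : 0 < m / C0 by rewrite divr_gt0.
  have q2 : 0 < de / 2 / T by rewrite divr_gt0// divr_gt0.
  by rewrite !lt_min q1 q2 e10 ltr01.
exists d => // p phi Kp.
pose h := phi - p.2; rewrite -/h => hd.
have hE s : toC h s = phi s - p.2 s by [].
rewrite (_ : toC phi - toC p.2 = toC h)//; set f := `|toC h|.
have f0 : 0 <= f by exact: normr_ge0.
have fd : f <= d by exact: le_trans (W_norm_C h) hd.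
have [dm [dde [de1 d1]]] : d <= m / C0 /\ (d <= de / 2 / T /\ (d <= e1 /\ d <= 1)).
  by rewrite !ge_min !lexx ?orbT.
have C0f : C0 * f <= m by rewrite mulrC -ler_pdivlMr// (le_trans fd).
have fm : f <= m by rewrite (le_trans _ C0f)// ler_peMl.
have m1 : m < d1' by rewrite ltr_pdivrMr// ltr_pMr// ltr1n.
have [F2 F3 Ft] := Hd1 p Kp.
have xb : hist_ball (rho + 1) (rho + 1) (toC p.2).
  have [xA xN] := K_ball Kp; split=> [s|s t].
    by rewrite (le_trans (xA s))// lerDl.
  by rewrite (le_trans (xN s t))// ler_wpM2r// lerDl.
have pb : hist_ball (rho + 1) (rho + 1) (toC phi).
  have pW : `|phi| <= rho + 1.
    have -> : phi = p.2 + h by rewrite addrC subrK.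
    rewrite (le_trans (ler_normD _ _))// lerD ?(rho0_ge Kp)//.
    exact: le_trans d1.
  split=> [s|s t]; first by rewrite (le_trans (C_norm_ge _ _))// (le_trans (W_norm_C _)).
  by rewrite (le_trans (W_lip _ _ _))// ler_wpM2r.
pose tau' := tau p.1 phi.
have tf : `|tau' - delay p| <= T * f by exact: HT.
have hp := delay_hitvN p.
have hp' : hitv r (- tau') by exact: (delay_hitv H).
pose D := - tau' - - delay p.
have DE : `|D| = `|tau' - delay p| by rewrite /D opprK addrC distrC.
have DT : `|D| <= T * f by rewrite DE.
have Dde : `|D| < de.
  rewrite (le_lt_trans DT)// mulrC -ltr_pdivlMr// (le_lt_trans (le_trans fd dde))//.
  by rewrite ltr_pM2r ?invr_gt0.
pose X := xd p (- delay p).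
pose a := p.2 0; pose b := p.2 (- delay p); pose a' := phi 0; pose b' := phi (- tau').
have aa : `|a' - a| <= f by rewrite -hE C_norm_ge.
have hmv : `|p.2 (- tau') - p.2 (- delay p) - D *: X| <= e1 * `|D|.
  apply: (K_mean_value Kp hp hp') => u hu ud.
  by apply: Hde => //; exact: le_lt_trans Dde.
have db : `|b' - b| <= C0 * f.
  have -> : b' - b = toC h (- tau') + (p.2 (- tau') - p.2 (- delay p)).
    by rewrite hE addrA subrK.
  rewrite (le_trans (ler_normD _ _))// mulrDl mul1r lerD// ?C_norm_ge//.
  have [_ xN] := K_ball Kp.
  by rewrite (le_trans (xN _ _))// -mulrA ler_wpM2l.
have clos a1 b1 : `|a1 - a| < d1' -> `|b1 - b| < d1' -> ball (p.1, a, b) d1' (p.1, a1, b1).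
  move=> h1 h2; apply: ball_pair; first by apply: ball_pair; [exact: ballxx|
    rewrite -ball_normE/= distrC].
  by rewrite -ball_normE/= distrC.
have tle (V : normedModType R) (v : V) t : 0 <= t <= 1 -> `|t *: v| <= `|v|.
  by move=> /andP[t0 t1]; rewrite normrZ (ger0_norm t0) ler_piMl.
(* The two arguments of [F] are changed one at a time, passing through [F p.1 a b']. *)
have E1 : `|F p.1 a' b' - F p.1 a b' - D2 p (a' - a)| <= e1 * f.
  have E1' : `|F p.1 (a + (a' - a)) b' - F p.1 a b' - D2 p (a' - a)| <= e1 * `|a' - a|.
    apply: (@diff_mean_value R _ n (F p.1 ^~ b') a (a' - a)) => t t01.
    split; first by have [] := dF p.1 (a + t *: (a' - a)) b'.
    have cl : ball (p.1, a, b) d1' (p.1, a + t *: (a' - a), b').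
      apply: clos => //; last by rewrite (le_lt_trans db)// (le_lt_trans C0f).
      rewrite (addrC a) addrK (le_lt_trans (tle _ _ _ t01))// (le_lt_trans aa)//.
      exact: le_lt_trans m1.
    exact: (F2 _ _ _ cl).
  rewrite (addrC a) subrK in E1'.
  by rewrite (le_trans E1')// ler_wpM2l// ltW.
have E2 : `|F p.1 a b' - F p.1 a b - D3 p (b' - b)| <= e1 * (C0 * f).
  have E2' : `|F p.1 a (b + (b' - b)) - F p.1 a b - D3 p (b' - b)| <= e1 * `|b' - b|.
    apply: (@diff_mean_value R _ n (F p.1 a) b (b' - b)) => t t01.
    split; first by have [] := dF p.1 a (b + t *: (b' - b)).
    have cl : ball (p.1, a, b) d1' (p.1, a, b + t *: (b' - b)).
      apply: clos => //; first by rewrite subrr normr0.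
      rewrite (addrC b) addrK (le_lt_trans (tle _ _ _ t01))// (le_lt_trans db)//.
      exact: le_lt_trans m1.
    exact: (F3 _ _ _ cl).
  rewrite (addrC b) subrK in E2'.
  by rewrite (le_trans E2')// ler_wpM2l// ltW.
have E3 : `|tau' - delay p - Dt p (toC h)| <= e1 * f.
  have E3' : `|tau p.1 (toC p.2 + toC h) - tau p.1 p.2 - Dt p (toC h)| <= e1 * f.
    apply: (@diff_mean_value1 R _ (tau p.1) (toC p.2) (toC h)) => t t01.
    split; first exact: dtau.
    have cl : ball (p.1, toC p.2) d1' (p.1, toC p.2 + t *: toC h).
      apply: ball_pair; first exact: ballxx.
      rewrite -ball_normE/= opprD addNKr normrN.
      by rewrite (le_lt_trans (tle _ _ _ t01))// (le_lt_trans fm).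
    exact: (Ft _ _ cl).
  by rewrite (_ : toC p.2 + toC h = toC phi) in E3'; last by rewrite addrC (_ : toC h = toC phi - toC p.2)// subrK.
have E4 : `|b' - b - (toC h (- delay p) - Dt p (toC h) *: X)| <= e1 * (2 * T + rho) * f.
  have hh : `|toC h (- tau') - toC h (- delay p)| <= d * `|D|.
    by rewrite (le_trans (W_lip h _ _))// ler_wpM2r.
  have Ds : `|D + Dt p (toC h)| <= e1 * f.
    rewrite -normrN (_ : - (D + Dt p (toC h)) = tau' - delay p - Dt p (toC h))//.
    by rewrite /D opprD opprB opprK addrC [- delay p + _]addrC addrC.
  have := evaluation_arith (ltW d0) (ltW e10) f0 DT hh hmv Ds (xd_le Kp hp) de1.
  by rewrite hE subrK.
have E5 : `|D3 p (b' - b) - (D3 p (toC h (- delay p)) - Dt p (toC h) *: D3 p X)| <=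
    M * (e1 * (2 * T + rho) * f).
  rewrite -D3Z -!D3B (le_trans (HM3 _ Kp _))// ler_wpM2l// ltW//.
have := linearization_arith E1 E2 E5.
rewrite (_ : (e1 * (1 + C0) + M * (e1 * (2 * T + rho))) = e); last by rewrite -e1c /c; ring.
by rewrite LopE -hE.
Qed.

(** * The linearized equation and its cocycle *)

Local Notation linear_sol := (linear_sol sigma F tau).
Local Notation is_linear_sol := (is_linear_sol sigma F tau).
Local Notation wlin := (wlin sigma F tau).

Lemma base_hist_eq p q : p.1 = q.1 -> toC p.2 = toC q.2 -> p = q.
Proof. by case: p q => [w x] [w' x'] /= -> h; congr pair; exact: val_inj. Qed.

Lemma Pi_add p s t : K p -> 0 <= s -> 0 <= t -> Pi t (Pi s p) = Pi (t + s) p.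
Proof.
move=> Kp s0 t0; have KP := Pi_in Kp s0.
have ts0 : 0 <= t + s by exact: addr_ge0.
apply: base_hist_eq; first by rewrite /= (flowD H).
rewrite (Pi2E KP t0) (Pi2E Kp ts0).
transitivity (segC (r := r) (fun u => Ksol p (u + s)) t).
  apply: eq_segC => u /andP[h _]; apply: (Ksol_Pi Kp s0); lra.
exact: segC_shift.
Qed.

(** With [phi] fixed, its uniform continuity makes the difference of its values at the two delays
    small, which a bound on its norm could not do. *)
Lemma Lop_continuous p phi e : K p -> 0 < e -> exists2 d, 0 < d & forall q psi, K q ->
  ball p.1 d q.1 -> `|toC p.2 - toC q.2| < d -> `|phi - psi| < d ->
  `|Lop p phi - Lop q psi| <= e.
Proof.
move=> Kp e0; have [l l0 Hl] := Lop_bounded; have [M M0 HM] := Lop_uniform.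
have e4 : 0 < e / 4 / M by rewrite !divr_gt0.
have f1 : 0 < `|phi| + 1 by rewrite ltr_wpDl.
have [eta eta0 Heta] := uniform_continuous_segment (- r%:num) 0 (@C_continuous _ _ _ phi) e4.
pose e1 := Num.min (eta / 2) (e / 4 / (`|phi| + 1)).
have e10 : 0 < e1.
  have q1 : 0 < e / 4 / (`|phi| + 1) by rewrite !divr_gt0.
  by rewrite lt_min q1 divr_gt0.
have [d1 d10 Hd1] := HM _ e10.
have e2l : 0 < e / 2 / l by rewrite !divr_gt0.
exists (Num.min d1 (e / 2 / l)); first by rewrite lt_min d10.
move=> q psi Kq b1 b2 b3.
have [dd1 dd2] : Num.min d1 (e / 2 / l) <= d1 /\ Num.min d1 (e / 2 / l) <= e / 2 / l.
  by rewrite !ge_min !lexx ?orbT.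
have [tpq Hpq] := Hd1 p q Kp Kq (le_ball dd1 b1) (lt_le_trans b2 dd1).
have h1 : `|phi (- delay p) - phi (- delay q)| <= e / 4 / M.
  apply: Heta; first by have := delay_hitvN p; rewrite /hitv/= in_itv.
  rewrite opprK addrC distrC (le_lt_trans tpq)// (@le_lt_trans _ _ (eta / 2))//.
    by rewrite ge_min lexx.
  by rewrite ltr_pdivrMr// ltr_pMr// ltr1n.
have h2 := Hpq phi.
have h3 : `|Lop q phi - Lop q psi| <= e / 2.
  rewrite -LopB (le_trans (Hl _ _ Kq))// mulrC -ler_pdivlMr// ltW//.
  exact: lt_le_trans dd2.
rewrite (le_trans (ler_distD (Lop q phi) _ _))// (splitr e) lerD//.
apply: (le_trans h2); rewrite (splitr (e / 2)) lerD//.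
  apply: (@le_trans _ _ (e / 4 / (`|phi| + 1) * (`|phi| + 1))).
    by rewrite ler_pM ?(ltW e10)// ?lerDl// ge_min lexx orbT.
  by rewrite divfK ?gt_eqF// -mulrA -invfM -natrM.
rewrite (le_trans (ler_wpM2l (ltW M0) h1))// mulrC divfK ?gt_eqF//.
by rewrite -mulrA -invfM -natrM.
Qed.

Definition lin p (v : C) (z : R -> Rn) := ivp v (fun t => Lop (Pi t p) (segC z t)) z.

Lemma Pi_continuous p t0 d : K p -> 0 <= t0 -> 0 < d ->
  \forall t \near t0, 0 <= t -> ball (Pi t0 p).1 d (Pi t p).1 /\
     `|toC (Pi t0 p).2 - toC (Pi t p).2| < d.
Proof.
move=> Kp t00 d0.
have c1 := @flow_path_continuous _ _ _ _ _ _ _ H p.1 t0.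
have n1 : \forall t \near t0, ball (sigma t0 p.1) d (sigma t p.1).
  by apply: (c1 (ball (sigma t0 p.1) d)); exact: nbhsx_ballx.
have c2 := @segC_continuous R r n _ (Ksol_continuous Kp) t0.
have n2 : \forall t \near t0, `|segC (r := r) (Ksol p) t0 - segC (Ksol p) t| < d.
  by move: c2 => /(@cvgrPdist_lt _ _ _ (nbhs t0)); apply.
apply: filterS2 n1 n2 => t h1 h2 tt0; split => //.
by rewrite !(Pi2E Kp).
Qed.

(** [Pi] is a semiflow, so time is frozen at 0 to obtain a function that is continuous on the whole
    line and can be integrated. *)
Lemma Lop_path_continuous p (z : R -> Rn) : K p -> continuous z ->
  continuous (fun t => Lop (Pi (Num.max t 0) p) (segC z (Num.max t 0))).
Proof.
move=> Kp cz.
have key t0 : 0 <= t0 -> forall e, 0 < e -> \forall t \near t0, 0 <= t ->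
    `|Lop (Pi t0 p) (segC z t0) - Lop (Pi t p) (segC z t)| <= e.
  move=> t00 e e0; have [d d0 Hd] := Lop_continuous (segC z t0) (Pi_in Kp t00) e0.
  have n1 := Pi_continuous Kp t00 d0.
  have n2 : \forall t \near t0, `|segC (r := r) z t0 - segC z t| < d.
    by have := @segC_continuous R r n _ cz t0 => /(@cvgrPdist_lt _ _ _ (nbhs t0)); apply.
  apply: filterS2 n1 n2 => t h1 h2 tt0; have [b1 b2] := h1 tt0.
  by apply: Hd => //; exact: (Pi_in).
move=> t; apply/(@cvgrPdist_le _ _ _ (nbhs t)) => e e0.
have m0 : 0 <= Num.max t 0 by rewrite le_max lexx orbT.
have := key _ m0 _ e0 => hk.
have hk' : \forall u \near t, 0 <= Num.max u 0 ->
    `|Lop (Pi (Num.max t 0) p) (segC z (Num.max t 0)) -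
      Lop (Pi (Num.max u 0) p) (segC z (Num.max u 0))| <= e.
  exact: ((@continuous_maxr R 0) t _ hk).
by apply: filterS hk' => u; apply; rewrite le_max lexx orbT.
Qed.

(** The operators are bounded on C uniformly over K, so the Picard class can consist of all
    continuous functions with past [v]. *)
Lemma lin_exists p (v : C) : K p -> exists z, lin p v z.
Proof.
move=> Kp; have [l l0 Hl] := Lop_bounded.
pose G t (z : R -> Rn) := Lop (Pi (Num.max t 0) p) (segC z (Num.max t 0)).
pose P (z : R -> Rn) := continuous z /\ forall s, s <= 0 -> z s = v s.
have max_ge0 t : 0 <= Num.max t 0 by rewrite le_max lexx orbT.
have Pv : P v by split => //; exact: C_continuous.
pose N := l * `|v|.
have N0 : 0 <= N by rewrite mulr_ge0// ltW.
have := @picard R n P G v v l (N / (2 * l)) l0 _ (@C_continuous _ _ _ v) (@C_right _ _ _ v) Pv.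
case=> //.
- by rewrite divr_ge0// mulr_ge0// ltW.
- by move=> y [cy _]; exact: Lop_path_continuous.
- by move=> y z Py [cz z0 dz].
- move=> u y Pu uy; split => [t|s s0]; last first.
    apply/eqP; rewrite -subr_eq0 -normr_le0; apply/ler_addgt0Pr => e e0; rewrite add0r.
    have [k0 Hk] := uy s e e0; have [_ us] := Pu k0.
    by rewrite -us// distrC; exact: Hk.
  apply/(@cvgrPdist_le _ _ _ (nbhs t)) => e e0; have e3 : 0 < e / 3 by rewrite divr_gt0.
  have eE : e = e / 3 + e / 3 + e / 3 by lra.
  have [k0 Hk] := uy (t + 1) _ e3; have [cu _] := Pu k0.
  have := cu t => /(@cvgrPdist_le _ _ _ (nbhs t))/(_ _ e3) n1.
  have n2 : \forall t' \near t, `|t - t'| < 1 by exact: (nbhs_normW (x := t) ltr01).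
  apply: filterS2 n1 n2 => t' h1 h2; rewrite eE.
  apply: (dist_quad_le (a := u k0 t) (b := u k0 t')) => //; apply: Hk => //.
    by rewrite lerDl.
  by have := ler_norm (t' - t); rewrite distrC in h2; lra.
- move=> y z t Q [cy y0] [cz z0] t0 yz; rewrite /G (max_idPl t0) -LopB.
  apply: (le_trans (Hl _ _ (Pi_in Kp t0))); rewrite ler_wpM2l ?(ltW l0)//.
  by apply: segC_dist_le => // s /andP[_]; exact: yz.
- move=> z [cz z0 dz] t t0.
  have h : `|z t - v t| <= N * t.
    rewrite (C_right v t0) -(z0 0 (lexx 0)) -[X in _ * X](subr0 t).
    apply: (derive_dist_le cz (lexx 0) t0) => s /andP[s0 _].
      by apply: dz; exact: ltW.
    rewrite /G (le_trans (Hl _ _ (Pi_in Kp (max_ge0 s))))// ler_wpM2l ?(ltW l0)//.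
    apply: segC_norm_le => [|u _]; [exact: C_continuous|exact: C_norm_ge].
  exact: le_trans h (linear_le_expR t l0 N0).
move=> z [_ iz]; exists z; apply: eq_ivp iz => t t0.
by rewrite /G (max_idPl t0).
Qed.

(** The two operators are compared along the reference solution [z] alone. They do not vary
    continuously in norm, so [z] has to be a solution whose values at nearby delays are close. *)
Lemma lin_gronwall : exists2 l, 0 < l & forall p q v w y z T g, K p -> K q ->
  0 <= g -> lin p v y -> lin q w z ->
  (forall t, 0 <= t -> t < T -> `|Lop (Pi t p) (segC z t) - Lop (Pi t q) (segC z t)| <= g) ->
  forall t, 0 <= t <= T -> `|y t - z t| <= 2 * (`|v - w| + g * T) * expR (2 * l * t).
Proof.
have [l l0 Hl] := Lop_bounded; exists l => // p q v w y z T g Kp Kq g0.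
move=> [cy y0 dy] [cz z0 dz] hg.
apply: (@delay_gronwall R n (fun s => y s - z s)
  (fun t => Lop (Pi t p) (segC y t) - Lop (Pi t q) (segC z t)) l) => //.
- by move=> s; apply: cvgB; [exact: cy|exact: cz].
- by move=> s s0; rewrite y0// z0// -C_subE C_norm_ge.
- by move=> t /andP[t0 _]; apply: has_derive_onB; [apply: dy|apply: dz]; exact: ltW.
- move=> t Q /andP[t0 tT] HQ.
  have t0' := ltW t0.
  apply: dist_chain_le (hg t t0' tT).
  rewrite -LopB; apply: le_trans (Hl _ _ (Pi_in Kp t0')) _.
  apply: (ler_wpM2l (ltW l0)).
  by apply: segC_dist_le => // s /andP[_]; exact: HQ.
Qed.

Lemma lin_unique p (v : C) y z t : K p -> lin p v y -> lin p v z -> y t = z t.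
Proof.
move=> Kp hy hz; have [t0|/ltW t0] := leP t 0.
  by have [_ y0 _] := hy; have [_ z0 _] := hz; rewrite y0// z0.
have [l l0 Hg] := lin_gronwall.
have := Hg p p v v y z t 0 Kp Kp (lexx 0) hy hz _ t.
rewrite t0 lexx subrr normr0 mul0r addr0 mulr0 mul0r => h.
apply/eqP; rewrite -subr_eq0 -normr_le0; apply: h => // s _ _.
by rewrite subrr normr0.
Qed.

(* Opaque, so that failing unification problems do not unfold [linear_sol]. *)
Fact zsol_subproof : {f : Omega * W -> C -> R -> Rn |
  forall p v t, f p v t = linear_sol p v (Num.max t (- r%:num))}.
Proof. by eexists. Qed.

Definition zsol := sval zsol_subproof.

Lemma zsolE p (v : C) t : zsol p v t = linear_sol p v (Num.max t (- r%:num)).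
Proof. exact: (svalP zsol_subproof). Qed.

Lemma zsol_lin p (v : C) : K p -> lin p v (zsol p v).
Proof.
move=> Kp; have [z hz] := lin_exists v Kp.
have [cz z0 dz] := hz.
have lz : is_linear_sol p v z.
  split; first by move=> s; rewrite inE /hitv/= in_itv/= => /andP[_]; exact: z0.
    exact: continuous_subspaceT.
  exact: dz.
have [yv cy dy] : is_linear_sol p v (linear_sol p v) by apply: xgetPex; exists z.
have zE t : - r%:num <= t -> zsol p v t = linear_sol p v t.
  by move=> rt; rewrite zsolE (max_idPl rt).
have r0 : 0 < r%:num :> R by [].
split.
- have -> : zsol p v = linear_sol p v \o (fun t => Num.max t (- r%:num)).
    by apply/funext => t; rewrite zsolE.
  apply: (continuous_comp_within cy); first exact: continuous_maxr.
  by move=> t /=; rewrite le_max lexx orbT.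
- move=> s s0; rewrite zsolE.
  have -> : Num.max s (- r%:num) = clamp r s.
    by rewrite /clamp (min_idPr s0) maxC.
  by rewrite -(C_clamp v s); apply: yv; rewrite inE; exact: clamp_in.
- move=> t t0; have rp : Rp t by rewrite /= in_itv/= t0.
  have -> : segC (r := r) (zsol p v) t = segC (linear_sol p v) t.
    by apply: eq_segC => s /andP[h _]; rewrite zE//; lra.
  apply: (@eq_has_derive_on _ _ _ (linear_sol p v)); last exact: dy.
    exact: rp.
  by move=> s; rewrite /= in_itv/= andbT => s0; rewrite zE//; lra.
Qed.

Lemma zsol_continuous p (v : C) : K p -> continuous (zsol p v).
Proof. by move=> /(zsol_lin v)[]. Qed.

Lemma zsol_past p (v : C) s : K p -> s <= 0 -> zsol p v s = v s.
Proof. by move=> /(zsol_lin v)[_ + _]; exact. Qed.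

Lemma wlin_zsol p (v : C) t : 0 <= t -> wlin t p v = segW (zsol p v) t.
Proof.
move=> t0; apply: eq_segW => s /andP[h _]; rewrite zsolE (max_idPl _)//.
by rewrite (le_trans _ h)// -[leLHS]add0r lerD2r.
Qed.

Lemma zsol_growth : exists2 l, 0 < l & forall p v, K p ->
  (forall T t, 0 <= T -> t <= T -> `|zsol p v t| <= 2 * `|v| * expR (2 * l * T)) /\
  (forall T s t, 0 <= s -> s <= t -> t <= T ->
    `|zsol p v t - zsol p v s| <= l * (2 * `|v| * expR (2 * l * T)) * (t - s)).
Proof.
have [l l0 Hl] := Lop_bounded; exists l => // p v Kp.
have [cz z0 dz] := zsol_lin v Kp.
have h1 T t : 0 <= T -> t <= T -> `|zsol p v t| <= 2 * `|v| * expR (2 * l * T).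
  apply: (@delay_gronwall0 R n _ (fun t => Lop (Pi t p) (segC (zsol p v) t)) _ _ _ _ l0 cz).
  - by move=> s s0; rewrite z0// C_norm_ge.
  - by move=> s /andP[s0 _]; apply: dz; exact: ltW.
  - move=> s Q /andP[s0 _] HQ.
    rewrite (le_trans (Hl _ _ (Pi_in Kp (ltW s0))))// ler_wpM2l ?(ltW l0)//.
    by apply: segC_norm_le => // u /andP[_]; exact: HQ.
split => // T s t s0 st tT; apply: (derive_dist_le cz s0 st) => u /andP[su ut].
  by apply: dz; rewrite (le_trans s0)// ltW.
have u0 : 0 <= u by rewrite (le_trans s0)// ltW.
have uT : u <= T by rewrite (le_trans (ltW ut)).
rewrite (le_trans (Hl _ _ (Pi_in Kp u0)))// ler_wpM2l ?(ltW l0)//.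
apply: segC_norm_le => // w /andP[_ wu]; apply: h1; first exact: le_trans uT.
exact: le_trans uT.
Qed.

Lemma le_W_norm_seg (y : R -> Rn) t M : continuous y -> 0 <= M ->
  (forall s, t - r%:num <= s <= t -> `|y s| <= M) ->
  (forall s u, t - r%:num <= s <= t -> t - r%:num <= u <= t ->
     `|y s - y u| <= M * `|s - u|) ->
  `|segW (r := r) y t| <= M.
Proof.
move=> cy M0 yM yL; apply: W_norm_le; rewrite (segWE cy M0 yL).
  exact: segC_norm_le.
by move=> s u _ _; exact: segC_lip.
Qed.

Lemma zsol_lip : exists2 l, 0 < l & forall p (v : W) T, K p -> 0 <= T ->
  (forall s, s <= T -> `|zsol p v s| <= (1 + l) * 2 * expR (2 * l * T) * `|v|) /\
  (forall s t, s <= T -> t <= T ->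
    `|zsol p v s - zsol p v t| <= (1 + l) * 2 * expR (2 * l * T) * `|v| * `|s - t|).
Proof.
have [l l0 Hl] := zsol_growth; exists l => // p v T Kp T0.
have [h1 h2] := Hl p v Kp.
set E := expR (2 * l * T).
have E1 : 1 <= E by rewrite -expR0 ler_expR !mulr_ge0// ltW.
have E0 : 0 < E := lt_le_trans ltr01 E1.
have vW := W_norm_C v.
have b1 : 2 * `|toC v| * E <= (1 + l) * 2 * E * `|v|.
  have -> : (1 + l) * 2 * E * `|v| = (1 + l) * (2 * `|v| * E) by ring.
  apply: (@le_trans _ _ (2 * `|v| * E)); first by rewrite ler_wpM2r ?(ltW E0)// ler_wpM2l.
  by rewrite ler_peMl ?mulr_ge0 ?(ltW E0)// lerDl ltW.
have b2 : l * (2 * `|toC v| * E) <= (1 + l) * 2 * E * `|v|.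
  have -> : (1 + l) * 2 * E * `|v| = (1 + l) * (2 * `|v| * E) by ring.
  rewrite ler_pM// ?mulr_ge0// ?(ltW l0) ?(ltW E0)//; first by rewrite lerDr.
  by rewrite ler_wpM2r ?(ltW E0)// ler_wpM2l.
have b3 : `|v| <= (1 + l) * 2 * E * `|v|.
  rewrite ler_peMl//; apply: le_trans (ler_peMr _ E1); last first.
    by rewrite mulr_ge0// addr_ge0// ltW.
  clear -l0 HK; lra.
split=> [s sT|]; first by rewrite (le_trans (h1 T s T0 sT)).
apply: lip_glue => [s t s0 t0|s t s0 st tT].
  rewrite !(zsol_past)// (le_trans (W_lip v s t))// ler_wpM2r//.
apply: (le_trans (h2 T s t s0 st tT)).
by rewrite ler_wpM2r// subr_ge0.
Qed.

Lemma wlin_toC p (v : W) t : K p -> 0 <= t -> toC (wlin t p v) = segC (zsol p v) t.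
Proof.
move=> Kp t0; have [l l0 Hl] := zsol_lip; have [_ h2] := Hl p v t Kp t0.
rewrite wlin_zsol//.
have N0 : 0 <= (1 + l) * 2 * expR (2 * l * t) * `|v|.
  by rewrite !mulr_ge0 ?expR_ge0// addr_ge0// ltW.
have cz : continuous (zsol p v) by exact: (zsol_continuous Kp).
apply: (segWE cz N0) => s u /andP[_ st] /andP[_ ut].
exact: h2.
Qed.

Lemma wlin_growth T : 0 <= T -> exists2 M, 1 <= M & forall p (v : W) t, K p ->
  0 <= t <= T -> `|wlin t p v| <= M * `|v|.
Proof.
move=> T0; have [l l0 Hl] := zsol_lip.
have E1 : 1 <= expR (2 * l * T) by rewrite -expR0 ler_expR !mulr_ge0// ltW.
have M1 : 1 <= (1 + l) * 2 * expR (2 * l * T).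
  apply: le_trans (ler_peMr _ E1); last by rewrite mulr_ge0// addr_ge0// ltW.
  clear -l0 HK; lra.
exists ((1 + l) * 2 * expR (2 * l * T)) => // p v t Kp /andP[t0 tT].
have [h1 h2] := Hl p v T Kp T0.
rewrite wlin_zsol//; apply: le_W_norm_seg.
- exact: (zsol_continuous Kp).
- by rewrite mulr_ge0// (le_trans ler01).
- by move=> s /andP[_ st]; apply: h1; exact: le_trans tT.
- by move=> s u /andP[_ st] /andP[_ ut]; apply: h2; exact: le_trans tT.
Qed.

(** The segment at time r sees the solution only on [0, r], where the equation bounds its derivative
    by the C-norm of the solution. *)
Lemma wlin_smoothing : exists2 M, 0 < M & forall p (v : C), K p ->
  `|wlin r%:num p v| <= M * `|v|.
Proof.
have [l l0 Hl] := zsol_growth.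
have r0 : 0 <= r%:num :> R by [].
set E := expR (2 * l * r%:num).
have E0 : 0 < E by exact: expR_gt0.
have l10 : 0 < 1 + l by rewrite addr_gt0.
exists ((1 + l) * (2 * E)); first by rewrite !mulr_gt0.
move=> p v Kp; have [h1 h2] := Hl p v Kp.
have e0 : 0 <= 2 * `|v| * E by rewrite !mulr_ge0// ltW.
have -> : (1 + l) * (2 * E) * `|v| = (1 + l) * (2 * `|v| * E) by ring.
rewrite wlin_zsol//; apply: le_W_norm_seg.
- exact: (zsol_continuous Kp).
- by rewrite mulr_ge0// ltW.
- move=> s /andP[_ sr]; rewrite (le_trans (h1 _ _ r0 sr))//.
  by rewrite ler_peMl// lerDl ltW.
- move=> s u; rewrite subrr => /andP[s0 sr] /andP[u0 ur].
  have [su|/ltW us] := leP s u.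
    rewrite distrC (distrC s) (@ger0_norm _ (u - s)) ?subr_ge0//.
    rewrite (le_trans (h2 _ _ _ s0 su ur))// ler_wpM2r ?subr_ge0//.
    by rewrite ler_wpM2r// lerDr.
  rewrite (@ger0_norm _ (s - u)) ?subr_ge0//.
  rewrite (le_trans (h2 _ _ _ u0 us sr))// ler_wpM2r ?subr_ge0//.
  by rewrite ler_wpM2r// lerDr.
Qed.

Lemma zsol_shift p (v : W) c u : K p -> 0 <= c ->
  zsol (Pi c p) (toC (wlin c p v)) u = shiftn (r := r) (zsol p v) c u.
Proof.
move=> Kp c0; have KP := Pi_in Kp c0.
apply: (lin_unique u KP (zsol_lin _ KP)).
rewrite (wlin_toC v Kp c0); apply: eq_ivp (ivp_shift c0 (zsol_lin v Kp)) => t t0.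
by rewrite (Pi_add Kp c0 t0) (segC_shiftn _ _ t0).
Qed.

(** The cocycle identity over [Pi], from uniqueness; it allows decay estimates to be restarted. *)
Lemma wlin_add p (v : W) c t : K p -> 0 <= c -> 0 <= t ->
  wlin (t + c) p v = wlin t (Pi c p) (wlin c p v).
Proof.
move=> Kp c0 t0; have tc : 0 <= t + c by exact: addr_ge0.
transitivity (segW (r := r) (zsol p v) (t + c)); first exact: wlin_zsol.
symmetry; transitivity (segW (r := r) (zsol (Pi c p) (toC (wlin c p v))) t).
  exact: wlin_zsol.
transitivity (segW (r := r) (shiftn (r := r) (zsol p v) c) t); last exact: segW_shiftn.
by apply: eq_segW => s _; exact: zsol_shift.
Qed.

Lemma zsolZ p (c : R) (v : C) t : K p -> zsol p (c *: v) t = c *: zsol p v t.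
Proof.
move=> Kp; apply: (lin_unique (z := fun u => c *: zsol p v u) t Kp (zsol_lin _ Kp)).
have [cz z0 dz] := zsol_lin v Kp; split.
- by move=> s; apply: cvgZl_tmp; exact: cz.
- by move=> s s0; rewrite z0.
- move=> s s0; have -> : segC (r := r) (fun u => c *: zsol p v u) s = c *: segC (zsol p v) s.
    apply: CfunP => u _; rewrite C_scaleE !segCE// => w.
    by apply: cvgZl_tmp; exact: cz.
  by rewrite LopZ; apply: has_derive_onZ; exact: dz.
Qed.

Lemma wlinZ p (c : R) (v : W) t : K p -> 0 <= t ->
  toC (wlin t p (c *: v)) = c *: toC (wlin t p v).
Proof.
move=> Kp t0; apply: etrans (wlin_toC (c *: v) Kp t0) _.
apply: etrans _ (congr1 (fun x : C => c *: x) (esym (wlin_toC v Kp t0))).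
apply: CfunP => s _.
rewrite C_scaleE !segCE; [|exact: (zsol_continuous Kp)..].
exact: zsolZ.
Qed.

(** * Uniform continuous dependence on the points of K *)

Lemma flow_uniform T e : 0 < e -> exists2 d, 0 < d & forall omega omega' t,
  0 <= t <= T -> ball omega d omega' -> ball (sigma t omega) e (sigma t omega').
Proof.
move=> e0; have [cs _ _] := base_flow H.
have cA : compact ([set` `[0, T]] `*` [set: Omega]).
  by apply: compact_setX; [exact: segment_compact|exact: (base_compact H)].
have [z _|d d0 Hd] := compact_uniform_radius
  (Q := fun z z' : R * Omega => ball (sigma z.1 z.2) e (sigma z'.1 z'.2)) cA.
  have e2 : 0 < e / 2 by rewrite divr_gt0.
  have /nbhs_ballP[d /= d0 hd] := cs z _ (nbhsx_ballx (sigma z.1 z.2) _ e2).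
  exists d => // w w' /hd h1 /hd h2; apply: ball_splitr h1 h2.
exists d => // w w' t t01 b; apply: (Hd (t, w) (t, w')); first by split; rewrite //= in_itv.
exact: ball_pair (ballxx _ d0) b.
Qed.

Lemma rhs_uniform e : 0 < e -> exists2 d, 0 < d & forall omega omega' p, K p ->
  ball omega d omega' -> `|rhs omega p.2 - rhs omega' p.2| <= e.
Proof.
move=> e0; have [z _|d d0 Hd] := compact_uniform_radius
  (Q := fun z z' : Omega * C => `|rhs z.1 z.2 - rhs z'.1 z'.2| <= e)
  (@hist_ball_pair_compact _ _ _ _ _ _ _ H (rho0 K) (rho0 K)).
  have e2 : 0 < e / 2 by rewrite divr_gt0.
  have := @rhs_continuous _ _ _ _ _ _ _ H z.
  move=> /(@cvgrPdist_le _ _ _ (nbhs z))/(_ _ e2)/nbhs_ballP[d /= d0 hd].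
  exists d => // w w' /hd h1 /hd h2; rewrite (splitr e).
  by apply: dist_chain_le h2; rewrite distrC.
exists d => // w w' p Kp b; apply: (Hd (w, toC p.2) (w', toC p.2)).
  exact: (K_ball).
exact: ball_pair b (ballxx _ d0).
Qed.

Lemma Ksol_ball p t : K p -> 0 <= t -> hist_ball (rho0 K) (rho0 K) (segC (r := r) (Ksol p) t).
Proof. by move=> Kp t0; rewrite -(Pi2E Kp t0); exact: (K_ball (Pi_in Kp t0)). Qed.

Lemma Pi_diff p q t : K p -> K q -> 0 <= t ->
  toC (Pi t p).2 - toC (Pi t q).2 = segC (Ksol p) t - segC (Ksol q) t.
Proof.
by move=> Kp Kq t0; exact: (congr2 (fun x y : C => x - y) (Pi2E Kp t0) (Pi2E Kq t0)).
Qed.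

(** Gronwall for the difference of the two solutions; the forcing term is the change of the
    right-hand side when only the base point moves, which is uniformly small over K. *)
Lemma Pi_uniform T e : 0 <= T -> 0 < e -> exists2 d, 0 < d & forall p q, K p -> K q ->
  ball p.1 d q.1 -> `|toC p.2 - toC q.2| < d -> forall t, 0 <= t <= T ->
  ball (Pi t p).1 e (Pi t q).1 /\ `|toC (Pi t p).2 - toC (Pi t q).2| < e.
Proof.
move=> T0 e0; have [l l0 Hl] := rhs_lip H (rho0 K) (rho0 K).
pose E := expR (2 * l * T).
have E0 : 0 < E by exact: expR_gt0.
have E1 : 1 <= E by rewrite -expR0 ler_expR !mulr_ge0// ltW.
have T1 : 0 < 1 + T by rewrite ltr_wpDr.
(* The Gronwall bound [2 * (g + g * T) * E] becomes [e / 2], which leaves a strict inequality at the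
   end. *)
pose g := e / 4 / E / (1 + T).
have g0 : 0 < g by rewrite !divr_gt0.
have gE : 2 * (g + g * T) * E = e / 2.
  have -> : 2 * (g + g * T) * E = 2 * (g * (1 + T) * E) by ring.
  by rewrite /g divfK ?gt_eqF// divfK ?gt_eqF//; lra.
have gT0 : 0 <= 2 * (g + g * T).
  by apply: mulr_ge0 => //; apply: addr_ge0; [exact: ltW|apply: mulr_ge0 => //; exact: ltW].
have [d1 d10 Hd1] := rhs_uniform g0.
have [d2 d20 Hd2] := flow_uniform T d10.
have [d3 d30 Hd3] := flow_uniform T e0.
exists (Num.min (Num.min d2 d3) g); first by rewrite !lt_min d20 d30.
set d := Num.min _ _ => p q Kp Kq b1 b2 t t0T.
have [dd2 [dd3 dg]] : d <= d2 /\ (d <= d3 /\ d <= g) by rewrite !ge_min !lexx ?orbT.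
split; first exact: Hd3 (le_ball dd3 b1).
have /andP[t0 tT] := t0T.
rewrite (Pi_diff Kp Kq t0).
have [cp p0 dp] := Ksol_gsol Kp; have [cq q0 dq] := Ksol_gsol Kq.
have key u : u <= T -> `|Ksol p u - Ksol q u| <= e / 2.
  have hg : `|toC p.2 - toC q.2| <= g by rewrite ltW// (lt_le_trans b2).
  have [u0|/ltW u0] := leP u 0.
    move=> _; rewrite p0// q0// -gE -C_subE (le_trans (C_norm_ge _ _))//.
    apply: (le_trans hg).
    have g1 : g <= 2 * (g + g * T).
      have : 0 <= g * T by rewrite mulr_ge0// ltW.
      by move: (g * T) => z z0; clear -g0 z0 HK; lra.
    by rewrite (le_trans g1)// ler_peMr// (le_trans _ g1)// ltW.
  move=> uT; apply: (@le_trans _ _ (2 * (g + g * T) * expR (2 * l * u))); last first.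
    have l20 : 0 <= 2 * l by rewrite mulr_ge0// ltW.
    by rewrite -gE; apply: (ler_wpM2l gT0); rewrite ler_expR; apply: ler_wpM2l.
  apply: (@delay_gronwall R n (fun s => Ksol p s - Ksol q s)
    (fun t => rhs (sigma t p.1) (segC (Ksol p) t) -
              rhs (sigma t q.1) (segC (Ksol q) t)) l g g T) => //.
  - exact: ltW.
  - by move=> s; apply: cvgB; [exact: cp|exact: cq].
  - by move=> s s0; rewrite p0// q0// -C_subE (le_trans (C_norm_ge _ _)).
  - by move=> s /andP[s0 _]; apply: has_derive_onB; [apply: dp|apply: dq]; exact: ltW.
  - move=> s Q /andP[s0 sT] HQ; have s0' := ltW s0.
    have KQs := Pi_in Kq s0'.
    apply: (dist_chain_le (b := rhs (sigma s p.1) (segC (Ksol q) s))).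
      apply: (le_trans (Hl (sigma s p.1) _ _ (Ksol_ball Kp s0') (Ksol_ball Kq s0'))).
      apply: (ler_wpM2l (ltW l0)).
      by apply: segC_dist_le => // w /andP[_]; exact: HQ.
    have Eq := Pi2E Kq s0'; rewrite -Eq; apply: (Hd1 _ _ _ KQs).
    apply: Hd2; first by rewrite s0' ltW.
    exact: le_ball b1.
  - by rewrite u0.
apply: (@le_lt_trans _ _ (e / 2)); last by rewrite ltr_pdivrMr// ltr_pMr// ltr1n.
by apply: segC_dist_le => // s /andP[_ st]; apply: key; exact: le_trans tT.
Qed.

(** The solution through [v0] serves as reference because [v0] is in W: it is Lipschitz with
    constant [B], so its values at two delays differ by at most [B] times their distance. The nearby
    [v] is merely continuous. *)
Lemma zsol_near p0 (v0 : W) T e : K p0 -> 0 <= T -> 0 < e ->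
  exists2 d, 0 < d & forall p (v : C), K p -> ball p0.1 d p.1 ->
    `|toC p0.2 - toC p.2| < d -> `|toC v0 - v| < d -> forall t, 0 <= t <= T ->
    `|zsol p v t - zsol p0 v0 t| <= e.
Proof.
move=> Kp0 T0 e0.
have [l l0 Hl] := zsol_lip; have [l1 l10 Hg] := lin_gronwall.
have [M M0 HM] := Lop_uniform.
have [zb zl] := Hl p0 v0 T Kp0 T0.
set B := (1 + l) * 2 * expR (2 * l * T) * `|v0| in zb zl.
have B0 : 0 <= B by rewrite !mulr_ge0 ?expR_ge0// addr_ge0// ltW.
pose E := expR (2 * l1 * T).
have E0 : 0 < E by exact: expR_gt0.
have T1 : 0 < 1 + T by rewrite ltr_wpDr.
pose g := e / 2 / E / (1 + T).
have g0 : 0 < g by rewrite !divr_gt0.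
have gE : 2 * (g + g * T) * E = e.
  have -> : 2 * (g + g * T) * E = 2 * (g * (1 + T) * E) by ring.
  by rewrite /g divfK ?gt_eqF// divfK ?gt_eqF//; field.
pose c := B * (1 + M) + 1.
have c0 : 0 < c by rewrite ltr_wpDl// mulr_ge0// addr_ge0// ltW.
pose e1 := g / c.
have e10 : 0 < e1 by rewrite divr_gt0.
have e1g : e1 * (B * (1 + M)) <= g.
  rewrite -[leRHS](divfK (lt0r_neq0 c0)); apply: ler_wpM2l; first exact: ltW.
  by rewrite lerDl.
have [d1 d10 Hd1] := HM _ e10.
have [d2 d20 Hd2] := Pi_uniform T0 d10.
exists (Num.min d2 g); first by rewrite lt_min d20.
set d := Num.min _ _ => p v Kp b1 b2 b3 t tT.
have [dd2 dg] : d <= d2 /\ d <= g by rewrite !ge_min !lexx ?orbT.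
have key u : 0 <= u -> u < T -> `|Defs.Lop F tau (Pi u p) (segC (zsol p0 v0) u) -
    Defs.Lop F tau (Pi u p0) (segC (zsol p0 v0) u)| <= g.
  move=> u0 uT; have u0T : 0 <= u <= T by rewrite u0 ltW.
  have [c1 c2] := Hd2 p0 p Kp0 Kp (le_ball dd2 b1) (lt_le_trans b2 dd2) u u0T.
  have [h1 h2] := Hd1 _ _ (Pi_in Kp0 u0) (Pi_in Kp u0) c1 c2.
  rewrite distrC; apply: le_trans (h2 _) (le_trans _ e1g).
  have cz : continuous (zsol p0 v0) by exact: (zsol_continuous Kp0).
  have q1 : `|segC (r := r) (zsol p0 v0) u| <= B.
    by apply: segC_norm_le => // w /andP[_ wu]; apply: zb; rewrite (le_trans wu)// ltW.
  have q2 := segC_lip (r := r) cz B0 (t := u) _.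
  have {}q2 w w' : `|segC (r := r) (zsol p0 v0) u w - segC (r := r) (zsol p0 v0) u w'| <= B * `|w - w'|.
    apply: q2 => a a' /andP[_ au] /andP[_ a'u]; apply: zl.
      by rewrite (le_trans au)// ltW.
    by rewrite (le_trans a'u)// ltW.
  have -> : e1 * (B * (1 + M)) = e1 * B + M * (B * e1) by ring.
  apply: lerD; first by apply: ler_wpM2l q1; exact: ltW.
  apply: ler_wpM2l; first exact: ltW.
  apply: le_trans (q2 _ _) _; apply: ler_wpM2l => //.
  by rewrite opprK addrC distrC.
have /andP[t0 tT'] := tT.
apply: le_trans (Hg p p0 v (toC v0) _ _ T g Kp Kp0 (ltW g0) (zsol_lin v Kp) (zsol_lin (toC v0) Kp0) key t tT) _.
have vg : `|v - toC v0| <= g by rewrite distrC ltW// (lt_le_trans b3).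
have l20 : 0 <= 2 * l1 by rewrite mulr_ge0// ltW.
have gT : 0 <= g * T by rewrite mulr_ge0// ltW.
rewrite -gE; apply: ler_pM.
- by apply: mulr_ge0 => //; apply: addr_ge0.
- exact: expR_ge0.
- by apply: ler_wpM2l => //; rewrite lerD2r.
- by rewrite ler_expR; apply: ler_wpM2l.
Qed.

(** * Uniform exponential decay of the linearized flow *)

Lemma expR_dominates (a b c : R) : 0 < b -> exists2 T0, 1 <= T0 &
  forall T, T0 <= T -> a * expR (- (c + b) * T) <= expR (- c * T).
Proof.
(* Since [1 + x <= expR x], a time of at least [a / b] suffices for the spare rate [b] to absorb the
   constant [a]. *)
move=> b0; exists (Num.max 1 (a / b)); first by rewrite le_max lexx.
move=> T; rewrite ge_max => /andP[T1 aT].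
have -> : - (c + b) * T = - c * T + - (b * T) by ring.
rewrite expRD mulrCA -[leRHS]mulr1 ler_wpM2l ?expR_ge0// expRN.
rewrite ler_pdivrMr ?expR_gt0// mul1r.
rewrite ler_pdivrMr// mulrC in aT.
by rewrite (le_trans aT)// (le_trans _ (expR_ge1Dx _))// lerDr.
Qed.

(* The decay times can be bounded uniformly because K times the W-unit ball is
   compact in the C-topology, in which t -> z(t, p, v) depends continuously on
   (p, v), and w(r, ., .) returns to W. *)
Lemma decay_step (beta beta' : R) : beta < beta' ->
  (forall p (v : W), K p -> exists T0, forall t, T0 <= t ->
     `|wlin t p v| <= expR (- beta' * t)) ->
  exists2 N, 1 <= N & forall p (v : W), K p ->
    exists T, [/\ 1 <= T, T <= N & `|wlin T p v| <= expR (- beta * T) * `|v|].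
Proof.
move=> bb Hdec; have [M M0 HM] := wlin_smoothing.
have b0 : 0 < beta' - beta by rewrite subr_gt0.
have r0 : 0 < r%:num :> R by [].
(* [M] comes from the smoothing step, 2 from adding the decay at the reference point to an error of
   the same size, and the exponential from the extra time r. *)
have [Ts Ts1 HTs] := expR_dominates (M * 2 * expR (beta * r%:num)) beta b0.
have {}HTs T : Ts <= T -> M * (2 * expR (- beta' * T)) <= expR (- beta * (T + r%:num)).
  move=> /HTs; rewrite addrC subrK => h.
  have -> : - beta * (T + r%:num) = - beta * T - beta * r%:num by ring.
  rewrite expRD expRN ler_pdivlMr ?expR_gt0//; apply: le_trans h.
  by rewrite le_eqVlt; apply/orP; left; apply/eqP; ring.
have cA : compact (K `*` @hist_ball R r n 1 1).
  by apply: compact_setX; [exact: (K_cpt HK)|exact: hist_ball_compact].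
have [||N N0 HN] := @compact_uniform_bound R _ _ (fun N (z : (Omega * W) * C) =>
   K z.1 -> hist_ball 1 1 z.2 ->
   exists T, [/\ 1 <= T, T <= N & `|wlin T z.1 z.2| <= expR (- beta * T)]) cA.
- move=> N N' z NN' h Kz bz; have [T [T1 TN hT]] := h Kz bz.
  by exists T; split => //; exact: le_trans NN'.
- move=> [p0 v0'] /= [Kp0 bv0].
  have lv (v : C) : hist_ball 1 1 v -> v \in @lip_hist R r n.
    by move=> [_ vl]; apply/lip_histP; exists 1.
  pose v0 : W := MkWSpace (lv _ bv0).
  have [T0 HT0] := Hdec p0 v0 Kp0.
  (* Past [Ts] the constants are absorbed, past [T0] the reference solution has decayed, and past r
     the segment lies at nonnegative times, where [zsol_near] applies. *)
  pose T1 := Num.max (Num.max Ts T0) r%:num.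
  have [TsT [T0T rT]] : Ts <= T1 /\ (T0 <= T1 /\ r%:num <= T1).
    by rewrite !le_max !lexx ?orbT.
  have T1_0 : 0 <= T1 by exact: le_trans rT.
  have [d d0 Hd] := zsol_near v0 Kp0 T1_0 (expR_gt0 (- beta' * T1)).
  exists (T1 + r%:num); apply/nbhs_ballP; exists d => // -[p v] [[b1 b2] b3] /= Kp bv.
  exists (T1 + r%:num); split => //.
    by rewrite (le_trans Ts1)// (le_trans TsT)// lerDl.
  pose vW : W := MkWSpace (lv _ bv).
  have b2' : `|toC p0.2 - toC p.2| < d.
    move: b2; rewrite -ball_normE/=; apply: le_lt_trans; exact: (W_norm_C (p0.2 - p.2)).
  have b3' : `|toC v0 - v| < d by move: b3; rewrite -ball_normE.
  have hz := Hd p v Kp b1 b2' b3'.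
  have -> : wlin (T1 + r%:num) p v = wlin r%:num (Pi T1 p) (wlin T1 p vW).
    by rewrite addrC; exact: (wlin_add vW Kp T1_0 (ltW r0)).
  apply: le_trans (HM _ _ (Pi_in Kp T1_0)) (le_trans _ (HTs _ TsT)).
  apply: (ler_wpM2l (ltW M0)).
  rewrite (wlin_toC vW Kp T1_0).
  apply: segC_norm_le; first exact: (zsol_continuous Kp).
  move=> s /andP[s1 s2].
  have s0T : 0 <= s <= T1 by apply/andP; split => //; rewrite (le_trans _ s1)// subr_ge0.
  have z0b : `|zsol p0 v0 s| <= expR (- beta' * T1).
    apply: le_trans (HT0 _ T0T); apply: le_trans (W_norm_C _).
    have h1 : hitv r (s - T1).
      by rewrite /hitv/= in_itv/=; apply/andP; split; [rewrite lerBrDl|rewrite subr_le0].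
    rewrite (wlin_toC v0 Kp0 T1_0).
    have -> : zsol p0 v0 s = segC (r := r) (zsol p0 v0) T1 (s - T1).
      rewrite segCE; last exact: (zsol_continuous Kp0).
      by rewrite clamp_id// addrC subrK.
    exact: C_norm_ge.
  have -> : 2 * expR (- beta' * T1) = expR (- beta' * T1) + expR (- beta' * T1) by ring.
  have -> : zsol p vW s = (zsol p v s - zsol p0 v0 s) + zsol p0 v0 s by rewrite subrK.
  by apply: le_trans (ler_normD _ _) _; apply: lerD => //; exact: hz.
exists (Num.max 1 N); first by rewrite le_max lexx.
move=> p v Kp.
have [v0|v0] := eqVneq v 0.
  exists 1; split => //; first by rewrite le_max lexx.
  have [Mg Mg1 HMg] := wlin_growth (ler01 : (0 : R) <= 1).
  have := HMg p v 1 Kp _; rewrite ler01 lexx => /(_ isT).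
  by rewrite v0 !normr0 !mulr0.
have nv : 0 < `|v| by rewrite normr_gt0.
pose w : W := `|v|^-1 *: v.
have w1 : `|w| = 1 by rewrite normrZ normfV normr_id mulVf// gt_eqF.
have bw : hist_ball 1 1 (toC w).
  split=> [s|s t]; first by rewrite (le_trans (C_norm_ge _ _))// (le_trans (W_norm_C _))// w1.
  by rewrite (le_trans (W_lip _ _ _))// w1.
have [T [T1 TN hT]] := HN (p, toC w) (conj Kp bw) Kp bw.
exists T; split => //; first by rewrite le_max TN orbT.
have T0 : 0 <= T by exact: le_trans T1.
have vE : v = `|v| *: w by rewrite scalerA divff ?scale1r// gt_eqF.
have wE : wlin T p v = `|v| *: wlin T p w.
  by apply: val_inj; rewrite {1}vE; exact: (wlinZ `|v| w Kp T0).
by rewrite wE normrZ normr_id mulrC; apply: ler_wpM2r.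
Qed.

(** The step length depends on the point but lies in [1, N]. The lower bound makes the induction on
    an integer above [t] descend; the upper bound limits the final incomplete step, which costs the
    factor [M * expR (beta * N)]. *)
Lemma decay (beta beta' : R) : 0 < beta -> beta < beta' ->
  (forall p (v : W), K p -> exists T0, forall t, T0 <= t ->
     `|wlin t p v| <= expR (- beta' * t)) ->
  exists2 k, 0 < k & forall p (v : W) t, K p -> 0 <= t ->
    `|wlin t p v| <= k * expR (- beta * t) * `|v|.
Proof.
move=> b0 bb Hdec; have [N N1 HN] := decay_step bb Hdec.
have N0 : 0 <= N by exact: le_trans N1.
have [M M1 HM] := wlin_growth N0.
have M0 : 0 < M := lt_le_trans ltr01 M1.
exists (M * expR (beta * N)); first by rewrite mulr_gt0// expR_gt0.
suff ind : forall (m : nat) p (v : W) t, K p -> 0 <= t -> t <= m%:R ->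
    `|wlin t p v| <= M * expR (beta * N) * expR (- beta * t) * `|v|.
  move=> p v t Kp t0; apply: (ind (Num.trunc t).+1) => //.
  by apply: ltW; exact: truncnS_gt.
have small p (v : W) t : K p -> 0 <= t -> t <= N ->
    `|wlin t p v| <= M * expR (beta * N) * expR (- beta * t) * `|v|.
  move=> Kp t0 tN; have := HM p v t Kp; rewrite t0 tN => /(_ isT) h.
  apply: (le_trans h); apply: ler_wpM2r => //; rewrite -mulrA ler_peMr ?(ltW M0)//.
  rewrite -expRD -expR0 ler_expR mulNr -mulrBr mulr_ge0 ?(ltW b0)// subr_ge0//.
elim=> [|m IH] p v t Kp t0 tm.
  by apply: small => //; rewrite (le_trans tm).
have [tN|/ltW Nt] := leP t N; first exact: small.
have [T [T1 TN hT]] := HN p v Kp.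
have T0 : 0 <= T by exact: le_trans T1.
have tT0 : 0 <= t - T by rewrite subr_ge0 (le_trans TN).
have tTm : t - T <= m%:R.
  by rewrite lerBlDr (le_trans tm)// -natr1 lerD2l.
have := wlin_add v Kp T0 tT0; rewrite subrK => ->.
apply: le_trans (IH _ (wlin T p v) _ (Pi_in Kp T0) tT0 tTm) _.
apply: (@le_trans _ _ (M * expR (beta * N) * expR (- beta * (t - T)) * (expR (- beta * T) * `|v|))).
  by apply: ler_wpM2l => //; rewrite !mulr_ge0 ?expR_ge0// ltW.
rewrite mulrA -[X in X * `|v|]mulrA -expRD.
by have -> : - beta * (t - T) + - beta * T = - beta * t by ring.
Qed.

(** * The truncated equation near K *)

Local Notation B := (rho0 K + 1).
Local Notation tsol := (tsol sigma F tau B).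

Lemma tsol_segW omega x y t : 0 <= B -> tsol omega x y ->
  toC (segW (r := r) y t) = segC y t.
Proof.
move=> B0 ty; have [M M0 HM] := rhs_bounded H B.
have yN := tsol_lip B0 HM ty; have [cy _ _] := ty.
have N0 : 0 <= Num.max `|x| M by rewrite le_max normr_ge0.
by apply: (segWE cy N0) => s u _ _; exact: yN.
Qed.

Lemma tsol_shift omega x y c : 0 <= B -> 0 <= c -> tsol omega x y ->
  tsol (sigma c omega) (segW (r := r) y c) (shiftn (r := r) y c).
Proof.
move=> B0 c0 ty; rewrite /(tsol _ _ _) (tsol_segW c B0 ty).
apply: eq_ivp (ivp_shift c0 ty) => t t0.
by rewrite (segC_shiftn _ _ t0) (flowD H).
Qed.

Lemma B_ge0 p : K p -> 0 <= B.
Proof. by move=> Kp; rewrite addr_ge0// (rho0_ge0 Kp). Qed.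

Lemma tsol_growth rho : exists2 l, 0 < l & forall p x y, K p -> `|x| <= rho ->
  tsol p.1 x y ->
  (forall T s, 0 <= T -> s <= T ->
    `|y s - Ksol p s| <= 2 * `|toC x - toC p.2| * expR (2 * l * T)) /\
  (forall a b Q, 0 <= a -> a <= b ->
    (forall s, a - r%:num <= s <= b -> `|y s - Ksol p s| <= Q) ->
    `|(y b - Ksol p b) - (y a - Ksol p a)| <= l * Q * (b - a)).
Proof.
have [M M0 HM] := rhs_bounded H B.
pose N := Num.max (Num.max rho M) (rho0 K).
have [l l0 Hl] := rhs_lip H B N.
exists l => // p x y Kp xr ty.
have B0 := B_ge0 Kp; have rho_ge0 := rho0_ge0 Kp.
have N0 : 0 <= N by rewrite le_max rho_ge0 orbT.
have yN s u : `|y s - y u| <= N * `|s - u|.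
  apply: le_trans (tsol_lip B0 HM ty s u) _; apply: ler_wpM2r => //.
  by rewrite ge_max !le_max xr lexx !orbT.
have [cy y0 dy] := ty; have [ck k0 dk] := Ksol_gsol Kp.
have kb t : 0 <= t -> hist_ball B N (segC (r := r) (Ksol p) t).
  move=> t0; have [kA kN] := Ksol_ball Kp t0; split=> [s|s u].
    by rewrite (le_trans (kA s))// lerDl.
  by rewrite (le_trans (kN s u))// ler_wpM2r// le_max lexx orbT.
have kid t : 0 <= t -> truncC B (segC (r := r) (Ksol p) t) = segC (Ksol p) t.
  by move=> t0; apply: truncC_id; apply: C_norm_le => s _; have [kA _] := kb t t0; exact: kA.
have yb t : hist_ball B N (truncC B (segC (r := r) y t)).
  by apply: truncC_segC_ball.
have dle t Q : 0 <= t -> (forall s, t - r%:num <= s <= t -> `|y s - Ksol p s| <= Q) ->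
    `|rhs (sigma t p.1) (truncC B (segC y t)) - rhs (sigma t p.1) (segC (Ksol p) t)| <= l * Q.
  move=> t0 HQ; apply: le_trans (Hl _ _ _ (yb t) (kb t t0)) _.
  apply: (ler_wpM2l (ltW l0)); rewrite -{1}(kid t t0).
  by apply: le_trans (truncC_dist _ _ _) _; apply: segC_dist_le.
have hD t : 0 <= t -> has_derive_on Rp (fun s => y s - Ksol p s) t
    (rhs (sigma t p.1) (truncC B (segC y t)) - rhs (sigma t p.1) (segC (Ksol p) t)).
  by move=> t0; apply: has_derive_onB; [exact: dy|exact: dk].
have cD : continuous (fun s => y s - Ksol p s) by move=> s; apply: cvgB; [exact: cy|exact: ck].
split.
- move=> T s; apply: (delay_gronwall0 l0 cD).
  + by move=> u u0; rewrite y0// k0// -C_subE C_norm_ge.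
  + by move=> t /andP[t0 _]; apply: hD; exact: ltW.
  + move=> t Q /andP[t0 _] HQ; apply: dle; first exact: ltW.
    by move=> u /andP[_]; exact: HQ.
- move=> a b Q a0 ab HQ.
  apply: (derive_dist_le cD a0 ab) => t /andP[at_ tb].
    by apply: hD; rewrite (le_trans a0)// ltW.
  apply: dle; first by rewrite (le_trans a0)// ltW.
  move=> s /andP[s1 s2]; apply: HQ; apply/andP; split; last by rewrite (le_trans s2)// ltW.
  by apply: le_trans s1; rewrite lerD2r ltW.
Qed.

Definition dW (y : R -> Rn) p t : W := segW y t - segW (Ksol p) t.

Lemma dW_toC omega x y p t : K p -> tsol omega x y ->
  toC (dW y p t) = segC y t - segC (Ksol p) t.
Proof.
move=> Kp ty; have B0 := B_ge0 Kp.
exact: (congr2 (fun a b : C => a - b) (tsol_segW t B0 ty) (gsol_segW H t (Ksol_gsol Kp))).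
Qed.

Lemma dW_le omega x y p t M : K p -> tsol omega x y -> 0 <= M ->
  (forall s, t - r%:num <= s <= t -> `|y s - Ksol p s| <= M) ->
  (forall s u, t - r%:num <= s -> s <= u -> u <= t ->
    `|(y u - Ksol p u) - (y s - Ksol p s)| <= M * (u - s)) ->
  `|dW y p t| <= M.
Proof.
move=> Kp ty M0 h1 h2.
have [cy _ _] := ty; have ck := Ksol_continuous Kp.
have E := dW_toC t Kp ty.
have E' : toC (dW y p t) = segC (fun s => y s - Ksol p s) t by rewrite E segCB.
have cD : continuous (fun s => y s - Ksol p s) by move=> s; apply: cvgB; [exact: cy|exact: ck].
apply: W_norm_le; rewrite E'; first exact: segC_norm_le.
move=> s u _ _; apply: segC_lip => // a b /andP[a1 a2] /andP[b1 b2].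
have [ab|/ltW ba] := leP a b.
  by rewrite distrC (distrC a) (@ger0_norm _ (b - a)) ?subr_ge0//; exact: h2.
by rewrite (@ger0_norm _ (a - b)) ?subr_ge0//; exact: h2.
Qed.

(** The derivative of the difference at a time of [t - r, t] involves one more delay window, whence
    the interval of length 2 r. *)
Lemma dW_smoothing rho : exists2 l, 0 < l & forall p x y t Q, K p -> `|x| <= rho ->
  tsol p.1 x y -> r%:num <= t ->
  (forall s, t - r%:num - r%:num <= s <= t -> `|y s - Ksol p s| <= Q) ->
  `|dW y p t| <= (1 + l) * Q.
Proof.
have [l l0 Hl] := tsol_growth rho; exists l => // p x y t Q Kp xr ty rt HQ.
have [_ h2] := Hl p x y Kp xr ty.
have r0 : 0 < r%:num :> R by [].
have Q0 : 0 <= Q by apply: le_trans (HQ t _); [exact: normr_ge0|apply/andP; split => //; lra].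
have lQ : l * Q <= (1 + l) * Q by rewrite ler_wpM2r// lerDr.
apply: (dW_le Kp ty).
- by apply: mulr_ge0 => //; apply: addr_ge0 => //; exact: ltW.
- move=> s /andP[s1 s2]; apply: le_trans (HQ s _) _; first by apply/andP; split => //; lra.
  by rewrite ler_peMl// lerDl ltW.
- move=> s u s1 su ut; have s0 : 0 <= s by lra.
  apply: le_trans (h2 s u Q s0 su _) _.
    by move=> w /andP[w1 w2]; apply: HQ; apply/andP; split; lra.
  by apply: ler_wpM2r lQ; rewrite subr_ge0.
Qed.

Lemma dW_growth rho T : 0 <= T -> exists2 c, 1 <= c & forall p x y t, K p ->
  `|x| <= rho -> tsol p.1 x y -> 0 <= t <= T -> `|dW y p t| <= c * `|x - p.2|.
Proof.
move=> T0; have [l l0 Hl] := tsol_growth rho.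
set E := expR (2 * l * T).
have E1 : 1 <= E by rewrite -expR0 ler_expR !mulr_ge0// ltW.
have E0 : 0 < E := lt_le_trans ltr01 E1.
have l1 : 1 <= 1 + l by rewrite lerDl ltW.
have c1 : 1 <= (1 + l) * (2 * E).
  rewrite -[leLHS]mulr1; apply: ler_pM => //.
  by rewrite -[leLHS]mulr1; apply: ler_pM => //; rewrite ler1n.
exists ((1 + l) * (2 * E)) => // p x y t Kp xr ty /andP[t0 tT].
have [h1 h2] := Hl p x y Kp xr ty.
pose f := `|x - p.2|; pose Q := 2 * `|toC x - toC p.2| * E.
have fC : `|toC x - toC p.2| <= f by exact: (W_norm_C (x - p.2)).
have Q0 : 0 <= Q by apply: mulr_ge0; [exact: mulr_ge0|exact: ltW].
have f0 : 0 <= f by exact: normr_ge0.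
have Qf : Q <= 2 * E * f.
  rewrite /Q mulrAC; apply: ler_wpM2l fC.
  by apply: mulr_ge0 => //; exact: ltW.
have Ef0 : 0 <= 2 * E * f by exact: le_trans Qf.
set M := (1 + l) * (2 * E) * `|x - p.2|.
have ME : M = (1 + l) * (2 * E * f) by rewrite /M -mulrA.
have QM : Q <= M by rewrite ME (le_trans Qf)// ler_peMl.
have lQM : l * Q <= M.
  by rewrite ME; apply: ler_pM => //; [exact: ltW|rewrite lerDr].
have fM : f <= M by rewrite /M ler_peMl.
have [cy y0 dy] := ty.
have lipD : forall s u, s <= T -> u <= T ->
    `|(y s - Ksol p s) - (y u - Ksol p u)| <= M * `|s - u|.
  apply: (@lip_glue _ _ (fun s => y s - Ksol p s) M T).
    move=> s u s0 u0; rewrite !y0// !(Ksol_past Kp)//.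
    have -> : x s - p.2 s - (x u - p.2 u) = (x - p.2) s - (x - p.2) u by [].
    by apply: le_trans (W_lip _ _ _) _; apply: ler_wpM2r.
  move=> s u s0 su uT; apply: le_trans (h2 s u Q s0 su _) _.
    by move=> w /andP[_ wu]; apply: (h1 T w T0); exact: le_trans uT.
  by apply: ler_wpM2r; rewrite ?subr_ge0.
apply: (dW_le Kp ty).
- exact: le_trans QM.
- by move=> s /andP[_ st]; apply: le_trans QM; apply: (h1 T s T0); exact: le_trans tT.
- move=> s u _ su ut; have uT : u <= T by exact: le_trans tT.
  have := lipD u s uT (le_trans su uT).
  by rewrite (@ger0_norm _ (u - s)) ?subr_ge0.
Qed.

Lemma W_near_norm p x : K p -> `|x - p.2| <= 1 -> `|x| <= B.
Proof.
move=> Kp h; have -> : x = p.2 + (x - p.2) by rewrite addrC subrK.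
by apply: le_trans (ler_normD _ _) _; apply: lerD => //; exact: (rho0_ge Kp).
Qed.

(** Gronwall, with the error of [rhs_linearization] along the orbit as forcing. That error needs the
    segments to be W-close, which is why the initial distance is measured in W. *)
Lemma flow_linearization T e : 0 <= T -> 0 < e -> exists2 d, 0 < d &
  forall p x y, K p -> tsol p.1 x y -> `|x - p.2| <= d -> forall t, 0 <= t <= T ->
    `|y t - Ksol p t - zsol p (toC (x - p.2)) t| <= e * `|x - p.2|.
Proof.
move=> T0 e0; have [c c1 Hc] := dW_growth B T0.
have c0 : 0 < c := lt_le_trans ltr01 c1.
have [l l0 Hl] := Lop_bounded.
pose E := expR (2 * l * T).
have E0 : 0 < E by exact: expR_gt0.
pose e1 := e / (c * (2 * T * E + 1)).
have TE0 : 0 <= 2 * T * E by rewrite !mulr_ge0// ltW.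
have TE1 : 0 < 2 * T * E + 1 by rewrite ltr_wpDl.
have e10 : 0 < e1 by rewrite divr_gt0// mulr_gt0.
have e1E : 2 * (e1 * c * T) * E <= e.
  have -> : 2 * (e1 * c * T) * E = e1 * (c * (2 * T * E)) by ring.
  rewrite -[leRHS](@divfK _ (c * (2 * T * E + 1))); last by rewrite gt_eqF// mulr_gt0.
  apply: ler_wpM2l; first exact: ltW.
  by apply: ler_wpM2l; [exact: ltW|rewrite lerDl].
have [d1 d10 Hd1] := rhs_linearization e10.
(* Up to time [T] W-distances grow by at most the factor [c]. They thus stay below [d1], where the
   expansion of the right-hand side holds, and below 1, where the truncation is the identity. The
   outer 1 puts [x] in the ball of radius [B]. *)
pose d := Num.min 1 (Num.min d1 1 / c).
have d0 : 0 < d by rewrite lt_min ltr01 divr_gt0// lt_min d10 ltr01.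
exists d => // p x y Kp ty xd t tT.
have [dd1 dd2] : d <= 1 /\ d <= Num.min d1 1 / c by rewrite !ge_min !lexx ?orbT.
have xB := W_near_norm Kp (le_trans xd dd1).
have B0 := B_ge0 Kp.
pose f := `|x - p.2|.
have f0 : 0 <= f by exact: normr_ge0.
have ec0 : 0 <= e1 * (c * f).
  by apply: mulr_ge0; [exact: ltW|apply: mulr_ge0 => //; exact: ltW].
have cf : c * f <= Num.min d1 1 by rewrite mulrC -ler_pdivlMr// (le_trans xd).
have dWf s : 0 <= s <= T -> `|dW y p s| <= c * f by exact: Hc.
have [cf1 cfd] : c * f <= 1 /\ c * f <= d1.
  by split; rewrite (le_trans cf)// ge_min lexx ?orbT.
have [cy y0 dy] := ty; have [ck k0 dk] := Ksol_gsol Kp.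
have [cz z0 dz] := zsol_lin (toC (x - p.2)) Kp.
have yid s : 0 <= s <= T -> truncC B (segC (r := r) y s) = segC y s.
  move=> sT; have /andP[s0 _] := sT; apply: truncC_id.
  have -> : segC (r := r) y s = segC (Ksol p) s + toC (dW y p s).
    by rewrite (dW_toC s Kp ty) addrC subrK.
  apply: le_trans (ler_normD _ _) _; apply: lerD.
    by apply: C_norm_le => u _; have [kA _] := Ksol_ball Kp s0; exact: kA.
  by apply: le_trans (W_norm_C _) (le_trans (dWf s sT) cf1).
apply: (@le_trans _ _ (2 * (0 + e1 * (c * f) * T) * expR (2 * l * t))); last first.
  have /andP[t0 tT'] := tT.
  apply: (@le_trans _ _ (2 * (0 + e1 * (c * f) * T) * E)).
    apply: ler_wpM2l.
      by rewrite add0r; apply: mulr_ge0 => //; apply: mulr_ge0.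
    by rewrite ler_expR ler_wpM2l// mulr_ge0// ltW.
  have -> : 2 * (0 + e1 * (c * f) * T) * E = 2 * (e1 * c * T) * E * f by ring.
  exact: ler_wpM2r.
apply: (@delay_gronwall R n (fun s => y s - Ksol p s - zsol p (toC (x - p.2)) s)
  (fun s => rhs (sigma s p.1) (truncC B (segC y s)) - rhs (sigma s p.1) (segC (Ksol p) s) -
     Lop (Pi s p) (segC (zsol p (toC (x - p.2))) s)) l 0 (e1 * (c * f)) T l0) => //.
- by move=> s; apply: cvgB; [apply: cvgB; [exact: cy|exact: ck]|exact: cz].
- move=> s s0; rewrite y0// k0// z0//.
  have -> : toC (x - p.2) s = x s - p.2 s by [].
  exact: dist_refl_le.
- move=> s /andP[s0 _]; have s0' := ltW s0.
  by apply: has_derive_onB; [apply: has_derive_onB; [exact: dy|exact: dk]|exact: dz].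
- move=> s Q /andP[s0 sT] HQ; have s0' := ltW s0.
  have sI : 0 <= s <= T by rewrite s0' ltW.
  rewrite (yid s sI).
  have Kq := Pi_in Kp s0'.
  have e2 : (Pi s p).2 = segW (Ksol p) s by exact: usol_Ksol.
  have h1 : `|segW (r := r) y s - (Pi s p).2| <= d1.
    by rewrite e2; exact: le_trans (dWf s sI) cfd.
  have h2 := Hd1 _ _ Kq h1.
  have e3 : toC (segW (r := r) y s) = segC y s := tsol_segW s B0 ty.
  have e4 : toC (Pi s p).2 = segC (Ksol p) s := Pi2E Kp s0'.
  rewrite e3 in h2; rewrite e4 in h2.
  rewrite [leRHS]addrC.
  apply: (dist_chain_le (b := Lop (Pi s p) (segC y s - segC (Ksol p) s))).
    apply: le_trans h2 _; apply: ler_wpM2l; first exact: ltW.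
    rewrite -(dW_toC s Kp ty); exact: le_trans (W_norm_C _) (dWf s sI).
  rewrite -LopB; apply: le_trans (Hl _ _ Kq) _; apply: (ler_wpM2l (ltW l0)).
  rewrite segCB// segCB//; last by move=> w; apply: cvgB; [exact: cy|exact: ck].
  apply: segC_norm_le => [w|w /andP[_]]; last exact: HQ.
  by apply: cvgB; [apply: cvgB; [exact: cy|exact: ck]|exact: cz].
Qed.

(** * Decay of the nonlinear equation and stability of K *)

Local Notation usol := (usol sigma F tau).

Lemma dW_shift (y : R -> Rn) p c t : K p -> 0 <= c -> 0 <= t ->
  dW (shiftn (r := r) y c) (Pi c p) t = dW y p (t + c).
Proof.
move=> Kp c0 t0.
apply: (congr2 (fun a b : W => a - b)); first exact: segW_shiftn.
apply: etrans (segW_shiftn _ _ t0); apply: eq_segW => s /andP[h _].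
have rs : - r%:num <= s by rewrite (le_trans _ h)// -[leLHS]add0r lerD2r.
by rewrite /shiftn (max_idPl rs); exact: (Ksol_Pi Kp c0 rs).
Qed.

Lemma dist_dW omega x y p t : K p -> tsol omega x y -> `|y t - Ksol p t| <= `|dW y p t|.
Proof.
move=> Kp ty; apply: le_trans (W_norm_C _).
have [cy _ _] := ty; have ck := Ksol_continuous Kp.
have -> : y t - Ksol p t = toC (dW y p t) 0.
  rewrite (dW_toC t Kp ty) C_subE !segCE// clamp_id ?addr0//; exact: hitv0.
exact: C_norm_ge.
Qed.

Lemma zsol_le_wlin p x t : K p -> 0 <= t -> `|zsol p x t| <= `|wlin t p x|.
Proof.
move=> Kp t0; apply: le_trans (W_norm_C _).
have cz : continuous (zsol p x) by exact: (zsol_continuous Kp).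
have -> : zsol p x t = toC (wlin t p x) 0.
  rewrite (wlin_toC x Kp t0) segCE// clamp_id ?addr0//; exact: hitv0.
exact: C_norm_ge.
Qed.

(** On [T - 2 r, T] the difference is the linearized solution plus an error; [dW_smoothing] makes
    this a W-estimate at [T]. The time [T] is chosen so that the linear part gives at most half of
    the target factor, and then [e] so that the error gives the other half. *)
Lemma tsol_decay_step (beta beta' k : R) : 0 < beta' -> beta < beta' -> 0 < k ->
  (forall p (v : W) t, K p -> 0 <= t -> `|wlin t p v| <= k * expR (- beta' * t) * `|v|) ->
  exists T d, [/\ 1 <= T, 0 < d, d <= 1 & forall p x y, K p -> tsol p.1 x y ->
    `|x - p.2| <= d -> `|dW y p T| <= expR (- beta * T) * `|x - p.2|].
Proof.
move=> b'0 bb k0 Hw; have [l l0 Hl] := dW_smoothing B.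
have b0 : 0 < beta' - beta by rewrite subr_gt0.
have r0 : 0 < r%:num :> R by [].
have l10 : 0 < 1 + l by rewrite addr_gt0.
pose rr : R := r%:num + r%:num.
have [T0 T01 HT0] := expR_dominates ((1 + l) * k * expR (beta' * rr) * 2) beta b0.
pose T := Num.max T0 rr.
have [TT0 Tr] : T0 <= T /\ rr <= T by rewrite !le_max !lexx orbT.
have T1 : 1 <= T by exact: le_trans TT0.
have T_0 : 0 <= T by exact: le_trans T1.
have {}HT0 := HT0 T TT0.
pose X := expR (- beta * T).
have X0 : 0 < X by exact: expR_gt0.
pose e := X / 2 / (1 + l).
have e0 : 0 < e by rewrite !divr_gt0.
have [d d0 Hd] := flow_linearization T_0 e0.
exists T, (Num.min d 1); split => //; first by rewrite lt_min d0 ltr01.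
  by rewrite ge_min lexx orbT.
move=> p x y Kp ty xd.
have xd1 : `|x - p.2| <= d by rewrite (le_trans xd)// ge_min lexx.
have xd2 : `|x - p.2| <= 1 by rewrite (le_trans xd)// ge_min lexx orbT.
have xB := W_near_norm Kp xd2.
pose f := `|x - p.2|.
have f0 : 0 <= f by exact: normr_ge0.
pose Q := (k * expR (- beta' * (T - rr)) + e) * f.
have rT : r%:num <= T by rewrite (le_trans _ Tr)// lerDl ltW.
apply: (le_trans (Hl p x y T Q Kp xB ty rT _)).
  move=> s /andP[s1 s2].
  have s1' : T - rr <= s by rewrite /rr opprD addrA.
  have s0 : 0 <= s by rewrite (le_trans _ s1')// subr_ge0.
  have sT : 0 <= s <= T by rewrite s0.
  have h1 := Hd p x y Kp ty xd1 s sT.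
  have h2 := le_trans (zsol_le_wlin (x - p.2) Kp s0) (Hw p (x - p.2) s Kp s0).
  have -> : y s - Ksol p s = zsol p (toC (x - p.2)) s +
      (y s - Ksol p s - zsol p (toC (x - p.2)) s) by rewrite [RHS]addrC subrK.
  apply: le_trans (ler_normD _ _) _; rewrite /Q mulrDl; apply: lerD h1.
  apply: le_trans h2 _; apply: ler_wpM2r => //; apply: ler_wpM2l; first exact: ltW.
  by rewrite ler_expR !mulNr lerN2; apply: ler_wpM2l; first exact: ltW.
rewrite /Q mulrA; apply: ler_wpM2r => //.
have -> : - beta' * (T - rr) = - beta' * T + beta' * rr by ring.
rewrite expRD.
have -> : (1 + l) * (k * (expR (- beta' * T) * expR (beta' * rr)) + e) =
    (1 + l) * k * expR (beta' * rr) * 2 * expR (- beta' * T) / 2 + X / 2.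
  rewrite mulrDr; congr (_ + _); last by rewrite /e mulrC divfK// gt_eqF.
  by field.
have bE : beta + (beta' - beta) = beta' by ring.
rewrite bE -/X in HT0.
apply: (@le_trans _ _ (X / 2 + X / 2)); last by rewrite -splitr.
by apply: lerD => //; apply: ler_wpM2r HT0; rewrite invr_ge0.
Qed.

(** The factor of one step is at most 1, so the point reached after time [T] is again within [d] of
    K and the step repeats with the same constants. *)
Lemma tsol_decay (beta beta' k : R) : 0 < beta -> beta < beta' -> 0 < k ->
  (forall p (v : W) t, K p -> 0 <= t -> `|wlin t p v| <= k * expR (- beta' * t) * `|v|) ->
  exists k' d, [/\ 1 <= k', 0 < d, d <= 1 & forall p x y t, K p -> tsol p.1 x y ->
    `|x - p.2| <= d -> 0 <= t -> `|dW y p t| <= k' * expR (- beta * t) * `|x - p.2|].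
Proof.
move=> b0 bb k0 Hw.
have [T [d [T1 d0 d1 Hd]]] := tsol_decay_step (lt_trans b0 bb) bb k0 Hw.
have T0 : 0 <= T by exact: le_trans T1.
have [c c1 Hc] := dW_growth B T0.
have c0 : 0 < c := lt_le_trans ltr01 c1.
have E1 : 1 <= expR (beta * T) by rewrite -expR0 ler_expR mulr_ge0// ltW.
exists (c * expR (beta * T)), d; split => //.
  by rewrite -[leLHS]mulr1; apply: ler_pM.
suff ind : forall (m : nat) p x y t, K p -> tsol p.1 x y -> `|x - p.2| <= d -> 0 <= t ->
    t <= m%:R -> `|dW y p t| <= c * expR (beta * T) * expR (- beta * t) * `|x - p.2|.
  move=> p x y t Kp ty xd t0; apply: (ind (Num.trunc t).+1 p x y t Kp ty xd t0).
  by apply: ltW; exact: truncnS_gt.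
have small p x y t : K p -> tsol p.1 x y -> `|x - p.2| <= d -> 0 <= t -> t <= T ->
    `|dW y p t| <= c * expR (beta * T) * expR (- beta * t) * `|x - p.2|.
  move=> Kp ty xd t0 tT; have tI : 0 <= t <= T by rewrite t0.
  apply: (le_trans (Hc p x y t Kp (W_near_norm Kp (le_trans xd d1)) ty tI)).
  apply: ler_wpM2r => //; rewrite -mulrA ler_peMr ?(ltW c0)//.
  by rewrite -expRD -expR0 ler_expR mulNr -mulrBr mulr_ge0 ?(ltW b0)// subr_ge0.
elim=> [|m IH] p x y t Kp ty xd t0 tm.
  by apply: small => //; rewrite (le_trans tm).
have [tT|/ltW Tt] := leP t T; first exact: small.
have tT0 : 0 <= t - T by rewrite subr_ge0.
have tTm : t - T <= m%:R by rewrite lerBlDr (le_trans tm)// -natr1 lerD2l.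
have h1 := Hd p x y Kp ty xd.
have KP := Pi_in Kp T0.
have ty' := tsol_shift (B_ge0 Kp) T0 ty.
have e1 : (Pi T p).2 = segW (Ksol p) T by exact: usol_Ksol.
have x'E : segW (r := r) y T - (Pi T p).2 = dW y p T by rewrite e1.
have xd' : `|segW (r := r) y T - (Pi T p).2| <= d.
  apply: (norm_eq_le x'E); apply: le_trans h1 (le_trans _ xd).
  by apply: ler_piMl; [exact: normr_ge0|exact: expRN_le1 (ltW b0) T0].
have := IH (Pi T p) _ _ _ KP ty' xd' tT0 tTm.
rewrite (dW_shift y Kp T0 tT0) subrK x'E => h2; apply: (le_trans h2).
have -> : - beta * t = - beta * (t - T) + - beta * T by ring.
rewrite expRD mulrA -[leRHS]mulrA; apply: ler_wpM2l h1.
apply: mulr_ge0; last exact: expR_ge0.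
by apply: mulr_ge0; [exact: ltW|exact: expR_ge0].
Qed.

Lemma tsol_gsol omega x y : (forall t, `|y t| <= B) -> tsol omega x y -> gsol omega x y.
Proof.
move=> yB ty; have [cy _ _] := ty; apply: eq_ivp ty => t _.
by rewrite truncC_id//; apply: segC_norm_le.
Qed.

Lemma gsol_tsol omega x y : (forall t, `|y t| <= B) -> gsol omega x y -> tsol omega x y.
Proof.
move=> yB gy; have [cy _ _] := gy; apply: eq_ivp gy => t _.
by rewrite truncC_id//; apply: segC_norm_le.
Qed.

Lemma near_Ksol_le p (y : R -> Rn) t : K p -> `|y t - Ksol p t| <= 1 -> `|y t| <= B.
Proof.
move=> Kp h; have -> : y t = Ksol p t + (y t - Ksol p t) by rewrite addrC subrK.
by apply: le_trans (ler_normD _ _) _; apply: lerD => //; exact: (Ksol_le).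
Qed.

Lemma usol_eq omega x y t : gsol omega x y -> 0 <= t -> usol t omega x = segW y t.
Proof.
move=> gy t0; have [_ yE] := gsol_sol H gy.
apply: eq_segW => s /andP[h _]; apply: yE.
by rewrite (le_trans _ h)// -[leLHS]add0r lerD2r.
Qed.

Lemma past_dist omega x y p t : K p -> tsol omega x y -> t <= 0 ->
  `|y t - Ksol p t| <= `|toC x - toC p.2|.
Proof.
move=> Kp [_ y0 _] t0; rewrite y0// (Ksol_past)// -C_subE.
exact: C_norm_ge.
Qed.

Lemma W_exp_stable_of_decay (beta beta' k : R) : 0 < beta -> beta < beta' -> 0 < k ->
  (forall p (v : W) t, K p -> 0 <= t -> `|wlin t p v| <= k * expR (- beta' * t) * `|v|) ->
  W_exp_stable sigma F tau K beta.
Proof.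
move=> b0 bb k0 Hw; have [k' [d [k1 d0 d1 Hd]]] := tsol_decay b0 bb k0 Hw.
have k'0 : 0 < k' := lt_le_trans ltr01 k1.
(* The radius [k'^-1] keeps the truncated solution within distance 1 of K, so that the truncation
   never acts. *)
exists k', (Num.min d k'^-1); split => //; first by rewrite lt_min d0 invr_gt0.
move=> omega xb x Kp; rewrite lt_min => /andP[xd xk].
pose p := (omega, xb).
have [y ty] := tsol_exists H omega x (B_ge0 Kp).
have hd t := Hd p x y t Kp ty (ltW xd).
have E1 t : 0 <= t -> expR (- beta * t) <= 1 by exact: expRN_le1 (ltW b0).
have kx : k' * `|x - xb| <= 1 by rewrite mulrC -ler_pdivlMr// mul1r ltW.
have yB t : `|y t| <= B.
  apply: (near_Ksol_le Kp); have [t0|/ltW t0] := leP t 0.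
    apply: le_trans (past_dist Kp ty t0) _; apply: le_trans (W_norm_C (x - xb)) _.
    by rewrite (le_trans (ltW xd)).
  apply: le_trans (dist_dW t Kp ty) (le_trans (hd t t0) _).
  apply: le_trans kx; rewrite mulrAC ler_piMr// ?E1//.
  by rewrite mulr_ge0// ltW.
have gy := tsol_gsol yB ty.
have [xoo _] := gsol_sol H gy; split; first exact: xoo.
move=> t t0.
have e1 := usol_eq gy t0; have e2 := usol_eq (Ksol_gsol Kp) t0.
exact: norm_eq_le (congr2 (fun a b : W => a - b) e1 e2) (hd t t0).
Qed.

(** Up to time r the difference is bounded by [E] times its initial C-norm; smoothing makes it
    W-small at time r, from where the decay in W takes over. The bound [rho] enters only through the
    constants of this first stage. *)
Lemma C_exp_stable_of_decay (beta beta' k : R) : 0 < beta -> beta < beta' -> 0 < k ->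
  (forall p (v : W) t, K p -> 0 <= t -> `|wlin t p v| <= k * expR (- beta' * t) * `|v|) ->
  C_exp_stable sigma F tau K beta.
Proof.
move=> b0 bb k0 Hw rho _; have [k' [d [k1 d0 d1 Hd]]] := tsol_decay b0 bb k0 Hw.
have k'0 : 0 < k' := lt_le_trans ltr01 k1.
have [l l0 Hl] := tsol_growth rho.
have [l' l'0 Hl'] := dW_smoothing rho.
have r0 : 0 < r%:num :> R by [].
have r0' := ltW r0.
pose E := 2 * expR (2 * l * r%:num).
have E1 : 1 <= E.
  rewrite -[leLHS]mulr1; apply: ler_pM; rewrite ?ler1n//.
  by rewrite -expR0 ler_expR !mulr_ge0// ltW.
have E0 : 0 < E := lt_le_trans ltr01 E1.
pose c := (1 + l') * E.
have Ec : E <= c by rewrite ler_peMl ?(ltW E0)// lerDl ltW.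
have c1 : 1 <= c by exact: le_trans Ec.
have c0 : 0 < c := lt_le_trans ltr01 c1.
pose er := expR (beta * r%:num).
have er1 : 1 <= er by rewrite -expR0 ler_expR mulr_ge0// ltW.
pose K1 := k' * c * er.
have K10 : 0 < K1 := mulr_gt0 (mulr_gt0 k'0 c0) (expR_gt0 _).
have kc1 : 1 <= k' * c by rewrite -[leLHS]mulr1; apply: ler_pM.
have kc0 : 0 < k' * c := lt_le_trans ltr01 kc1.
(* [d / c] makes the W-distance at time r at most [d]; the other radius keeps the solution within 1
   of K. The factor [er] in [K1] pays for the decay starting at r, and also covers all times up to
   r. *)
exists K1, (Num.min (d / c) (k' * c)^-1); split => //.
  by rewrite lt_min divr_gt0// invr_gt0.
move=> omega xb x Kp xr; rewrite le_min => /andP[xd xk].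
pose p := (omega, xb).
have [y ty] := tsol_exists H omega x (B_ge0 Kp).
have [h1 _] := Hl p x y Kp xr ty.
set f := `|toC x - toC xb| in xd xk *.
have f0 : 0 <= f by exact: normr_ge0.
have early s : s <= r%:num -> `|y s - Ksol p s| <= E * f.
  by move=> sr; have := h1 _ s r0' sr; rewrite /E mulrAC.
have dr : `|dW y p r%:num| <= c * f.
  rewrite /c -mulrA; apply: (Hl' p x y r%:num (E * f) Kp xr ty (lexx _)).
  by move=> s /andP[_]; exact: early.
have KP := Pi_in Kp r0'.
have ty' := tsol_shift (B_ge0 Kp) r0' ty.
have e1 : (Pi r%:num p).2 = segW (Ksol p) r%:num by exact: usol_Ksol.
have x'E : segW (r := r) y r%:num - (Pi r%:num p).2 = dW y p r%:num by rewrite e1.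
have cf : c * f <= d by rewrite mulrC -ler_pdivlMr.
have xd' : `|segW (r := r) y r%:num - (Pi r%:num p).2| <= d.
  by rewrite x'E (le_trans dr).
have late t : r%:num <= t -> `|dW y p t| <= k' * expR (- beta * (t - r%:num)) * (c * f).
  move=> rt; have tr0 : 0 <= t - r%:num by rewrite subr_ge0.
  have := Hd _ _ _ _ KP ty' xd' tr0.
  rewrite (dW_shift y Kp r0' tr0) subrK x'E => h; apply: (le_trans h).
  by apply: ler_wpM2l dr; apply: mulr_ge0; [exact: ltW|exact: expR_ge0].
have kcf : k' * c * f <= 1 by rewrite mulrC -(ler_pdivlMr _ _ kc0) mul1r; exact: xk.
have b0' := ltW b0; have k'0' := ltW k'0; have c0' := ltW c0; have E0' := ltW E0.
have fbound t : `|y t - Ksol p t| <= K1 * expR (- beta * t) * f.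
  have [rt|/ltW tr] := leP r%:num t.
    apply: le_trans (dist_dW t Kp ty) (le_trans (late t rt) _).
    by rewrite rate_shift; exact: lexx.
  exact: le_trans (early t tr) (le_rate b0' tr k1 E0' Ec f0).
have yB t : `|y t| <= B.
  apply: (near_Ksol_le Kp); have [rt|/ltW tr] := leP r%:num t.
    apply: le_trans (dist_dW t Kp ty) (le_trans (late t rt) _).
    exact: le_trans (rate_le b0' rt k'0' c0' f0) kcf.
  apply: le_trans (early t tr) (le_trans _ kcf); apply: ler_wpM2r; first exact: f0.
  exact: le_trans Ec (ler_peMl c0' k1).
have gy := tsol_gsol yB ty.
have [xoo solE] := gsol_sol H gy.
have gp := Ksol_gsol Kp; have [_ solEp] := gsol_sol H gp.
split; first exact: xoo.
  move=> t rt.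
  exact: norm_eq_le (congr2 (fun a b : Rn => a - b) (solE t rt) (solEp t rt)) (fbound t).
move=> t t0.
have e3 : toC (usol t omega x) = segC y t.
  exact: etrans (congr1 (@toC R r n) (usol_eq gy t0)) (tsol_segW t (B_ge0 Kp) ty).
have e4 : toC (usol t omega xb) = segC (Ksol p) t.
  exact: etrans (congr1 (@toC R r n) (usol_eq gp t0)) (gsol_segW H t gp).
apply: norm_eq_le (congr2 (fun a b : C => a - b) e3 e4) _.
have [cy _ _] := ty; have ck := Ksol_continuous Kp.
apply: (segC_dist_le cy ck) => s /andP[s1 s2].
apply: le_trans (fbound s) _; apply: ler_wpM2r; first exact: f0.
rewrite -mulrA; apply: ler_wpM2l; first exact: ltW.
rewrite -expRD ler_expR mulNr mulNr -mulrN -mulrN -mulrDr; apply: ler_wpM2l; first exact: ltW.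
by clear -s1 HK; lra.
Qed.

(** * From stability to a negative exponent *)

Local Notation lambda := (upper_lyapunov_exponent sigma F tau K).

Lemma segC_dist_ge (y z : R -> Rn) t : continuous y -> continuous z ->
  `|y t - z t| <= `|segC (r := r) y t - segC z t|.
Proof.
move=> cy cz; apply: le_trans (C_norm_ge _ 0).
by rewrite C_subE !segCE// clamp_id ?addr0//; exact: hitv0.
Qed.

Lemma gsol_dist omega x y p t : K p -> gsol omega x y -> 0 <= t ->
  `|y t - Ksol p t| <= `|toC (usol t omega x) - toC (usol t p.1 p.2)|.
Proof.
move=> Kp gy t0; have [cy _ _] := gy; have ck := Ksol_continuous Kp.
apply: le_trans (segC_dist_ge t cy ck) _.
have e1 := etrans (congr1 (@toC R r n) (usol_eq gy t0)) (gsol_segW H t gy).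
have gp := Ksol_gsol Kp.
have e2 := etrans (congr1 (@toC R r n) (usol_eq gp t0)) (gsol_segW H t gp).
exact: norm_eq_le (esym (congr2 (fun a b : C => a - b) e1 e2)) (lexx _).
Qed.

(** A common consequence of both stability notions: the conclusion is in the weaker norm, the
    initial distance in the stronger one. *)
Definition C_bounded_decay (k d beta : R) : Prop :=
  forall omega (xb x : W), K (omega, xb) -> `|x - xb| <= d -> `|x| <= B ->
    sol_time omega x = +oo%E /\ forall t, 0 <= t ->
      `|toC (usol t omega x) - toC (usol t omega xb)| <= k * expR (- beta * t) * `|x - xb|.

(** For a fixed [t] one small multiple [h] of [v] suffices: the linearization on [0, t] is taken
    with relative error [expR (- beta * t)], the size of the decay itself, which turns [k] into
    [k + 1]. The factor [h] depends on [t] but cancels by linearity. *)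
Lemma zsol_decay k d beta : 0 < beta -> 0 < k -> 0 < d -> C_bounded_decay k d beta ->
  forall p (v : W) t, K p -> 0 <= t -> `|zsol p v t| <= (k + 1) * expR (- beta * t) * `|v|.
Proof.
move=> b0 k0 d0 Hd p v t Kp t0.
have e0 : 0 < expR (- beta * t) by exact: expR_gt0.
have [d1 d10 Hl] := flow_linearization t0 e0.
(* [d] gives stability, [d1] the linearization; [k^-1] and 1 keep the solution within 1 of K at
   positive and at past times, so that it solves the truncated equation as well. *)
pose m := Num.min (Num.min d d1) (Num.min k^-1 1).
have m0 : 0 < m by rewrite !lt_min d0 d10 ltr01 invr_gt0 k0.
have [md md1 mk m1] : [/\ m <= d, m <= d1, m <= k^-1 & m <= 1].
  by split; rewrite !ge_min !lexx ?orbT.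
have v1 : 0 < `|v| + 1 by rewrite ltr_wpDl.
pose h := m / (`|v| + 1).
have h0 : 0 < h by rewrite divr_gt0.
pose x := p.2 + h *: v.
have xE : x - p.2 = h *: v by rewrite /x addrC addKr.
have xN : `|x - p.2| = h * `|v| by rewrite xE normrZ gtr0_norm.
have xm : `|x - p.2| <= m.
  by rewrite xN /h mulrAC ler_pdivrMr// ler_wpM2l ?(ltW m0)// lerDl.
have xB := W_near_norm Kp (le_trans xm m1).
have Kp' : K (p.1, p.2) by rewrite -surjective_pairing.
have [xoo Hx] := Hd p.1 p.2 x Kp' (le_trans xm md) xB.
have [y gy] := sol_time_gsol H xoo.
have near s : 0 <= s -> `|y s - Ksol p s| <= k * expR (- beta * s) * `|x - p.2|.
  by move=> s0; apply: le_trans (gsol_dist Kp gy s0) (Hx s s0).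
have yB s : `|y s| <= B.
  apply: (near_Ksol_le Kp); have [s0|/ltW s0] := leP s 0.
    have [_ y0 _] := gy; rewrite y0// (Ksol_past Kp s0) -C_subE.
    apply: le_trans (C_norm_ge _ _) _; apply: le_trans (W_norm_C (x - p.2)) _.
    exact: le_trans xm m1.
  apply: le_trans (near s s0) _; apply: (@le_trans _ _ (k * `|x - p.2|)).
    apply: ler_wpM2r; first exact: normr_ge0.
    by apply: ler_piMr; [exact: ltW|exact: expRN_le1 (ltW b0) s0].
  by rewrite mulrC -ler_pdivlMr// mul1r (le_trans xm).
have ty := gsol_tsol yB gy.
have tt : 0 <= t <= t by rewrite t0 lexx.
have h1 := Hl p x y Kp ty (le_trans xm md1) t tt.
have zE : zsol p (toC (x - p.2)) t = h *: zsol p v t.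
  by rewrite xE; exact: (zsolZ h v t Kp).
rewrite zE distrC in h1.
have h2 := near t t0.
have hz : `|h *: zsol p v t| <= (k + 1) * expR (- beta * t) * (h * `|v|).
  rewrite -[y t - _]subr0 in h2; have := dist_chain_le h1 h2.
  by rewrite subr0 -xN => /le_trans; apply; rewrite addrC !mulrDl mul1r.
rewrite normrZ gtr0_norm// in hz.
by rewrite -(ler_pM2l h0); apply: le_trans hz _; rewrite mulrCA.
Qed.

(** The decay of values is passed to the W-norm at time t by smoothing from time t - r, whose
    segment reaches back to t - 2 r. Half of the rate is spent on absorbing the constant [a]. *)
Lemma lyapunov_lt0_of_decay k d beta : 0 < beta -> 0 < k -> 0 < d ->
  C_bounded_decay k d beta -> (lambda < 0)%E.
Proof.
move=> b0 k0 d0 Hd; apply: (@le_lt_trans _ _ (- (beta / 2))%:E); last first.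
  by rewrite lte_fin oppr_lt0 divr_gt0.
have zd := zsol_decay b0 k0 d0 Hd.
have [M M0 HM] := wlin_smoothing.
have r0 : 0 <= r%:num :> R by [].
apply: ge_ereal_sup => _ [p Kp <-]; apply: ge_ereal_sup => _ [v _ <-].
pose a := M * ((k + 1) * expR (beta * (r%:num + r%:num)) * `|v|).
have b2 : 0 < beta / 2 by rewrite divr_gt0.
have [T0 T01 HT0] := expR_dominates a (beta / 2) b2.
apply: (@limf_esup_pinfty_le _ _ _ (Num.max T0 (r%:num + r%:num))) => t.
rewrite gt_max => /andP[T0t rt].
have t0 : 0 < t by rewrite (lt_trans _ T0t)// (lt_le_trans ltr01).
rewrite lne_rate_le//; apply: le_trans (HT0 t (ltW T0t)).
have bE : beta / 2 + beta / 2 = beta by rewrite -splitr.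
rewrite bE.
have c0 : 0 <= t - r%:num by rewrite subr_ge0 (le_trans _ (ltW rt))// lerDl.
have tE : r%:num + (t - r%:num) = t by rewrite addrC subrK.
rewrite -{1}tE (wlin_add v Kp c0 r0).
apply: le_trans (HM _ _ (Pi_in Kp c0)) _.
rewrite /a -[leRHS]mulrA; apply: ler_wpM2l; first exact: ltW.
rewrite (wlin_toC v Kp c0).
apply: segC_norm_le => [|s /andP[s1 _]]; first exact: (zsol_continuous Kp).
have s0 : 0 <= s.
  by rewrite (le_trans _ s1)// -addrA -opprD subr_ge0 ltW.
apply: le_trans (zd p v s Kp s0) _; rewrite [leRHS]mulrAC; apply: ler_wpM2r => //.
rewrite -mulrA; apply: ler_wpM2l; first by rewrite addr_ge0// ltW.
rewrite -expRD ler_expR !mulNr -mulrBr -mulrN; apply: ler_wpM2l; first exact: ltW.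
by rewrite lerNl opprB opprD addrA.
Qed.

(** The constants depend on [rho], but the single value [B] is enough, since the perturbed points
    stay within 1 of K. *)
Lemma C_exp_stable_lyapunov_lt0 beta : 0 < beta -> C_exp_stable sigma F tau K beta ->
  (lambda < 0)%E.
Proof.
move=> b0 Hst; have B1 : rho0 K < B by rewrite ltrDl.
have [k [d [k0 d0 Hd]]] := Hst B B1.
apply: (@lyapunov_lt0_of_decay (k * expR (beta * r%:num)) d beta) => //.
  by rewrite mulr_gt0// expR_gt0.
move=> omega xb x Kx xd xB.
have xC : `|toC x - toC xb| <= `|x - xb| by exact: (W_norm_C (x - xb)).
have [xoo _ hu] := Hd omega xb x Kx xB (le_trans xC xd); split; first exact: xoo.
move=> t t0; apply: le_trans (hu t t0) _; apply: ler_wpM2l xC.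
by rewrite !mulr_ge0 ?expR_ge0// ltW.
Qed.

Lemma W_exp_stable_lyapunov_lt0 beta : 0 < beta -> W_exp_stable sigma F tau K beta ->
  (lambda < 0)%E.
Proof.
move=> b0 [k [d [k1 d0 Hd]]].
have d20 : 0 < d / 2 by rewrite divr_gt0.
apply: (@lyapunov_lt0_of_decay k (d / 2) beta b0 (lt_le_trans ltr01 k1) d20).
move=> omega xb x Kx xd _; have xd' : `|x - xb| < d.
  by rewrite (le_lt_trans xd)// ltr_pdivrMr// ltr_pMr// ltr1n.
have [xoo hu] := Hd omega xb x Kx xd'; split; first exact: xoo.
by move=> t t0; apply: le_trans (hu t t0); exact: (W_norm_C (usol t omega x - usol t omega xb)).
Qed.

(** * From a negative exponent to stability *)

Lemma lyapunov_eventual_decay beta p (v : W) : (lambda < (- beta)%:E)%E -> K p ->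
  exists T0, forall t, T0 <= t -> `|wlin t p v| <= expR (- beta * t).
Proof.
move=> lb Kp; have [->|v0] := eqVneq v 0.
  exists 0 => t t0; have [M _ HM] := wlin_growth t0.
  have tt : 0 <= t <= t by rewrite t0 lexx.
  by apply: le_trans (HM p 0 t Kp tt) _; rewrite normr0 mulr0 expR_ge0.
have : (lyapunov_exponent sigma F tau p v < (- beta)%:E)%E.
  apply: le_lt_trans lb; apply: (@le_trans _ _
    (ereal_sup [set lyapunov_exponent sigma F tau p v | v in [set v : W | v != 0]])).
    by apply: ereal_sup_ubound; exists v.
  by apply: ereal_sup_ubound; exists p.
move=> /limf_esup_pinfty_lt[M HM]; exists (Num.max M 0 + 1) => t Mt.
have {}Mt : Num.max M 0 < t by rewrite (lt_le_trans _ Mt)// ltrDl.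
move: Mt; rewrite gt_max => /andP[Mt t0].
by rewrite -lne_rate_le//; apply: ltW; exact: HM.
Qed.

(** Room is made for two losses: [b2] is an eventual rate for each solution, [b1] a uniform rate of
    the linearized flow, and [beta] the rate of the nonlinear one. The exponent may be -oo, and then
    any [b2] above [beta] will do. *)
Lemma lyapunov_exp_stable beta : 0 < beta -> (beta%:E < - lambda)%E ->
  C_exp_stable sigma F tau K beta /\ W_exp_stable sigma F tau K beta.
Proof.
move=> b0 bl.
have [b2 bb2 lb2] : exists2 b2 : R, beta < b2 & (lambda < (- b2)%:E)%E.
  move: bl; rewrite lteNr; case: (lambda) => [l| |].
  - rewrite -EFinN lte_fin => bl; exists ((beta - l) / 2); last by rewrite lte_fin; lra.
    lra.
  - by [].
  - by exists (beta + 1); [rewrite ltrDl|rewrite ltNyr].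
pose b1 := (beta + b2) / 2.
have bb1 : beta < b1 by rewrite /b1; lra.
have b12 : b1 < b2 by rewrite /b1; lra.
have [k k0 Hk] := decay (lt_trans b0 bb1) b12
  (fun p v Kp => lyapunov_eventual_decay v lb2 Kp).
split.
  exact: (C_exp_stable_of_decay b0 bb1 k0 Hk).
exact: (W_exp_stable_of_decay b0 bb1 k0 Hk).
Qed.

Lemma lyapunov_rate_exists : (lambda < 0)%E ->
  exists2 beta : R, 0 < beta & (beta%:E < - lambda)%E.
Proof.
case: (lambda) => [l| |] //; last by move=> _; exists 1; rewrite ?ltr01 ?ltry.
rewrite lte_fin => l0; exists (- l / 2); first lra.
by rewrite -EFinN lte_fin; lra.
Qed.

End invariant_set.

Theorem theorem5p2 (R : realType) (r : {posnum R}) (n : nat) (n_ge1 : (1 <= n)%N)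
  (Omega : metricType R) (Omega_compact : compact [set: Omega])
  (sigma : R -> Omega -> Omega) (sigma_flow : continuous_flow sigma)
  (F : Omega -> 'rV[R]_n -> 'rV[R]_n -> 'rV[R]_n)
  (tau : Omega -> CSpace r n -> R)
  (tau_range : forall omega x, 0 <= tau omega x <= r%:num)
  (F_H1 : cond_H1 F) (tau_H2 : cond_H2 tau)
  (K : set (Omega * WSpace r n)) (K_compact : compact K)
  (K_invariant : positively_invariant sigma F tau K)
  (K_projects : projects_over_base K)
  (K_backward : forall p, K p -> backward_extension sigma F tau K p) :
  let lambdaK := upper_lyapunov_exponent sigma F tau K in
  [/\ (lambdaK < 0)%E <->
        (exists2 beta : R, 0 < beta & C_exp_stable sigma F tau K beta),
      (lambdaK < 0)%E <->
        (exists2 beta : R, 0 < beta & W_exp_stable sigma F tau K beta) &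
      (lambdaK < 0)%E -> forall beta : R, 0 < beta -> (beta%:E < - lambdaK)%E ->
        C_exp_stable sigma F tau K beta /\ W_exp_stable sigma F tau K beta].
Proof.
have HK := KHyps (DelayHyps Omega_compact sigma_flow tau_range F_H1 tau_H2)
  K_compact K_invariant K_backward.
split.
- split=> [/lyapunov_rate_exists[beta b0 bl]|[beta b0]].
    by exists beta => //; have [] := lyapunov_exp_stable HK b0 bl.
  exact: C_exp_stable_lyapunov_lt0.
- split=> [/lyapunov_rate_exists[beta b0 bl]|[beta b0]].
    by exists beta => //; have [] := lyapunov_exp_stable HK b0 bl.
  exact: W_exp_stable_lyapunov_lt0.
- by move=> _ beta; exact: lyapunov_exp_stable.
Qed.
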